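(* Let $r\ge1$ and let $N$ be a nonzero proper ideal of $A$. With respect to the metric $\mathrm d_{\overleftarrow{\mathcal L_N^r}}$, the space $\overleftarrow{\mathcal L_N^r}$ is the completion of $\mathcal L_N^r$; that is, $\overleftarrow{\mathcal L_N^r}$ is complete and $\mathcal L_N^r$ is a dense subset of it.
   Context: Setting. $F$ is a global function field of prime characteristic with field of constants $\mathbb F_q$; $\infty$ is a fixed place of $F$ of degree $\delta$; $A\subset F$ is the ring of elements regular away from $\infty$; $|\cdot|$ is the absolute value at $\infty$ with $|\pi|=q^{-\delta}$ for a uniformiser $\pi$; $F_\infty$ is the completion of $F$, and $\mathbb C_\infty$ is the completion of an algebraic closure of $F_\infty$. A lattice is a finitely generated $A$-submodule $\Lambda\subset\mathbb C_\infty$ meeting every ball of finite radius in a finite set; its rank is its rank as a projective $A$-module (the zero lattice has rank $0$). A level $N$ structure on a lattice $\Lambda$ of rank $r$ is an $A/N$-module isomorphism $\alpha:(N^{-1}/A)^r\to N^{-1}\Lambda/\Lambda$; $\mathcal L_N^r$ is the set of all pairs $(\Lambda,\alpha)$ with $\Lambda$ of rank $r$. $\overleftarrow{\mathcal L_N^r}$ is the set of all pairs $(\Lambda,\iota)$ of a lattice $\Lambda$ of rank $\le r$ and an injective $A/N$-module homomorphism $\iota:N^{-1}\Lambda/\Lambda\to(N^{-1}/A)^r$. $\mathcal L_N^r$ is identified with the subset of pairs with $\Lambda$ of rank $r$ via $(\Lambda,\alpha)\leftrightarrow(\Lambda,\alpha^{-1})$. Metric. $e_\Lambda(z)=z\prod_{0\ne\lambda\in\Lambda}(1-z/\lambda)$,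 which induces a bijection $\mathbb C_\infty/\Lambda\to\mathbb C_\infty$. $\mathrm d_{\mathcal L}(\Lambda_1,\Lambda_2)=\sup_{|z|\le1}|e_{\Lambda_1}(z)-e_{\Lambda_2}(z)|$. For $l\in(N^{-1}/A)^r$, $\mu_{\Lambda,\iota}(l)=e_\Lambda(\iota^{-1}(l))^{-1}$ if $l\in\operatorname{Im}\iota\setminus\{0\}$, and $\mu_{\Lambda,\iota}(l)=0$ otherwise. Then $$\mathrm d_{\overleftarrow{\mathcal L_N^r}}\bigl((\Lambda_1,\iota_1),(\Lambda_2,\iota_2)\bigr)=\mathrm d_{\mathcal L}(\Lambda_1,\Lambda_2)+\sum_{l\in(N^{-1}/A)^r}|\mu_{\Lambda_1,\iota_1}(l)-\mu_{\Lambda_2,\iota_2}(l)|.$$ *)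

(* Defs.v *)
From HB Require Import structures.
From mathcomp Require Import all_boot all_order all_algebra all_field.
From mathcomp Require Import all_classical all_reals all_analysis.

Set Implicit Arguments.
Unset Strict Implicit.
Unset Printing Implicit Defensive.

Import Order.TTheory GRing.Theory Num.Theory.

Local Open Scope classical_set_scope.
Local Open Scope ring_scope.

(* The library's normed structures assume |x *+ n| = n |x|, hence
   characteristic 0. *)
Record absolute_value (R : realType) (K : fieldType) := AbsoluteValue {
  absv :> K -> R ;
  absv_ge0 : forall x, 0 <= absv x ;
  absv_eq0 : forall x, (absv x == 0) = (x == 0) ;
  absvM : forall x y, absv (x * y) = absv x * absv y ;
  absvD : forall x y, absv (x + y) <= Num.max (absv x) (absv y) }.

(* K with the metric (x, y) |-> v (x - y) *)
Definition metrized (R : realType) (K : fieldType) (v : absolute_value R K) :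
  Type := K.

Section Metrized.
Variables (R : realType) (K : fieldType) (v : absolute_value R K).

Lemma absvN x : v (- x) = v x.
Proof.
have v1 : v 1 = 1.
  have v10 : v 1 != 0 by rewrite absv_eq0 oner_eq0.
  by apply: (mulfI v10); rewrite -absvM !mulr1.
suff vN1 : v (- 1) = 1 by rewrite -mulN1r absvM vN1 mul1r.
have /eqP : v (- 1) ^+ 2 = 1 by rewrite expr2 -absvM mulrNN mulr1.
by rewrite sqrp_eq1 ?absv_ge0 // => /eqP.
Qed.

Lemma absv_distC x y : v (x - y) = v (y - x).
Proof. by rewrite -absvN opprB. Qed.

Lemma absv_triangle x y : v (x + y) <= v x + v y.
Proof.
by rewrite (le_trans (absvD v x y))// ge_max lerDl lerDr !absv_ge0.
Qed.

Let mdist (x y : metrized v) : R := v ((x : K) - y).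

Let mdistxx x : mdist x x = 0.
Proof. by apply/eqP; rewrite absv_eq0 subrr. Qed.

Let mdist_positivity x y : mdist x y = 0 -> x = y.
Proof. by move/eqP; rewrite absv_eq0 subr_eq0 => /eqP. Qed.

Let mdist_sym x y : mdist x y = mdist y x.
Proof. exact: absv_distC. Qed.

Let mdist_triangle y x z : mdist x z <= mdist x y + mdist y z.
Proof. by rewrite /mdist -(subrKA (y : K)) absv_triangle. Qed.

HB.instance Definition _ := Choice.copy (metrized v) K.
HB.instance Definition _ := isMetric.Build R (metrized v)
  mdistxx mdist_positivity mdist_sym mdist_triangle.
HB.instance Definition _ := isPointed.Build (metrized v) (0 : K).

End Metrized.

Definition complete_space (T : uniformType) : Prop :=
  forall G : set_system T, ProperFilter G -> cauchy G -> exists x : T, G --> x.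

Section FunctionField.
Variables (k : finFieldType) (F : fieldExtType {fraction {poly k}}).

Definition const (c : k) : F := in_alg F (tofrac c%:P).

Definition is_constant_field : Prop :=
  forall x : F, algebraicOver const x -> exists c : k, x = const c.

End FunctionField.

(* Places are normalised discrete valuations; they are trivial on constants
   because the constant field is finite.  The value at 0, really +oo, is set to
   0, so that [0 <= P x] says that x is in the valuation ring also if x = 0. *)
Record place (F : fieldType) := Place {
  place_val :> F -> int ;
  place_val0 : place_val 0 = 0 ;
  place_valM : forall x y, x != 0 -> y != 0 ->
    place_val (x * y) = place_val x + place_val y ;
  place_valD : forall x y, x != 0 -> y != 0 -> x + y != 0 ->
    Num.min (place_val x) (place_val y) <= place_val (x + y) ;
  place_val_unif : exists x, place_val x = 1 }.

Definition in_max_ideal (F : fieldType) (P : place F) (x : F) : Prop :=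
  x = 0 \/ 0 < P x.

(* The residues of b form a k-basis of the residue field at P. *)
Definition has_degree (k : finFieldType) (F : fieldExtType {fraction {poly k}})
    (P : place F) (d : nat) : Prop :=
  exists b : 'I_d -> F, (forall i, 0 <= P (b i)) /\
    forall x, 0 <= P x ->
      exists! c : {ffun 'I_d -> k},
        in_max_ideal P (x - \sum_i const F (c i) * b i).

Definition place_abs (R : realType) (k : finFieldType)
    (F : fieldExtType {fraction {poly k}}) (P : place F) (d : nat) (x : F) : R :=
  if x == 0 then 0 else #|k|%:R ^ (- (d%:Z * P x)).

Definition is_completion_of_place (R : realType) (k : finFieldType)
    (F : fieldExtType {fraction {poly k}}) (P : place F) (d : nat)
    (Finf : fieldType) (vinf : absolute_value R Finf)
    (j : {rmorphism F -> Finf}) : Prop :=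
  [/\ forall x, vinf (j x) = place_abs R P d x,
      dense (range j : set (metrized vinf)) & complete_space (metrized vinf)].

Definition is_algebraic_closure (K : fieldType) (Kbar : closedFieldType)
    (i : {rmorphism K -> Kbar}) : Prop :=
  forall y : Kbar, algebraicOver i y.

(* Kbar carries the absolute value v \o h, which is the unique one extending
   that of K. *)
Definition is_completion_of_algebraic_closure (R : realType)
    (K : fieldType) (w : absolute_value R K)
    (Kbar : closedFieldType) (i : {rmorphism K -> Kbar})
    (C : fieldType) (v : absolute_value R C) (h : {rmorphism Kbar -> C}) : Prop :=
  [/\ is_algebraic_closure i, forall x, v (h (i x)) = w x,
      dense (range h : set (metrized v)) & complete_space (metrized v)].

Section RegularFunctions.
Variables (F : fieldType) (infty : place F).

Definition regular : set F :=
  [set x | forall P : place F, P <> infty -> 0 <= P x].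

Definition is_ideal (N : set F) : Prop :=
  [/\ N `<=` regular, N 0,
      forall x y, N x -> N y -> N (x + y) &
      forall a x, regular a -> N x -> N (a * x)].

Definition inv_ideal (N : set F) : set F :=
  [set x | forall n, N n -> regular (x * n)].

End RegularFunctions.

Record quotient (V : zmodType) (M L : set V) := Quotient {
  coset :> set V ;
  cosetP : exists2 m, M m & coset = [set m + l | l in L] }.

HB.instance Definition _ V M L := gen_eqMixin (@quotient V M L).
HB.instance Definition _ V M L := gen_choiceMixin (@quotient V M L).

(* The graphs of addition and of scalar multiplication on cosets. *)
Definition coset_sum (V : zmodType) (X Y Z : set V) : Prop :=
  forall x y, X x -> Y y -> Z (x + y).

Definition coset_scale (V : pzRingType) (a : V) (X Y : set V) : Prop :=
  forall x, X x -> Y (a * x).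

Section Lattices.
Variables (R : realType) (F : fieldType) (infty : place F).
Variables (C : fieldType) (v : absolute_value R C) (emb : {rmorphism F -> C}).

Local Notation A := (regular infty).

Record is_lattice (L : set C) : Prop := IsLattice {
  lattice_0 : L 0 ;
  lattice_add : forall x y, L x -> L y -> L (x + y) ;
  lattice_scale : forall a x, A a -> L x -> L (emb a * x) ;
  lattice_fg : exists (m : nat) (g : 'I_m -> C), (forall i, L (g i)) /\
    forall x, L x -> exists a : 'I_m -> F,
      (forall i, A (a i)) /\ x = \sum_i emb (a i) * g i ;
  lattice_discrete : forall M : R, finite_set [set x | L x /\ v x <= M] }.

Record lattice := Lattice {
  lattice_set :> set C ;
  latticeP : is_lattice lattice_set }.

(* A lattice L is torsion free, so its rank as a projective A-module is
   dim_F (F (x)_A L) = dim_F (F L). *)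
Definition has_rank (L : set C) (n : nat) : Prop :=
  exists b : 'I_n -> C,
    [/\ forall i, L (b i),
        forall c : 'I_n -> F, \sum_i emb (c i) * b i = 0 -> forall i, c i = 0 &
        forall x, L x -> exists c : 'I_n -> F, x = \sum_i emb (c i) * b i].

(* Partial products are taken over the finite sets {l in L | 0 < |l| <= n}. *)
Definition exp_lattice (L : set C) (z : C) : C :=
  z * lim ((fun n : nat => (
    \big[*%R/1]_(l \in [set l | [/\ L l, l != 0 & v l <= n%:R]])
      (1 - z / l) : metrized v)) @ \oo).

Definition dist_lattice (L1 L2 : set C) : \bar R :=
  ereal_sup [set (v (exp_lattice L1 z - exp_lattice L2 z))%:E
            | z in [set z | v z <= 1]].

Section Level.
Variables (N : set F) (r : nat).

Local Notation Ninv := (inv_ideal infty N).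

Definition Ninv_mul (L : set C) : set C :=
  [set z | exists (m : nat) (x : 'I_m -> F) (l : 'I_m -> C),
     [/\ forall i, Ninv (x i), forall i, L (l i)
       & z = \sum_i emb (x i) * l i]].

(* N^-1 L / L and (N^-1 / A)^r.  Both are killed by N, so that their
   A/N-linear maps are their A-linear maps. *)
Definition torsion (L : set C) : Type := quotient (Ninv_mul L) L.

Definition level_module : Type := {ffun 'I_r -> quotient Ninv A}.

HB.instance Definition _ := Choice.on level_module.

Definition is_zero_level (l : level_module) : Prop := forall i, coset (l i) 0.

Definition linear_to_level (L : set C) (f : torsion L -> level_module) : Prop :=
  (forall X Y Z : torsion L, coset_sum X Y Z ->
     forall i, coset_sum (f X i) (f Y i) (f Z i)) /\
  (forall a (X Y : torsion L), A a -> coset_scale (emb a) X Y ->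
     forall i, coset_scale a (f X i) (f Y i)).

Definition linear_from_level (L : set C) (f : level_module -> torsion L) : Prop :=
  (forall X Y Z : level_module, (forall i, coset_sum (X i) (Y i) (Z i)) ->
     coset_sum (f X) (f Y) (f Z)) /\
  (forall a (X Y : level_module), A a -> (forall i, coset_scale a (X i) (Y i)) ->
     coset_scale (emb a) (f X) (f Y)).

Definition is_level_structure (L : set C) (alpha : level_module -> torsion L) :
    Prop :=
  linear_from_level alpha /\ bijective alpha.

Record partial_level_lattice := PartialLevelLattice {
  plat : lattice ;
  plat_rank : exists2 n, (n <= r)%N & has_rank plat n ;
  plat_iota : torsion plat -> level_module ;
  plat_iota_linear : linear_to_level plat_iota ;
  plat_iota_inj : injective plat_iota }.

HB.instance Definition _ := gen_eqMixin partial_level_lattice.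
HB.instance Definition _ := gen_choiceMixin partial_level_lattice.

(* The image of the pairs (L, alpha) with alpha a level structure on the lattice
   L of rank r under (L, alpha) |-> (L, alpha^-1). *)
Definition full_level : set partial_level_lattice :=
  [set x | exists alpha : level_module -> torsion (plat x),
     [/\ has_rank (plat x) r, is_level_structure alpha,
         cancel alpha (@plat_iota x) & cancel (@plat_iota x) alpha]].

(* The coset iota^-1(l), as a set; it is empty if l is not in the image. *)
Definition iota_inv (x : partial_level_lattice) (l : level_module) : set C :=
  [set z | exists2 X : torsion (plat x), plat_iota X = l & coset X z].

(* exp_lattice is constant on cosets of the lattice, hence the choice of the
   representative [xget 0 _] is irrelevant. *)
Definition mu (x : partial_level_lattice) (l : level_module) : C :=
  if `[< iota_inv x l !=set0 /\ ~ is_zero_level l >]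
  then (exp_lattice (plat x) (xget 0 (iota_inv x l)))^-1 else 0.

(* All values are finite. The supremum and the sum, which is over the finite
   set (N^-1/A)^r, are taken in \bar R only to have them defined a priori. *)
Definition dist (x y : partial_level_lattice) : \bar R :=
  (dist_lattice (plat x) (plat y) +
   \esum_(l in [set: level_module]) (v (mu x l - mu y l))%:E)%E.

Local Open Scope ereal_scope.

Lemma dist_latticexx L : dist_lattice L L = 0.
Proof.
apply/eqP; rewrite eq_le; apply/andP; split.
  apply: ge_ereal_sup => _ [z _ <-].
  by rewrite subrr lee_fin le_eqVlt absv_eq0 eqxx.
apply: ereal_sup_ubound; exists (0%R : C) => /=.
  have /eqP-> // : v 0%R == 0%R by rewrite absv_eq0.
by rewrite subrr; congr (_%:E); apply/eqP; rewrite absv_eq0.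
Qed.

Lemma dist_lattice_sym L1 L2 : dist_lattice L1 L2 = dist_lattice L2 L1.
Proof.
by rewrite /dist_lattice; congr ereal_sup; apply: eq_imagel => z _;
  rewrite absv_distC.
Qed.

Lemma dist_lattice_triangle L2 L1 L3 :
  dist_lattice L1 L3 <= dist_lattice L1 L2 + dist_lattice L2 L3.
Proof.
apply: ge_ereal_sup => _ [z z1 <-].
rewrite -(subrKA (exp_lattice L2 z)).
apply: le_trans (leeD _ _); [|apply: ereal_sup_ubound; exists z => //..].
by rewrite -EFinD lee_fin absv_triangle.
Qed.

Lemma distxx x : dist x x = 0.
Proof.
rewrite /dist dist_latticexx add0e esum1// => l _.
by rewrite subrr; congr (_%:E); apply/eqP; rewrite absv_eq0.
Qed.

Lemma dist_sym x y : dist x y = dist y x.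
Proof.
rewrite /dist dist_lattice_sym; congr (_ + _).
by apply: eq_esum => l _; rewrite absv_distC.
Qed.

Lemma dist_triangle y x z : dist x z <= dist x y + dist y z.
Proof.
rewrite /dist addeACA -esumD => [| l _|l _]; rewrite ?lee_fin ?absv_ge0//.
apply: leeD; first exact: dist_lattice_triangle.
apply: le_esum => l _; rewrite -EFinD lee_fin.
by rewrite -(subrKA (mu y l)) absv_triangle.
Qed.

Let dist_ball (x : partial_level_lattice) (e : R) : set partial_level_lattice :=
  [set y | dist x y < e%:E].

Let ball_center x e : (0 < e)%R -> dist_ball x e x.
Proof. by move=> e0; rewrite /dist_ball/= distxx lte_fin. Qed.

Let ball_sym x y e : dist_ball x e y -> dist_ball y e x.
Proof. by rewrite /dist_ball/= dist_sym. Qed.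

Let ball_triangle x y z e1 e2 : dist_ball x e1 y -> dist_ball y e2 z ->
  dist_ball x (e1 + e2)%R z.
Proof.
rewrite /dist_ball/= => xy yz.
by rewrite (le_lt_trans (dist_triangle y _ _))// EFinD lteD.
Qed.

HB.instance Definition _ :=
  @hasNbhs.Build partial_level_lattice (nbhs_ (entourage_ dist_ball)).
HB.instance Definition _ := @Nbhs_isPseudoMetric.Build R partial_level_lattice
  (entourage_ dist_ball) erefl dist_ball ball_center ball_sym ball_triangle
  erefl.

End Level.
End Lattices.

(* Main.v *)
Require Import Defs.
From HB Require Import structures.
From mathcomp Require Import all_boot all_order all_algebra all_field.
From mathcomp Require Import all_classical all_reals all_analysis.
From mathcomp Require Import finmap ring lra zify.

(** Throughout, e_L is the exponential function of a discrete subgroup L of C,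
    |.| is the absolute value of C and a is an element of N with a pole at
    infty, so that |a| > 1.

    Completeness. The distance of two lattices only compares their exponential
    functions on the unit ball. A bound for e_L there bounds the non-zero
    elements of L from below ([norm_lower_bound]), so that in a Cauchy sequence
    of lattices L_n there is a common lower bound rho. The functional equation
    e_L (a z) = Q (e_L z) ([exp_functional]), with Q a polynomial whose degree
    is bounded in terms of the rank and which is recovered by interpolation at
    small points, carries uniform convergence from the ball of radius T to that
    of radius |a| T ([exp_cauchy_step]), hence to all balls. Since e_L is small
    only near L ([exp_lattice_near]), the finite sets of points of L_n in a ball
    converge. Their limits form a discrete A-module; counting its points in
    large balls shows that its rank is at most r ([limset_ev_rank]), descent
    shows that it is finitely generated ([discrete_module_fg]), and the e_(L_n)
    converge to its exponential function ([exp_limset_cvg]).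

    A level structure iota is encoded by the A-module of the pairs (z, c) with
    iota [z] = [c] ([level_graph]). The pairs for the limit are those (z, c) for
    which z is a limit of z_n with iota_n [z_n] = [c] for large n. It is the
    convergence of the mu_n that makes the limit of the iota_n defined on all of
    N^-1 L ([limit_graph_total]), and no element of the level module is lost:
    where mu_n does not tend to 0 there is a bounded, hence convergent, choice
    of preimages ([mu_vanish]).

    Density. If the rank n of L is less than r, then L is replaced by L + A gam,
    where |gam| is very large and different from all norms of F L
    ([exists_new_norm]). The exponential function then changes little on bounded
    sets ([adjoin_exp]), and the new values of mu are small
    ([adjoin_exp_large]). The level structure extends injectively because its
    image cannot contain lines in all r directions of the m^-1 / A, for any
    maximal ideal m that contains N ([exists_free_index]); the choices for the
    finitely many m are put together by the Chinese remainder theorem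
    ([maximal_separator]). After r - n steps the rank is r. In rank r, an
    injective iota is bijective, as there is an injection in the opposite
    direction ([exists_independent_torsion]) and the sets are finite.

    The arithmetic of A that is needed comes from three facts: an element of A
    without a pole at infty is constant, because non-constant functions have
    poles ([no_pole_algebraic]); A is an intersection of valuation rings; and
    the rings A / b A are finite ([finite_residues]). The last two imply that
    non-zero ideals are invertible ([ideal_inverse]). *)

Set Implicit Arguments.
Unset Strict Implicit.
Unset Printing Implicit Defensive.

Import Order.TTheory GRing.Theory Num.Theory.

Local Open Scope classical_set_scope.
Local Open Scope ring_scope.

(** * Linear algebra over the polynomials in one function *)

Lemma field_left_kernel (K : fieldType) (I J : finType) (M : I -> J -> K) :
  (#|J| < #|I|)%N ->
  exists u : I -> K, (exists i, u i != 0) /\ forall j, \sum_i u i * M i j = 0.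
Proof.
move=> ltJI.
pose A := \matrix_(i < #|I|, j < #|J|) M (enum_val i) (enum_val j).
have [u uA un0] : exists2 u : 'rV_#|I|, u *m A = 0 & u != 0.
  have : kermx A != 0.
    by rewrite kermx_eq0 /row_free neq_ltn (leq_ltn_trans (rank_leq_col A) ltJI).
  by case/rowV0Pn => u /sub_kermxP uA; exists u.
exists (fun i => u 0 (enum_rank i)); split.
  have [i ui] : exists i, u 0 i != 0.
    apply/existsP; apply: contraNT un0; rewrite negb_exists => /forallP u0.
    by apply/eqP/rowP => i; rewrite mxE; apply/eqP; have := u0 i; rewrite negbK.
  by exists (enum_val i); rewrite enum_valK.
move=> j; have /matrixP/(_ 0 (enum_rank j)) := uA.
rewrite !mxE => E; rewrite -[RHS]E (reindex _ (onW_bij _ (@enum_val_bij I))) /=.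
by apply: eq_bigr => i _; rewrite !mxE !enum_valK enum_rankK.
Qed.

Lemma fraction_denom (R : idomainType) (x : {fraction R}) :
  exists d n : R, d != 0 /\ FracField.tofrac d * x = FracField.tofrac n.
Proof.
exists (frac (repr x)).2, (frac (repr x)).1; split; first exact: denom_ratioP.
rewrite -[X in _ * X = _](reprK x) !piE; apply/eqmodP => /=.
rewrite FracField.equivfE /FracField.mulf !numden_Ratio ?mul1r ?mulr1 ?oner_eq0//;
  exact: denom_ratioP.
Qed.

Lemma common_denom (R : idomainType) (I : finType) (x : I -> {fraction R}) :
  exists (d : R) (n : I -> R), d != 0 /\
    forall i, FracField.tofrac d * x i = FracField.tofrac (n i).
Proof.
have [f fP] := choice (fun i => fraction_denom (x i)).
have [g gP] := choice fP.
exists (\prod_i f i), (fun i => g i * \prod_(j | j != i) f j); split.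
  by apply/prodf_neq0 => i _; case: (gP i).
move=> i; rewrite (bigD1 i)//= !rmorphM/= mulrAC.
by have [_ ->] := gP i.
Qed.

(** Clears the denominators of a kernel vector over the fraction field. *)
Lemma idomain_left_kernel (R : idomainType) (I J : finType) (M : I -> J -> R) :
  (#|J| < #|I|)%N ->
  exists u : I -> R, (exists i, u i != 0) /\ forall j, \sum_i u i * M i j = 0.
Proof.
move=> /(field_left_kernel (fun i j => FracField.tofrac (M i j))).
move=> [u [[i ui] uM]]; have [d [n [d0 dn]]] := common_denom u.
exists n; split.
  exists i; rewrite -tofrac_eq0 -dn mulf_neq0//.
  by rewrite tofrac_eq0.
move=> j; apply/eqP; rewrite -tofrac_eq0 rmorph_sum/=.
under eq_bigr do rewrite rmorphM/= -dn -mulrA.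
by rewrite -mulr_sumr uM mulr0.
Qed.

Section FunctionFieldDim.
Variables (k : finFieldType) (F : fieldExtType {fraction {poly k}}).

HB.instance Definition _ := GRing.RMorphism.copy (@const k F)
  (in_alg F \o @FracField.tofrac {poly k} \o polyC).

(** F is regarded as an algebra over k[T] through T := a. The ranks over k[a]
    below refer to this structure. *)
Definition ev (a : F) : {poly k} -> F := horner_eval a \o map_poly (@const k F).

HB.instance Definition _ a := GRing.RMorphism.copy (ev a)
  (horner_eval a \o map_poly (@const k F)).

Lemma evX a : ev a 'X = a.
Proof. by rewrite /ev/= map_polyX horner_evalE hornerX. Qed.

Lemma evC a c : ev a c%:P = const F c.
Proof. by rewrite /ev/= map_polyC horner_evalE hornerC. Qed.

Definition dependent (L : Type) (a : F) (I : finType) (x : I -> L -> F) :=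
  exists p : I -> {poly k}, (exists i, p i != 0) /\
    forall l, \sum_i ev a (p i) * x i l = 0.

(** Once row i is multiplied by a common denominator of its coordinates with
    respect to f, what remains is a system of #|L| * #|J| linear equations over
    k[T]. *)
Lemma dependent_span (a : F) (L I J : finType) (x : I -> L -> F) (f : J -> F) :
  (#|L| * #|J| < #|I|)%N ->
  (forall i l, exists (c : {poly k}) (q : J -> {poly k}), c != 0 /\
     ev a c * x i l = \sum_j ev a (q j) * f j) ->
  dependent a x.
Proof.
move=> LJI xf.
have [c cP] := choice (fun il : I * L => xf il.1 il.2).
have [q qP] := choice cP.
pose M i (lj : L * J) :=
  (\prod_(l' | l' != lj.1) c (i, l')) * q (i, lj.1) lj.2.
have [|u [[i ui] uM]] := @idomain_left_kernel _ I (L * J)%type M.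
  by rewrite card_prod.
exists (fun i => u i * \prod_l c (i, l)); split.
  exists i; rewrite mulf_neq0//; apply/prodf_neq0 => l _.
  by have [] := qP (i, l).
move=> l; transitivity (\sum_i \sum_j ev a (u i * M i (l, j)) * f j).
  apply: eq_bigr => i' _; rewrite (bigD1 l)//= [c _ * _]mulrC mulrA.
  rewrite [X in X * _]rmorphM/= -[LHS]mulrA; have [_ ->] := qP (i', l).
  rewrite mulr_sumr; apply: eq_bigr => j _.
  by rewrite !rmorphM/= !mulrA.
rewrite exchange_big/= big1// => j _.
by rewrite -mulr_suml -rmorph_sum uM rmorph0 mul0r.
Qed.

(** A polynomial in tvar and a may be evaluated at the two variables in either
    order. *)
Lemma ev_swap (T a : F) (H : {poly {poly k}}) :
  (map_poly (ev a) (swapXY H)).[T] = (map_poly (ev T) H).[a].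
Proof.
elim/poly_ind: H => [|H p IH]; first by rewrite !rmorph0 !horner0.
rewrite !rmorphD !rmorphM/= !hornerE IH swapXY_X swapXY_polyC.
rewrite !map_polyC/= !map_polyX !hornerE evX; congr (_ + _).
rewrite -map_poly_comp /ev /= horner_evalE; congr (_.[_]).
by apply: eq_map_poly => c /=; rewrite evC.
Qed.

Definition tvar : F := in_alg F (tofrac 'X).

Lemma ev_tvar p : ev tvar p = in_alg F (tofrac p).
Proof.
elim/poly_ind: p => [|p c IH]; first by rewrite !rmorph0.
rewrite rmorphD rmorphM/= IH evX evC.
by rewrite rmorphD rmorphM/= mulr_algl scalerDl -scalerA.
Qed.

(** The powers of a are dependent over k(tvar), over which F is of finite
    degree. A relation between them, read as a polynomial in tvar, is an
    equation of tvar over k[a]. *)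
Lemma exists_annihilator (a : F) : exists G : {poly {poly k}},
  G != 0 /\ (map_poly (ev a) G).[tvar] = 0.
Proof.
pose d := \dim {:F}.
pose M (i : 'I_d.+1) (j : 'I_d) := coord (vbasis {:F}) j (a ^+ i).
have [|u [[i0 ui] uM]] := field_left_kernel M; first by rewrite !card_ord.
have [q [n [q0 qn]]] := common_denom u.
pose H := \poly_(i < d.+1) n (inord i).
exists (swapXY H); split.
  rewrite swapXY_eq0; apply/eqP => /polyP/(_ i0).
  rewrite coef_poly ltn_ord inord_val coef0 => n0.
  have := qn i0; rewrite n0 rmorph0 => /eqP.
  by rewrite mulf_eq0 tofrac_eq0 (negPf q0) (negPf ui).
rewrite ev_swap (@horner_coef_wide _ d.+1); last first.
  by rewrite (leq_trans (size_poly _ _))// size_poly.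
transitivity (\sum_(i < d.+1) (tofrac q * u i) *: a ^+ i).
  apply: eq_bigr => i _; rewrite coef_map coef_poly ltn_ord inord_val/=.
  by rewrite ev_tvar qn/= mulr_algl.
transitivity (tofrac q *: \sum_(i < d.+1) u i *: a ^+ i).
  by rewrite scaler_sumr; apply: eq_bigr => i _; rewrite scalerA.
rewrite [X in _ *: X](_ : _ = 0) ?scaler0//.
under eq_bigr do rewrite [_ ^+ _](coord_vbasis (memvf _)) scaler_sumr.
rewrite exchange_big big1// => j _/=.
under eq_bigr do rewrite scalerA.
by rewrite -scaler_suml uM scale0r.
Qed.

(** F is spanned over k(tvar) by finitely many elements, and polynomials in tvar
    are reduced modulo the equation G of tvar over k[a] by pseudo-division. *)
Lemma exists_dim_bound (a : F) : exists D : nat,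
  forall (I : finType) (x : I -> unit -> F), (D < #|I|)%N -> dependent a x.
Proof.
have [G [G0 Ga]] := exists_annihilator a.
pose d := \dim {:F}; pose e (l : 'I_d) := (vbasis {:F})`_l.
exists (size G * d)%N => I x DI.
have [q [n [q0 qn]]] :=
  common_denom (fun il : I * 'I_d => coord (vbasis {:F}) il.2 (x il.1 tt)).
pose y i (_ : unit) := in_alg F (tofrac q) * x i tt.
pose f (jl : 'I_(size G) * 'I_d) := tvar ^+ jl.1 * e jl.2.
suff [p [p0 py]] : dependent a y.
  exists p; split=> // -[]; have /eqP := py tt.
  under eq_bigr do rewrite mulrCA.
  rewrite -mulr_sumr mulf_eq0 fmorph_eq0 tofrac_eq0 (negPf q0)/=.
  by move/eqP.
apply: (@dependent_span _ _ _ _ _ f).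
  by rewrite card_unit mul1n card_prod !card_ord.
move=> i []; pose P l := map_poly polyC (n (i, l)).
pose m l := scalp (P l) G.
exists (lead_coef G ^+ \sum_l m l).
exists (fun jl : 'I_(size G) * 'I_d => lead_coef G ^+ (\sum_(l | l != jl.2) m l) *
                  (P jl.2 %% G)`_jl.1).
split; first by rewrite expf_neq0// lead_coef_eq0.
have PE l : ev a (lead_coef G ^+ m l) * ev tvar (n (i, l)) =
    \sum_(j < size G) ev a (P l %% G)`_j * tvar ^+ j.
  transitivity (map_poly (ev a) (lead_coef G ^+ m l *: P l)).[tvar].
    rewrite map_polyZ/= hornerZ; congr (_ * _).
    rewrite /P -map_poly_comp /ev /= horner_evalE; congr (_.[_]).
    by apply: eq_map_poly => c /=; rewrite evC.
  rewrite /m Pdiv.Idomain.divp_eq rmorphD rmorphM/= !hornerE Ga mulr0 add0r.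
  rewrite (@horner_coef_wide _ (size G)); last first.
    by rewrite (leq_trans (size_poly _ _))// ltnW// ltn_modp.
  by apply: eq_bigr => j _; rewrite coef_map.
have -> : y i tt = \sum_l ev tvar (n (i, l)) * e l.
  rewrite /y [x i tt](coord_vbasis (memvf _)) mulr_sumr.
  by apply: eq_bigr => l _; rewrite ev_tvar -qn/= !mulr_algl scalerA.
rewrite mulr_sumr -(pair_bigA _ (fun (j : 'I_(size G)) (l : 'I_d) => ev a (lead_coef G ^+ (\sum_(l' | l' != l) m l') * (P l %% G)`_j) * (tvar ^+ j * e l)))/=.
rewrite exchange_big/=; apply: eq_bigr => l _.
rewrite (bigD1 l)//= exprD [X in ev a X]mulrC rmorphM/= mulrA -[X in X * _]mulrA PE.
rewrite mulr_sumr mulr_suml; apply: eq_bigr => j _.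
by rewrite rmorphM/= !mulrA.
Qed.

(** A maximal k[a]-independent family, which exists by the previous bound. *)
Lemma exists_ev_basis (a : F) : exists (D : nat) (f : 'I_D -> F),
  (forall p : 'I_D -> {poly k}, \sum_i ev a (p i) * f i = 0 ->
     forall i, p i = 0) /\
  (forall x, exists (c : {poly k}) (q : 'I_D -> {poly k}), c != 0 /\
     ev a c * x = \sum_i ev a (q i) * f i).
Proof.
have [D0 D0P] := exists_dim_bound a.
pose indep D := exists f : 'I_D -> F,
  forall p : 'I_D -> {poly k}, \sum_i ev a (p i) * f i = 0 ->
     forall i, p i = 0.
have ex0 : exists D, `[< indep D >].
  by exists 0%N; apply/asboolP; exists (fun=> 0) => p _ [].
have ub D : `[< indep D >] -> (D <= D0)%N.
  move=> /asboolP[f fP]; rewrite leqNgt; apply/negP => DD.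
  have [|p [[i pi] pf]] := D0P 'I_D (fun i _ => f i); first by rewrite card_ord.
  by have /eqP := fP p (pf tt) i; rewrite (negPf pi).
case: (ex_maxnP ex0 ub) => D /asboolP[f fP] Dmax.
exists D, f; split=> // x; apply: contrapT => nx.
have : indep D.+1.
  exists (fun i => if unlift ord0 i is Some j then f j else x) => p.
  rewrite big_ord_recl unlift_none.
  under eq_bigr do rewrite liftK.
  move=> E; have [p0|p0] := eqVneq (p ord0) 0.
    move: E; rewrite p0 rmorph0 mul0r add0r => /fP pf i.
    by case: (unliftP ord0 i) => [j|] ->; rewrite ?p0 ?pf.
  case: nx; exists (p ord0), (fun j => - p (lift ord0 j)); split=> //.
  under eq_bigr do rewrite rmorphN mulNr.
  by rewrite sumrN; apply/eqP; rewrite -addr_eq0 E.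
by move=> /asboolP/Dmax; rewrite ltnn.
Qed.

(** For transcendental a, the number D is the degree of F over k(a). The second
    property, for rows of any length, turns a dimension over F into a rank over
    k[a]; the first one is for the way back. *)
Lemma exists_ev_dim (a : F) : exists (D : nat) (f : 'I_D -> F),
  (forall p : 'I_D -> {poly k}, \sum_i ev a (p i) * f i = 0 ->
     forall i, p i = 0) /\
  (forall (L I : finType) (x : I -> L -> F), (#|L| * D < #|I|)%N ->
     dependent a x).
Proof.
have [D [f [fi fs]]] := exists_ev_basis a.
exists D, f; split=> // L I x LDI; apply: (@dependent_span _ _ _ _ _ f).
  by rewrite card_ord.
by move=> i l; have [c [q]] := fs (x i l); exists c, q.
Qed.

End FunctionFieldDim.

(** * Every non-constant function has a pole *)

Record is_subring (F : nzRingType) (B : set F) : Prop := IsSubring {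
  subring1 : B 1 ;
  subringB : forall x y, B x -> B y -> B (x - y) ;
  subringM : forall x y, B x -> B y -> B (x * y) }.

Section SubringTheory.
Variables (F : nzRingType) (B : set F).
Hypothesis HB : is_subring B.

Lemma subring0 : B 0.
Proof. by rewrite -(subrr 1); apply: (subringB HB); exact: subring1. Qed.

Lemma subringN x : B x -> B (- x).
Proof. by rewrite -sub0r; apply: subringB => //; exact: subring0. Qed.

Lemma subringD x y : B x -> B y -> B (x + y).
Proof. by move=> Bx By; rewrite -[y]opprK; apply: subringB => //; exact: subringN. Qed.

Lemma subringX x n : B x -> B (x ^+ n).
Proof.
move=> Bx; elim: n => [|n IH]; first by rewrite expr0; exact: subring1.
by rewrite exprS; apply: subringM.
Qed.

Lemma subring_sum (I : Type) (r : seq I) (P : pred I) (f : I -> F) :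
  (forall i, P i -> B (f i)) -> B (\sum_(i <- r | P i) f i).
Proof.
move=> Bf; elim/big_rec: _ => [|i x Pi Bx]; first exact: subring0.
by apply: subringD => //; exact: Bf.
Qed.

Lemma subring_prod (I : Type) (r : seq I) (P : pred I) (f : I -> F) :
  (forall i, P i -> B (f i)) -> B (\prod_(i <- r | P i) f i).
Proof.
move=> Bf; elim/big_rec: _ => [|i x Pi Bx]; first exact: subring1.
by apply: subringM => //; exact: Bf.
Qed.

Lemma subring_horner (q : {poly F}) x : (forall i, B q`_i) -> B x -> B q.[x].
Proof.
by move=> Bq Bx; rewrite horner_coef; apply: subring_sum => i _;
  apply: subringM => //; exact: subringX.
Qed.

End SubringTheory.

Section PoleExists.
Variables (k : finFieldType) (F : fieldExtType {fraction {poly k}}).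
Variable y : F.
Hypothesis y_tr : forall p : {poly k}, ev y p = 0 -> p = 0.

Let y0 : y != 0.
Proof.
apply/eqP => y0; have := @y_tr 'X; rewrite evX y0 => /(_ erefl)/eqP.
by rewrite polyX_eq0.
Qed.

(** The candidates for a valuation ring with y in its maximal ideal. *)
Definition avoids (B : set F) :=
  [/\ is_subring B, forall c, B (const F c), B y & ~ B y^-1].

(** Zorn's lemma above k[y], where y is not invertible because it is
    transcendental. *)
Lemma maximal_avoiding : exists B, avoids B /\
  forall B', avoids B' -> B `<=` B' -> B' = B.
Proof.
have base : avoids (range (ev y)).
  split.
  - split; first by exists 1 => //; rewrite rmorph1.
      by move=> _ _ [p _ <-] [q _ <-]; exists (p - q) => //; rewrite rmorphB.
    by move=> _ _ [p _ <-] [q _ <-]; exists (p * q) => //; rewrite rmorphM.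
  - by move=> c; exists c%:P => //; rewrite evC.
  - by exists 'X => //; rewrite evX.
  move=> [p _ py]; have : ev y (1 - p * 'X) = 0.
    by rewrite rmorphB rmorph1 rmorphM/= evX py mulVf// subrr.
  move/y_tr/(congr1 (fun p => p.[0])).
  by rewrite !hornerE ?mulr0 ?oppr0 ?addr0 => /eqP; rewrite oner_eq0.
have [|B [[B0|avB] Bmax]] := @Zorn_bigcup F (fun B => B = set0 \/ avoids B).
- move=> G GP Gtot; have [[X GX X0]|nX] := pselect (exists2 X, G X & X !=set0);
    last first.
    left; apply/seteqP; split=> // x [X GX Xx].
    by exfalso; apply: nX; exists X => //; exists x.
  have av Z z : G Z -> Z z -> avoids Z.
    by move=> GZ Zz; case: (GP _ GZ) => // Z0; move: Zz; rewrite Z0.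
  have avX : avoids X by have [z Xz] := X0; exact: av Xz.
  right; split.
  - split; first by exists X => //; have [/subring1] := avX.
      move=> a b [Za GZa Zaa] [Zb GZb Zbb].
      have [/subsetP ab|/subsetP ba] : Za `<=` Zb \/ Zb `<=` Za by exact: Gtot.
        exists Zb => //; have [sZ _ _ _] := av _ _ GZb Zbb.
        by apply: (subringB sZ) => //; have /subsetP := ab; apply.
      exists Za => //; have [sZ _ _ _] := av _ _ GZa Zaa.
      by apply: (subringB sZ) => //; have /subsetP := ba; apply.
    move=> a b [Za GZa Zaa] [Zb GZb Zbb].
    have [/subsetP ab|/subsetP ba] : Za `<=` Zb \/ Zb `<=` Za by exact: Gtot.
      exists Zb => //; have [sZ _ _ _] := av _ _ GZb Zbb.
      by apply: (subringM sZ) => //; have /subsetP := ab; apply.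
    exists Za => //; have [sZ _ _ _] := av _ _ GZa Zaa.
    by apply: (subringM sZ) => //; have /subsetP := ba; apply.
  - by move=> c; exists X => //; case: avX.
  - by exists X => //; case: avX.
  by move=> [Z GZ Zy]; have [_ _ _] := av _ _ GZ Zy; apply.
- exfalso; apply: (Bmax (range (ev y))); last by right.
  rewrite B0; split=> // /(_ y); apply; exists 'X => //; exact: evX.
exists B; split=> // B' avB' BB'; apply: contrapT => ne.
apply: (Bmax B'); last by right.
split=> // B'B; apply: ne; exact/seteqP.
Qed.

Section MaximalAvoiding.
Variable B : set F.
Hypothesis avB : avoids B.
Hypothesis maxB : forall B', avoids B' -> B `<=` B' -> B' = B.

Let sB : is_subring B. Proof. by case: avB. Qed.
Let By : B y. Proof. by case: avB. Qed.
Let nBy : ~ B y^-1. Proof. by case: avB. Qed.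
Let cB c : B (const F c). Proof. by case: avB. Qed.

Lemma one_sub_neq0 b : B b -> 1 - y * b != 0.
Proof.
move=> Bb; apply/eqP => /subr0_eq yb; apply: nBy.
by rewrite -[y^-1]mulr1 yb mulKf.
Qed.

(** Making the elements of 1 + y B invertible does not make y invertible, so
    that they are invertible in B already. *)
Lemma one_sub_inv b : B b -> B (1 - y * b)^-1.
Proof.
move=> Bb; set z := 1 - y * b.
have Bz : B z by apply: (subringB sB); [exact: subring1|exact: subringM].
have z0 : z != 0 by exact: one_sub_neq0.
pose B' := [set x | exists s, B (x * z ^+ s)].
suff <- : B' = B by exists 1%N; rewrite expr1 mulVf//; exact: subring1.
apply: maxB; last by move=> x Bx; exists 0%N; rewrite mulr1.
have up x s t : (s <= t)%N -> B (x * z ^+ s) -> B (x * z ^+ t).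
  move=> st Bx; rewrite -(subnK st) addnC exprD mulrA.
  by apply: (subringM sB) => //; exact: subringX.
have zE s : exists2 b', B b' & z ^+ s = 1 - y * b'.
  elim: s => [|s [b' Bb' IH]].
    by exists 0; [exact: subring0|rewrite mulr0 subr0 expr0].
  exists (b * z ^+ s + b'); last first.
    by rewrite exprS IH /z; ring.
  apply: (subringD sB) => //; apply: (subringM sB) => //; exact: subringX.
split.
- split.
  + by exists 0%N; rewrite mulr1; exact: subring1.
  + move=> x x' [s Bx] [t Bx']; exists (maxn s t); rewrite mulrBl.
    by apply: (subringB sB); [apply: up Bx|apply: up Bx'];
      rewrite ?leq_maxl ?leq_maxr.
  + move=> x x' [s Bx] [t Bx']; exists (s + t)%N.
    by rewrite exprD mulrACA; exact: subringM.
- by move=> c; exists 0%N; rewrite mulr1.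
- by exists 0%N; rewrite mulr1.
move=> [s]; have [b' Bb' ->] := zE s.
rewrite mulrBr mulr1 mulKf// => Byb; apply: nBy.
by rewrite -[y^-1](subrK b'); exact: subringD.
Qed.

(** Two relations can be reduced against each other, as their constant terms 1 -
    y * q`_0 and 1 - y * r`_0 are units. *)
Lemma no_two_relations n (u : F) (q r : {poly F}) : u != 0 ->
  (size q + size r <= n)%N -> (forall i, B q`_i) -> (forall i, B r`_i) ->
  q.[u] = y^-1 -> r.[u^-1] = y^-1 -> False.
Proof.
elim: n u q r => [|n IH] u q r u0.
  rewrite leqn0 addn_eq0 size_poly_eq0 => /andP[/eqP -> _] _ _.
  by rewrite horner0 => /esym/eqP; rewrite invr_eq0 (negPf y0).
wlog szqr : u q r u0 / (size r <= size q)%N.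
  move=> H szn Bq Br qu ru; have [/H|/ltnW/H] := leqP (size r) (size q).
    by move=> /(_ u); apply.
  by move=> /(_ u^-1); apply => //; rewrite ?invr_eq0 ?invrK// addnC.
move=> szn Bq Br qu ru.
have sz_ge2 (v : F) (p : {poly F}) : (forall i, B p`_i) -> p.[v] = y^-1 -> (1 < size p)%N.
  move=> Bp pv; rewrite ltnNge; apply/negP => /size1_polyC pE.
  by move: pv; rewrite pE hornerC => py; apply: nBy; rewrite -py.
have q2 := sz_ge2 _ _ Bq qu; have r2 := sz_ge2 _ _ Br ru.
pose d := (size q).-1; pose e := (size r).-1.
have de : size q = d.+1 by rewrite /d prednK// (leq_trans _ q2).
have ee : size r = e.+1 by rewrite /e prednK// (leq_trans _ r2).
have led : (e <= d)%N by move: szqr; rewrite de ee.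
pose w := (1 - y * r`_0)^-1.
have Bw : B w by exact: one_sub_inv.
have ue : u ^+ d = \sum_(j < e) w * y * r`_j.+1 * u ^+ (d - j.+1).
  have : r.[u^-1] = r`_0 + \sum_(j < e) r`_j.+1 * u^-1 ^+ j.+1.
    by rewrite horner_coef ee big_ord_recl expr0 mulr1.
  rewrite ru => E.
  have : 1 = w * (y * \sum_(j < e) r`_j.+1 * u^-1 ^+ j.+1).
    have -> : \sum_(j < e) r`_j.+1 * u^-1 ^+ j.+1 = y^-1 - r`_0.
      by rewrite E addrAC subrr add0r.
    by rewrite mulrBr divff// mulVf//; exact: one_sub_neq0.
  move=> /(congr1 (fun z => z * u ^+ d)); rewrite mul1r => ->.
  rewrite mulr_sumr mulr_sumr mulr_suml; apply: eq_bigr => j _.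
  have jd : (j.+1 <= d)%N by exact: leq_trans led.
  rewrite -[in LHS](subnK jd) exprD exprVn; field.
  by rewrite expf_neq0.
pose q' := \poly_(i < d) q`_i +
  \sum_(j < e) (q`_d * (w * y * r`_j.+1)) *: 'X^(d - j.+1).
have szq' : (size q' <= d)%N.
  rewrite (leq_trans (size_polyD _ _))// geq_max size_poly/=.
  apply: (leq_trans (size_sum _ _ _)); apply/bigmax_leqP => j _.
  apply: (leq_trans (size_scale_leq _ _)); rewrite size_polyXn.
  have jd : (j.+1 <= d)%N by exact: leq_trans led.
  by rewrite -subSn// subSS leq_subr.
apply: (IH u q' r u0) => //.
- by rewrite -ltnS (leq_trans _ szn)// -addSn leq_add2r de ltnS.
- move=> i; rewrite coefD coef_poly coef_sum; apply: (subringD sB).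
    by case: ifP => // _; exact: subring0.
  apply: (subring_sum sB) => j _; rewrite coefZ coefXn.
  apply: (subringM sB); last first.
    by case: (_ == _); [exact: subring1|exact: subring0].
  by do 3![apply: (subringM sB) => //].
rewrite hornerD horner_sum horner_poly -qu horner_coef de big_ord_recr/=.
congr (_ + _); rewrite ue mulr_sumr; apply: eq_bigr => j _.
by rewrite hornerZ hornerXn !mulrA.
Qed.

(** If neither u nor its inverse is in B then y becomes invertible when either
    one is adjoined, which is excluded by [no_two_relations]. *)
Lemma valuation_ring u : u != 0 -> B u \/ B u^-1.
Proof.
move=> u0; have adj v : ~ B v -> exists2 q : {poly F},
    (forall i, B q`_i) & q.[v] = y^-1.
  move=> nBv; apply: contrapT => nq.
  pose B' := [set x | exists2 q : {poly F}, (forall i, B q`_i) & q.[v] = x].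
  have BB' : B `<=` B'.
    move=> b Bb; exists b%:P; rewrite ?hornerC// => i; rewrite coefC.
    by case: ifP => // _; exact: subring0.
  have : B' v.
    exists 'X; rewrite ?hornerX// => i; rewrite coefX.
    by case: (_ == _); [exact: subring1|exact: subring0].
  suff -> : B' = B by [].
  apply: maxB => //; split.
  - split.
    + by apply: BB'; exact: subring1.
    + move=> _ _ [q Bq <-] [r Br <-]; exists (q - r); last by rewrite !hornerE.
      by move=> i; rewrite coefB; exact: subringB.
    + move=> _ _ [q Bq <-] [r Br <-]; exists (q * r); last by rewrite !hornerE.
      move=> i; rewrite coefM; apply: (subring_sum sB) => j _.
      exact: subringM.
  - by move=> c; exact: BB'.
  - exact: BB'.
  exact: nq.
have [|nu] := pselect (B u); first by left.
have [|nv] := pselect (B u^-1); first by right.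
have [q Bq qu] := adj _ nu; have [r Br ru] := adj _ nv.
by case: (no_two_relations u0 (leqnn _) Bq Br qu ru).
Qed.

Definition vunit u := [/\ u != 0, B u & B u^-1].

Lemma vunitM u v : vunit u -> vunit v -> vunit (u * v).
Proof.
move=> [u0 Bu Bu'] [v0 Bv Bv']; split; first by rewrite mulf_neq0.
  exact: subringM.
by rewrite invfM; exact: subringM.
Qed.

Lemma vunitV u : vunit u -> vunit u^-1.
Proof. by move=> [u0 Bu Bu']; split; rewrite ?invr_eq0 ?invrK. Qed.

Lemma vunit1 : vunit 1.
Proof. by split; rewrite ?oner_eq0 ?invr1//; exact: subring1. Qed.

Lemma vunitX u n : vunit u -> vunit (u ^+ n).
Proof.
move=> uu; elim: n => [|n IH]; first exact: vunit1.
by rewrite exprS; exact: vunitM.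
Qed.

(** In a valuation ring a sum of two terms of different values has the value of
    one of them. *)
Lemma vunit_add u v : u != 0 -> v != 0 -> ~ vunit (u / v) ->
  (vunit ((u + v) / v)) \/ (vunit ((u + v) / u)).
Proof.
have key w : w != 0 -> B w -> ~ B w^-1 -> vunit (1 + w).
  move=> w0 Bw nw; have w1 : 1 + w != 0.
    apply/eqP => /eqP; rewrite addrC addr_eq0 => /eqP wN; apply: nw.
    by rewrite wN invrN invr1 -wN.
  split => //; first by apply: (subringD sB) => //; exact: subring1.
  have [//|/(subringM sB)] : B (1 + w)^-1 \/ B (1 + w)^-1^-1.
    by apply: valuation_ring; rewrite invr_eq0.
  rewrite invrK => H.
  have [//|Bw'] : B ((1 + w)^-1) \/ B ((1 + w) / w).
    rewrite -[(1 + w) / w]invrK invfM invrK.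
    have [] := @valuation_ring ((1 + w)^-1 * w); rewrite ?mulf_neq0 ?invr_eq0//.
      move=> B1; left; have -> : (1 + w)^-1 = 1 - (1 + w)^-1 * w by field.
      by apply: (subringB sB) => //; exact: subring1.
    by right.
  case: nw; have -> : w^-1 = (1 + w) / w - 1 by field.
  by apply: (subringB sB) => //; exact: subring1.
move=> u0 v0 nuv; have uv0 : u / v != 0 by rewrite mulf_neq0 ?invr_eq0.
have [Buv|Bvu] := valuation_ring uv0.
  left; have -> : (u + v) / v = 1 + u / v by field.
  by apply: key => // nB; apply: nuv.
right; have -> : (u + v) / u = 1 + (u / v)^-1 by field; rewrite u0 v0.
by apply: key; rewrite ?invr_eq0// invrK => nB; apply: nuv.
Qed.

(** Terms with pairwise different values cannot cancel. *)
Lemma vunit_sum (I : eqType) (i0 : I) (s : seq I) (t : I -> F) :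
  (forall i, t i != 0) -> uniq (i0 :: s) ->
  {in i0 :: s &, forall i j, i != j -> ~ vunit (t i / t j)} ->
  exists2 i, i \in i0 :: s & vunit ((\sum_(j <- i0 :: s) t j) / t i).
Proof.
move=> t0; elim: s i0 => [|j s IH] i0 us H.
  exists i0; first by rewrite inE.
  by rewrite big_seq1 divff//; exact: vunit1.
move: us => /andP[i0js /IH[|i ijs uS]].
  by move=> i i' si si'; apply: H; rewrite inE ?si ?si' orbT.
rewrite big_cons; set S := \sum_(_ <- _) _ in uS *.
have S0 : S != 0 by case: uS; rewrite mulf_eq0 negb_or => /andP[].
have ni : i0 != i by apply: contraNneq i0js => ->.
have nS : ~ vunit (t i0 / S).
  move=> iS; apply: (H _ _ _ _ ni); [by rewrite inE eqxx|by rewrite inE ijs orbT|].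
  by have := vunitM iS uS; rewrite mulrA divfK.
have [uSS|uSi] := vunit_add (t0 i0) S0 nS.
  exists i; first by rewrite inE ijs orbT.
  by have := vunitM uSS uS; rewrite mulrA divfK.
by exists i0 => //; rewrite inE eqxx.
Qed.

(** A polynomial in y is its lowest term times an element of 1 + y B. *)
Lemma ev_unit (p : {poly k}) : p != 0 ->
  exists e : nat, vunit (ev y p / y ^+ e).
Proof.
have [n] := ubnP (size p); elim: n p => // n IH p szp p0.
have [p00|p00] := eqVneq p`_0 0.
  have pE : p = (p %/ 'X) * 'X.
    by apply/esym/divpK; rewrite -['X]subr0 -polyC0 dvdp_XsubCl /root horner_coef0 p00.
  have q0 : p %/ 'X != 0 by apply: contraNneq p0 => q0; rewrite pE q0 mul0r.
  have [|//|e eP] := IH (p %/ 'X).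
    by rewrite -ltnS (leq_trans _ szp)// ltnS [in ltnRHS]pE size_mulX.
  exists e.+1; rewrite {1}pE rmorphM/= evX exprSr invfM mulrACA divff// mulr1.
  exact: eP.
exists 0%N; rewrite expr0 divr1.
have c0 : const F p`_0 != 0 by rewrite fmorph_eq0.
have -> : ev y p = const F p`_0 * (1 - y * - (const F (p`_0)^-1 * ev y (p %/ 'X))).
  rewrite [in LHS](divp_eq p 'X) rmorphD rmorphM/= evX.
  have -> : p %% 'X = (p`_0)%:P.
    by rewrite -['X]subr0 -polyC0 modp_XsubC horner_coef0.
  rewrite evC fmorphV; field; exact: c0.
have Bq : B (- (const F (p`_0)^-1 * ev y (p %/ 'X))).
  apply: (subringN sB); apply: (subringM sB) => //.
  rewrite /ev/= horner_evalE; apply: (subring_horner sB) => // i.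
  by rewrite coef_map; exact: cB.
apply: vunitM; split=> //.
- by rewrite -fmorphV; exact: cB.
- exact: one_sub_neq0.
- by apply: (subringB sB); [exact: subring1|exact: subringM].
- exact: one_sub_inv.
Qed.

Lemma vunit_y_pow (e : int) : vunit (y ^ e) -> e = 0.
Proof.
have pos n : ~ B (y ^- n.+1).
  move=> Bn; apply: nBy; have -> : y^-1 = y ^+ n * y ^- n.+1.
    by rewrite exprS; field; rewrite y0 expf_neq0.
  by apply: (subringM sB) => //; exact: subringX.
case: e => [[//|n]|n] [_ Bu Bv]; first by case: (pos n); exact: Bv.
by case: (pos n); exact: Bu.
Qed.

(** By [exists_ev_dim] the powers 1, u, ..., u^D satisfy a relation over k[y].
    Two of its terms have the same value, and this compares a power of u of
    positive exponent at most D with a power of y. *)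
Lemma exists_value_exponent : exists2 m, (0 < m)%N &
  forall u, u != 0 -> exists e : int, vunit (u ^+ m / y ^ e).
Proof.
have [D [_ [_ dimD]]] := exists_ev_dim y.
exists (D`!); first exact: fact_gt0.
move=> u u0; have [|p [[i0 pi0] pE]] := @dimD unit 'I_D.+1 (fun i _ => u ^+ i).
  by rewrite card_unit mul1n card_ord.
pose t (i : 'I_D.+1) := if p i == 0 then 1 else ev y (p i) * u ^+ i.
have tn0 i : t i != 0.
  rewrite /t; case: (eqVneq (p i) 0) => [_|p0]; first by rewrite oner_eq0.
  by rewrite mulf_neq0 ?expf_neq0//; apply: contraNneq p0 => /y_tr ->.
have [i [j [ij pi pj uij]]] :
    exists i j, [/\ i != j, p i != 0, p j != 0 & vunit (t i / t j)].
  apply: contrapT => nij.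
  pose s := [seq i <- enum 'I_D.+1 | p i != 0].
  have sE : \sum_(i <- s) t i = 0.
    rewrite -[RHS](pE tt) /s big_filter big_enum_cond/=.
    rewrite [RHS](bigID (fun i => p i != 0))/= [X in _ = _ + X]big1 ?addr0.
      by apply: eq_big => // i /negPf pi; rewrite /t pi.
    by move=> i; rewrite negbK => /eqP ->; rewrite rmorph0 mul0r.
  have si i : i \in s -> p i != 0 by rewrite mem_filter => /andP[].
  have : i0 \in s by rewrite mem_filter pi0 mem_enum.
  have : uniq s by apply: filter_uniq; exact: enum_uniq.
  move: sE si; case: s => [//|x s] sE si us _.
  have [||z _] := @vunit_sum _ x s t _ us; last by rewrite sE mul0r => -[]; rewrite eqxx.
    exact: tn0.
  by move=> z z' /si pz /si pz' zz' uz; apply: nij; exists z, z'.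
wlog lij : i j ij pi pj uij / (j < i)%N.
  move=> H; have [ltij|ltji|/val_inj eij] := ltngtP i j.
  - apply: (H j i) => //; first by rewrite eq_sym.
    by rewrite -[_ / _]invrK; apply: vunitV; rewrite invf_div.
  - exact: (H i j).
  by rewrite eij eqxx in ij.
have [e eP] := ev_unit pi; have [e' eP'] := ev_unit pj.
have uy0 n : y ^+ n != 0 by rewrite expf_neq0.
have H : vunit (u ^+ (i - j) / y ^ (e'%:Z - e%:Z)).
  have -> : u ^+ (i - j) / y ^ (e'%:Z - e%:Z) =
     (t i / t j) * (ev y (p j) / y ^+ e') / (ev y (p i) / y ^+ e).
    rewrite expfzDr// -invr_expz -!exprnP /t (negPf pi) (negPf pj).
    rewrite -[in u ^+ i](subnK (ltnW lij)) exprD; field.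
    rewrite !uy0 expf_neq0//=; apply/andP; split.
      by apply: contraNneq pi => /y_tr ->.
    by apply: contraNneq pj => /y_tr ->.
  by apply: vunitM; [exact: vunitM|exact: vunitV].
(* D! is a multiple of all possible differences i - j *)
have /dvdnP[m mE] : (i - j %| D`!)%N.
  apply: dvdn_fact; rewrite subn_gt0 lij/= (leq_trans (leq_subr _ _))//.
  by rewrite -ltnS.
exists ((e'%:Z - e%:Z) * m); rewrite mE mulnC exprM -exprz_exp.
by rewrite -exprnP -expr_div_n; exact: vunitX.
Qed.

(** The exponent w u with u^m ~ y^(w u) is a valuation with integral values.
    Division by a generator of its value group normalises it. *)
Lemma place_of_maximal : exists P : place F, 0 < P y.
Proof.
have [m m0 mP] := exists_value_exponent.
have mP' u : exists e : int, u != 0 -> vunit (u ^+ m / y ^ e).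
  by have [u0|u0] := eqVneq u 0; [exists 0|have [e] := mP _ u0; exists e].
have [w wP] := choice mP'.
have yz0 (e : int) : y ^ e != 0 by rewrite expfz_neq0.
have wU u e : u != 0 -> vunit (u ^+ m / y ^ e) -> w u = e.
  move=> u0 ue; apply/eqP; rewrite -subr_eq0; apply/eqP/vunit_y_pow.
  have -> : y ^ (w u - e) = (u ^+ m / y ^ e) / (u ^+ m / y ^ w u).
    by rewrite expfzDr// -invr_expz; field; rewrite !yz0 expf_neq0.
  by apply: vunitM => //; apply: vunitV; exact: wP.
have wM u v : u != 0 -> v != 0 -> w (u * v) = w u + w v.
  move=> u0 v0; apply: wU; first by rewrite mulf_neq0.
  rewrite exprMn expfzDr// invfM mulrACA.
  by apply: vunitM; exact: wP.
have wy : w y = m by apply: wU => //; rewrite -exprnP divff ?expf_neq0//; exact: vunit1.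
have wB u : u != 0 -> B u -> 0 <= w u.
  move=> u0 Bu; rewrite leNgt; apply/negP => wu; apply: nBy.
  have [n wn] : exists n, w u = - n.+1%:Z.
    by case: (w u) wu => // n _; exists n; rewrite NegzE.
  have := wP _ u0; rewrite wn => -[_ _]; rewrite -invr_expz invrK invfM => Bi.
  have -> : y^-1 = y ^+ n * (u ^+ m * (u ^- m * y ^ (- n.+1%:Z))).
    rewrite -invr_expz -exprnP exprS; field; rewrite y0 !expf_neq0//.
  by do 2![apply: (subringM sB); first exact: subringX]; rewrite -invr_expz.
have wD u v : u != 0 -> v != 0 -> u + v != 0 ->
    Num.min (w u) (w v) <= w (u + v).
  have key u' v' : u' != 0 -> v' != 0 -> u' + v' != 0 -> B (u' / v') ->
      w v' <= w (u' + v').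
    move=> u0 v0 uv0 Buv; have E : u' + v' = v' * (1 + u' / v') by field.
    have n0 : 1 + u' / v' != 0.
      by apply: contraNneq uv0 => n0; rewrite E n0 mulr0.
    rewrite E wM// lerDl wB//; apply: (subringD sB) => //; exact: subring1.
  move=> u0 v0 uv0; have uv : u / v != 0 by rewrite mulf_neq0 ?invr_eq0.
  have [Buv|] := valuation_ring uv; first by rewrite ge_min key ?orbT.
  by rewrite invf_div => Bvu; rewrite ge_min addrC key// addrC.
have w1 : w 1 = 0.
  by apply: wU; rewrite ?oner_eq0// expr1n expr0z divr1; exact: vunit1.
have wX u (n : nat) : u != 0 -> w (u ^+ n) = w u *+ n.
  move=> u0; elim: n => [|n IH]; first by rewrite expr0 mulr0n.
  by rewrite exprS wM ?expf_neq0// IH mulrS.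
have wV u : u != 0 -> w u^-1 = - w u.
  move=> u0; apply/eqP; rewrite -addr_eq0 addrC -wM ?invr_eq0//.
  by rewrite divff// w1.
have ex : exists n, `[< (0 < n)%N /\ exists2 u, u != 0 & w u = n%:Z >].
  by exists m; apply/asboolP; split=> //; exists y.
(* g generates the value group of w *)
case: (ex_minnP ex) => g /asboolP[g0 [ug ug0 wug]] gmin.
have gdvd u : u != 0 -> w u = (w u %/ g)%Z * g.
  move=> u0; have E := divz_eq (w u) g.
  have r0 := @modz_ge0 (w u) g; have rg := @ltz_pmod (w u) g.
  have [z z0 zE] : exists2 z, z != 0 & w z = (w u %% g)%Z.
    case: (w u %/ g)%Z E => [n|n] E.
      exists (u / ug ^+ n); first by rewrite mulf_neq0 ?invr_eq0 ?expf_neq0.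
      by rewrite wM ?invr_eq0 ?expf_neq0// wV ?expf_neq0// wX// wug; lia.
    exists (u * ug ^+ n.+1); first by rewrite mulf_neq0 ?expf_neq0.
    by rewrite wM ?expf_neq0// wX// wug; lia.
  suff z00 : (w u %% g)%Z = 0 by rewrite [LHS]E z00 addr0.
  have /r0 : g%:Z != 0 by lia.
  have /rg : 0 < g%:Z by lia.
  case: (w u %% g)%Z zE => // -[//|n] zE ng _.
  have := gmin n.+1; rewrite leqNgt => /(_ _)/negP; case; last by lia.
  by apply/asboolP; split=> //; exists z.
pose P u := if u == 0 then 0 else (w u %/ g)%Z.
have gz : g%:Z != 0 by lia.
have PE u : u != 0 -> w u = P u * g.
  by move=> u0; rewrite /P (negPf u0); exact: gdvd.
have P0 : P 0 = 0 by rewrite /P eqxx.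
have PM u v : u != 0 -> v != 0 -> P (u * v) = P u + P v.
  move=> u0 v0; apply: (mulIf gz); rewrite mulrDl -!PE//; first exact: wM.
  by rewrite mulf_neq0.
have PD u v : u != 0 -> v != 0 -> u + v != 0 ->
    Num.min (P u) (P v) <= P (u + v).
  move=> u0 v0 uv0; have := wD u v u0 v0 uv0; rewrite !PE//.
  by rewrite !ge_min !ler_pM2r//; lia.
have Pu : exists u, P u = 1.
  by exists ug; apply: (mulIf gz); rewrite -PE// wug mul1r.
exists (Place P0 PM PD Pu) => /=.
have gp : 0 < g%:Z by lia.
by rewrite -(pmulr_lgt0 _ gp) -PE// wy; lia.
Qed.

End MaximalAvoiding.

Lemma exists_zero_place : exists P : place F, 0 < P y.
Proof.
have [B [avB maxB]] := maximal_avoiding.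
exact: place_of_maximal avB maxB.
Qed.
End PoleExists.

Lemma place_val1 (F : fieldType) (P : place F) : P 1 = 0.
Proof.
have := place_valM P (oner_neq0 F) (oner_neq0 F).
by rewrite mulr1 => /eqP; rewrite -[X in X == _]addr0 (inj_eq (addrI _)) => /eqP.
Qed.

Lemma place_valV (F : fieldType) (P : place F) x : P x^-1 = - P x.
Proof.
have [->|x0] := eqVneq x 0; first by rewrite invr0 place_val0 oppr0.
apply/eqP; rewrite -addr_eq0 -place_valM ?invr_eq0// mulVf//.
by rewrite place_val1.
Qed.

(** A transcendental x has a pole at any place at which 1 / x has a zero. *)
Lemma no_pole_algebraic (k : finFieldType) (F : fieldExtType {fraction {poly k}})
    (x : F) : (forall P : place F, 0 <= P x) -> algebraicOver (@const k F) x.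
Proof.
move=> Px; apply: contrapT => nalg.
have x0 : x != 0.
  apply: contra_notN nalg => /eqP ->; exists 'X; first by rewrite polyX_eq0.
  by rewrite map_polyX rootX.
have [|P Py] := @exists_zero_place k F x^-1.
  move=> p px; apply/eqP; apply: contra_notT nalg => p0.
  pose n := size p; pose q := \poly_(i < n) p`_(n.-1 - i).
  (* q is the reciprocal polynomial of p *)
  exists q.
    apply/eqP => /polyP/(_ 0); rewrite coef_poly coef0 subn0.
    rewrite size_poly_gt0 p0 => /eqP.
    by rewrite -/(lead_coef p) lead_coef_eq0 (negPf p0).
  have n0 : (0 < n)%N by rewrite size_poly_gt0.
  have : ev x^-1 p * x ^+ n.-1 = 0 by rewrite px mul0r.
  rewrite /ev/= horner_evalE horner_poly mulr_suml => E.
  rewrite /root (@horner_coef_wide _ n); last first.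
    by rewrite (leq_trans (size_poly _ _))// size_poly.
  rewrite -[X in _ == X]E (reindex_inj rev_ord_inj)/=; apply/eqP.
  apply: eq_bigr => i _; rewrite coef_map coef_poly/=.
  have idx (a b : nat) : (b < a)%N -> (a.-1 - (a - b.+1) = b)%N by lia.
  have le : (n - i.+1 < n)%N by rewrite ltn_subrL n0.
  rewrite le -mulrA; congr (const _ _`_ _ * _).
    exact: idx (ltn_ord i).
  have -> : (n - i.+1 = n.-1 - i)%N by rewrite -subn1 -subnDA add1n.
  have li : (i <= n.-1)%N by rewrite -ltnS prednK.
  by rewrite -[in RHS](subnK li) exprD exprVn mulrCA mulVf ?mulr1// expf_neq0.
by have := Px P; rewrite place_valV in Py; lia.
Qed.

(** * The ring of regular functions *)

(** A longest sequence of pairwise inequivalent elements. *)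
Lemma exists_transversal (T : choiceType) (M : set T) (E : T -> T -> Prop) (B : nat) :
  (forall x y, E x y -> E y x) ->
  (forall s : seq T, uniq s -> (forall x, x \in s -> M x) ->
     {in s &, forall x y, x != y -> ~ E x y} -> (size s <= B)%N) ->
  exists s : seq T, [/\ uniq s, forall x, x \in s -> M x,
    {in s &, forall x y, x != y -> ~ E x y} &
    forall x, M x -> x \in s \/ exists2 y, y \in s & E x y].
Proof.
move=> Esym HB; pose good (s : seq T) := [/\ uniq s, forall x, x \in s -> M x &
    {in s &, forall x y, x != y -> ~ E x y}].
have ex0 : exists n, `[< exists2 s, good s & size s = n >].
  by exists 0%N; apply/asboolP; exists [::].
have ub n : `[< exists2 s, good s & size s = n >] -> (n <= B)%N.
  by move=> /asboolP[s [us Ms Es] <-]; exact: HB.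
case: (ex_maxnP ex0 ub) => n /asboolP[s [us Ms Es] sn] smax.
exists s; split=> // x Mx; apply: contrapT => /not_orP[xs nE].
have /negP xs' : ~ x \in s by [].
suff /smax : `[< exists2 s, good s & size s = n.+1 >] by rewrite ltnn.
apply/asboolP; exists (x :: s); last by rewrite /= sn.
split; first by rewrite /= xs'.
  by move=> y; rewrite inE => /predU1P[->|/Ms].
move=> y z; rewrite !inE => /predU1P[->|ys] /predU1P[->|zs] yz.
- by rewrite eqxx in yz.
- by move=> xz; apply: nE; exists z.
- by move=> /Esym yx; apply: nE; exists y.
- exact: Es.
Qed.

Lemma invX_mulX (F : fieldType) (g : F) i m : g != 0 -> (i <= m)%N ->
  g^-1 ^+ (m - i) * g ^+ m = g ^+ i.
Proof.
move=> g0 im; rewrite -[X in _ * g ^+ X](subnK im) exprD mulrA -exprMn mulVf//.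
by rewrite expr1n mul1r.
Qed.

Lemma mulrn_ge1 (z : int) n : 1 <= z -> (0 < n)%N -> 1 <= z *+ n.
Proof.
case: n => // n z1 _; rewrite mulrS; have : 0 <= z *+ n by rewrite mulrn_wge0//; lia.
by lia.
Qed.

Lemma count_lt (T : eqType) (r : T) (p q : pred T) (s : seq T) :
  (forall z, p z -> q z) -> r \in s -> q r -> ~~ p r -> (count p s < count q s)%N.
Proof.
move=> pq + qr npr; elim: s => // z s IH; rewrite inE => /predU1P[<-|rs] /=.
  by rewrite qr (negPf npr) add0n add1n ltnS; exact: sub_count.
by rewrite -addnS leq_add ?IH//; case: (boolP (p z)) => // /pq ->.
Qed.

Section Places.
Variables (F : fieldType) (P : place F).

Lemma place_valX x n : P (x ^+ n) = P x *+ n.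
Proof.
have [->|x0] := eqVneq x 0.
  case: n => [|n]; first by rewrite expr0 mulr0n place_val1.
  by rewrite expr0n place_val0 mul0rn.
elim: n => [|n IH]; first by rewrite expr0 mulr0n place_val1.
by rewrite exprS place_valM ?expf_neq0// IH mulrS.
Qed.

Lemma place_valN x : P (- x) = P x.
Proof.
have N1 : P (-1) = 0.
  have : P ((-1) ^+ 2) = 0 by rewrite sqrrN expr1n place_val1.
  by rewrite place_valX; lia.
have [->|x0] := eqVneq x 0; first by rewrite oppr0.
by rewrite -mulN1r place_valM ?oppr_eq0 ?oner_eq0// N1 add0r.
Qed.

(** The value at 0 is 0 by convention, so that 0 has to be included separately.
    *)
Definition val_ge n : set F := [set x | x = 0 \/ n <= P x].

Lemma val_geD n x y : val_ge n x -> val_ge n y -> val_ge n (x + y).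
Proof.
have [->|x0] := eqVneq x 0; first by rewrite add0r.
have [->|y0] := eqVneq y 0; first by rewrite addr0.
have [->|xy0] := eqVneq (x + y) 0; first by left.
move=> [/eqP|nx]; first by rewrite (negPf x0).
move=> [/eqP|ny]; first by rewrite (negPf y0).
by right; rewrite (le_trans _ (place_valD P x0 y0 xy0))// le_min nx.
Qed.

Lemma val_geN n x : val_ge n x -> val_ge n (- x).
Proof. by move=> [->|nx]; [left; rewrite oppr0|right; rewrite place_valN]. Qed.

Lemma val_geB n x y : val_ge n x -> val_ge n y -> val_ge n (x - y).
Proof. by move=> nx ny; apply: val_geD => //; exact: val_geN. Qed.

Lemma val_geM n m x y : val_ge n x -> val_ge m y -> val_ge (n + m) (x * y).
Proof.
have [->|x0] := eqVneq x 0; first by rewrite mul0r; left.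
have [->|y0] := eqVneq y 0; first by rewrite mulr0; left.
move=> [/eqP|nx]; first by rewrite (negPf x0).
move=> [/eqP|ny]; first by rewrite (negPf y0).
by right; rewrite place_valM// lerD.
Qed.

Lemma val_ge0E x : val_ge 0 x <-> 0 <= P x.
Proof. by split=> [[->|//]|]; [rewrite place_val0|right]. Qed.

Lemma valuation_subring : is_subring [set x | 0 <= P x].
Proof.
split=> /=; first by rewrite place_val1.
  by move=> x y /val_ge0E nx /val_ge0E ny; apply/val_ge0E; exact: val_geB.
move=> x y /val_ge0E nx /val_ge0E ny; apply/val_ge0E.
by rewrite -[0]addr0; exact: val_geM.
Qed.

Lemma val_ge_sum n (I : Type) (r : seq I) (Q : pred I) (f : I -> F) :
  (forall i, Q i -> val_ge n (f i)) -> val_ge n (\sum_(i <- r | Q i) f i).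
Proof.
by move=> nf; elim/big_rec: _ => [|i x Qi nx]; [left|apply: val_geD => //; exact: nf].
Qed.

(** In an equation of integral dependence for an element of negative value the
    leading term alone would have the smallest value. *)
Lemma integral_val_ge0 (m : nat) (c : nat -> F) (g : F) :
  (forall i, 0 <= P (c i)) -> g ^+ m = \sum_(i < m) c i * g ^+ i -> 0 <= P g.
Proof.
move=> c0 E; rewrite leNgt; apply/negP => gneg.
have g0 : g != 0 by apply: contraTneq gneg => ->; rewrite place_val0.
case: m E => [|m] E.
  by move: E; rewrite expr0 big_ord0 => /eqP; rewrite oner_eq0.
suff : 0 <= P g by rewrite leNgt gneg.
have -> : g = \sum_(i < m.+1) c i * g^-1 ^+ (m - i).
  apply: (mulIf (expf_neq0 m g0)); rewrite -exprS E mulr_suml.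
  apply: eq_bigr => i _; rewrite -mulrA; congr (_ * _).
  have im : (i <= m)%N by rewrite -ltnS.
  by rewrite invX_mulX.
have := subring_sum valuation_subring; apply => i _ /=.
apply: (subringM valuation_subring); first exact: c0.
by rewrite /= place_valX place_valV; apply: mulrn_wge0; lia.
Qed.

End Places.

Section RegularRing.
Variables (k : finFieldType) (F : fieldExtType {fraction {poly k}}).
Hypothesis Hk : is_constant_field F.
Variable (infty : place F).
Local Notation A := (regular infty).

Lemma place_const (P : place F) c : P (const F c) = 0.
Proof.
have [->|c0] := eqVneq c 0; first by rewrite rmorph0 place_val0.
have : P (const F c ^+ #|k|) = P (const F c) by rewrite -rmorphXn expf_card.
by rewrite place_valX; have := finRing_gt1 k; case: #|k| => [|[|n]]//; lia.
Qed.

Lemma regular_subring : is_subring A.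
Proof.
split; first by move=> P _; rewrite place_val1.
  by move=> x y Ax Ay P Pi; apply: (subringB (valuation_subring P)); [exact: Ax|exact: Ay].
by move=> x y Ax Ay P Pi; apply: (subringM (valuation_subring P)); [exact: Ax|exact: Ay].
Qed.

Lemma regular_const c : A (const F c).
Proof. by move=> P _; rewrite place_const. Qed.

(** Such an x has no pole at all and is algebraic over k. *)
Lemma regular_bounded_const x : A x -> 0 <= infty x -> exists c, x = const F c.
Proof.
move=> Ax x0; apply: Hk; apply: no_pole_algebraic => P.
by have [->//|/Ax] := pselect (P = infty).
Qed.

Lemma regular_val x : A x -> infty x <= 0.
Proof.
move=> Ax; rewrite leNgt; apply/negP => x0.
by have [c xc] := regular_bounded_const Ax (ltW x0); rewrite xc place_const in x0.
Qed.

Lemma regular_ev a p : A a -> A (ev a p).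
Proof.
move=> Aa; apply: (subring_horner regular_subring) => // i.
by rewrite coef_map; exact: regular_const.
Qed.

(** The terms of a polynomial in a have different orders at infty. *)
Lemma ev_eq0 a p : infty a < 0 -> ev a p = 0 -> p = 0.
Proof.
move=> a0 pa; apply/eqP; apply: contraT => p0; have a_n0 : a != 0.
  by apply: contraTneq a0 => ->; rewrite place_val0.
have sp : (0 < size p)%N by rewrite size_poly_gt0.
have szE : size p = (size p).-1.+1 by rewrite prednK.
have lc : const F (lead_coef p) != 0 by rewrite fmorph_eq0 lead_coef_eq0.
suff : val_ge infty 1 (const F (lead_coef p)).
  by move=> [/eqP|]; [rewrite (negPf lc)|rewrite place_const].
have -> : const F (lead_coef p) =
    - \sum_(i < (size p).-1) const F p`_i * a^-1 ^+ ((size p).-1 - i).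
  apply/eqP; rewrite -addr_eq0; apply/eqP.
  apply: (mulIf (expf_neq0 (size p).-1 a_n0)); rewrite mul0r -[RHS]pa.
  rewrite /ev/= horner_evalE /map_poly horner_poly [in RHS]szE big_ord_recr/=.
  rewrite mulrDl addrC mulr_suml; congr (_ + _); apply: eq_bigr => i _.
  rewrite -mulrA; congr (_ * _).
  by rewrite invX_mulX// ltnW.
apply: val_geN; apply: val_ge_sum => i _.
rewrite -[1]add0r; apply: val_geM; right; first by rewrite place_const.
rewrite place_valX place_valV; apply: mulrn_ge1; first lia.
by rewrite subn_gt0.
Qed.

(** Multiplied by the leading coefficient of an equation over k[a], f becomes
    integral over k[a], hence regular by [integral_val_ge0]. *)
Lemma regular_denom a f : A a -> infty a < 0 ->
  exists c, [/\ A c, c != 0 & A (c * f)].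
Proof.
move=> Aa a0; have [D [_ [_ dimD]]] := exists_ev_dim a.
have [|p [[i0 pi0] pE]] := @dimD unit 'I_D.+1 (fun i _ => f ^+ i).
  by rewrite card_unit mul1n card_ord.
have {}pE := pE tt.
case: (@arg_maxnP _ i0 (fun i => p i != 0) val pi0) => m pm mmax.
pose c := ev a (p m).
have c0 : c != 0 by apply: contraNneq pm => /(ev_eq0 a0) ->.
exists c; split=> //; first exact: regular_ev.
pose q (i : nat) : {poly k} := if (i < D.+1)%N then p (inord i) else 0.
have pq : \sum_(i < m.+1) ev a (q i) * f ^+ i = 0.
  rewrite -[RHS]pE (big_ord_widen D.+1 (fun i => ev a (q i) * f ^+ i)) //.
  rewrite big_mkcond/=; apply: eq_bigr => i _; rewrite /q ltn_ord inord_val.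
  case: ifPn => //; rewrite -leqNgt => mi.
  have [->|/mmax/=] := eqVneq (p i) 0; first by rewrite rmorph0 mul0r.
  by move=> im; move: mi; rewrite ltnNge im.
have qm : q m = p m by rewrite /q ltn_ord inord_val.
move=> P Pi; move: pq; rewrite big_ord_recr/= qm -/c.
case: (nat_of_ord m) => [|m'].
  by rewrite big_ord0 add0r expr0 mulr1 => cE; move: c0; rewrite cE eqxx.
move=> /eqP; rewrite addr_eq0 => /eqP E.
apply: (@integral_val_ge0 _ P m'.+1 (fun i => - ev a (q i) * c ^+ (m' - i))).
  move=> i; rewrite mulNr place_valN.
  have PA x : A x -> 0 <= P x by apply.
  apply: (subringM (valuation_subring P)) => /=; first by apply: PA; exact: regular_ev.
  by apply: PA; apply: (subringX regular_subring); exact: regular_ev.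
rewrite exprMn exprSr -mulrA -[c * _]opprK -E mulrN mulr_sumr -sumrN.
apply: eq_bigr => i _; have im : (i <= m')%N by rewrite -ltnS.
by rewrite exprMn -[X in c ^+ X * (ev _ _ * _)](subnK im) exprD; ring.
Qed.

Lemma regular_common_denom a (I : finType) (f : I -> F) : A a -> infty a < 0 ->
  exists c, [/\ A c, c != 0 & forall i, A (c * f i)].
Proof.
move=> Aa a0; have [c cP] := choice (fun i => regular_denom (f i) Aa a0).
have A1 := regular_subring.
exists (\prod_i c i); split.
- by apply: (subring_prod A1) => i _; case: (cP i).
- by apply/prodf_neq0 => i _; case: (cP i).
move=> i; rewrite (bigD1 i)//= mulrAC; apply: (subringM A1).
  by case: (cP i).
by apply: (subring_prod A1) => j _; case: (cP j).
Qed.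

Section ModuleReduction.
Variables (K : fieldType) (g : {rmorphism F -> K}).

Record is_submodule (M : set K) : Prop := IsSubmodule {
  submodule0 : M 0 ;
  submoduleD : forall x y, M x -> M y -> M (x + y) ;
  submoduleZ : forall b x, A b -> M x -> M (g b * x) }.

Section Submodule.
Variables (M : set K) (HM : is_submodule M).

Lemma submoduleN x : M x -> M (- x).
Proof.
move=> Mx; rewrite -mulN1r -(rmorph1 g) -rmorphN; apply: (submoduleZ HM) => //.
exact: (subringN regular_subring (subring1 regular_subring)).
Qed.

Lemma submoduleB x y : M x -> M y -> M (x - y).
Proof. by move=> Mx My; apply: (submoduleD HM) => //; exact: submoduleN. Qed.

Lemma submodule_sum (I : Type) (r : seq I) (Q : pred I) (f : I -> K) :
  (forall i, Q i -> M (f i)) -> M (\sum_(i <- r | Q i) f i).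
Proof.
move=> Mf; elim/big_rec: _ => [|i x Qi Mx]; first exact: submodule0.
by apply: (submoduleD HM) => //; exact: Mf.
Qed.

End Submodule.

(** A bound for the rank of M over k[a], which makes sense before M is known to
    be finitely generated. *)
Definition ev_rank_le (a : F) (S : nat) (M : set K) :=
  forall (I : finType) (x : I -> K), (forall i, M (x i)) -> (S < #|I|)%N ->
    exists p : I -> {poly k}, (exists i, p i != 0) /\
      \sum_i g (ev a (p i)) * x i = 0.

Definition congr_mod (a : F) (M : set K) (x y : K) :=
  exists2 w, M w & x - y = g a * w.

Variables (a : F) (M : set K) (S : nat).
Hypothesis (Aa : A a) (a_neq0 : a != 0) (HM : is_submodule M).
Hypothesis rkM : ev_rank_le a S M.

(** The largest power of a common to all the coefficients is cancelled. *)
Lemma combination_div (I : finType) (x : I -> K) (p : I -> {poly k}) :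
  (exists i, p i != 0) -> \sum_i g (ev a (p i)) * x i = 0 ->
  exists q : I -> {poly k}, (exists i, (q i)`_0 != 0) /\
    \sum_i g (ev a (q i)) * x i = 0.
Proof.
have [n] := ubnP (\sum_i size (p i)); elim: n p => // n IH p szp [i0 pi0] pE.
have [q0|q0] := pselect (exists i, (p i)`_0 != 0); first by exists p.
have p00 i : (p i)`_0 = 0.
  by apply/eqP; apply: contra_notT q0 => pi; exists i.
pose q i := p i %/ 'X.
have pqE i : p i = q i * 'X.
  apply/esym/divpK.
  by rewrite -['X]subr0 -polyC0 dvdp_XsubCl /root horner_coef0 p00.
apply: (IH q).
- rewrite -ltnS (leq_trans _ szp)// ltnS (bigD1 i0)//= [ltnRHS](bigD1 i0)//=.
  have qi0 : q i0 != 0 by apply: contraNneq pi0 => q_0; rewrite pqE q_0 mul0r.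
  rewrite -addSn leq_add//; first by rewrite [in leqRHS]pqE size_mulX.
  apply: leq_sum => i _; have [->|qi] := eqVneq (q i) 0; first by rewrite size_poly0.
  by rewrite [in leqRHS]pqE size_mulX.
- by exists i0; apply: contraNneq pi0 => q_0; rewrite pqE q_0 mul0r.
have ga0 : g a != 0 by rewrite fmorph_eq0.
apply: (mulfI ga0); rewrite mulr0 -[RHS]pE mulr_sumr.
apply: eq_bigr => i _; rewrite [in RHS]pqE rmorphM/= evX rmorphM/=.
by rewrite mulrA [g a * _]mulrC.
Qed.

Definition indep_mod (t : nat) (x : 'I_t -> K) :=
  forall c : 'I_t -> k, (exists2 w, M w & \sum_i g (const F (c i)) * x i = g a * w) ->
    forall i, c i = 0.

(** After cancellation of a, the constant terms of a relation over k[a] give a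
    relation over k modulo a M. *)
Lemma indep_mod_leq t (x : 'I_t -> K) : (forall i, M (x i)) -> indep_mod x ->
  (t <= S)%N.
Proof.
move=> Mx xi; rewrite leqNgt; apply/negP => St.
have [|p [p0 pE]] := @rkM 'I_t x Mx; first by rewrite card_ord.
have [q [[i0 qi0] qE]] := combination_div p0 pE.
have : forall i, (q i)`_0 = 0; last by move/(_ i0)/eqP; rewrite (negPf qi0).
apply: (xi (fun i => (q i)`_0)).
exists (- \sum_i g (ev a (q i %/ 'X)) * x i).
  apply: (submoduleN HM); apply: (submodule_sum HM) => i _.
  by apply: (submoduleZ HM) => //; exact: regular_ev.
rewrite mulrN mulr_sumr -sumrN; apply/eqP; rewrite -subr_eq0 -sumrB.
rewrite -[X in _ == X]qE; apply/eqP; apply: eq_bigr => i _.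
rewrite [in RHS](divp_eq (q i) 'X) rmorphD rmorphM/= evX rmorphD rmorphM/=.
have -> : q i %% 'X = ((q i)`_0)%:P.
  by rewrite -['X]subr0 -polyC0 modp_XsubC horner_coef0.
by rewrite evC; ring.
Qed.

(** A maximal family that is independent over k modulo a M. *)
Lemma exists_generators_mod : exists (t : nat) (x : 'I_t -> K),
  [/\ (t <= S)%N, forall i, M (x i) & forall z, M z -> exists c : 'I_t -> k,
    congr_mod a M z (\sum_i g (const F (c i)) * x i)].
Proof.
have ex0 : exists t, `[< exists2 x : 'I_t -> K, forall i, M (x i) & indep_mod x >].
  by exists 0%N; apply/asboolP; exists (fun=> 0) => [[]|c _ []].
have ub t : `[< exists2 x : 'I_t -> K, forall i, M (x i) & indep_mod x >] ->
    (t <= S)%N.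
  by move=> /asboolP[x Mx xi]; exact: indep_mod_leq xi.
case: (ex_maxnP ex0 ub) => t /asboolP[x Mx xi] tmax.
exists t, x; split=> //; first by apply: indep_mod_leq xi.
move=> z Mz; apply: contrapT => nz.
suff /asboolP/tmax : exists2 x : 'I_t.+1 -> K, forall i, M (x i) & indep_mod x.
  by rewrite ltnn.
exists (fun i => if unlift ord0 i is Some j then x j else z).
  by move=> i; case: unliftP => [j|] _.
move=> c [w Mw]; rewrite big_ord_recl unlift_none.
under eq_bigr do rewrite liftK.
have [c0|c0] := eqVneq (c ord0) 0.
  rewrite c0 !rmorph0 mul0r add0r => E i.
  case: (unliftP ord0 i) => [j|] -> //.
  by apply: (xi (fun j => c (lift ord0 j))); exists w.
move=> E; case: nz; exists (fun j => - (c ord0)^-1 * c (lift ord0 j)).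
have gc0 : g (const F (c ord0)) != 0 by rewrite !fmorph_eq0.
exists (g (const F (c ord0)^-1) * w).
  by apply: (submoduleZ HM) => //; exact: regular_const.
apply: (mulfI gc0).
have -> : g (const F (c ord0)) * (g a * (g (const F (c ord0)^-1) * w)) = g a * w.
  by rewrite !fmorphV; field.
rewrite -E mulrBr; congr (_ + _); rewrite mulr_sumr -sumrN; apply: eq_bigr => j _.
by rewrite !rmorphM !rmorphN !fmorphV/=; field.
Qed.

Lemma congr_mod_sym x y : congr_mod a M x y -> congr_mod a M y x.
Proof.
move=> [w Mw xy]; exists (- w); first exact: (submoduleN HM).
by rewrite mulrN -xy opprB.
Qed.

Lemma congr_mod_trans y x z :
  congr_mod a M x y -> congr_mod a M y z -> congr_mod a M x z.
Proof.
move=> [w Mw xy] [w' Mw' yz]; exists (w + w'); first exact: (submoduleD HM).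
by rewrite mulrDr -xy -yz; ring.
Qed.

(** M / a M is a vector space over k of dimension at most S. *)
Lemma incongruent_leq (s : seq K) : uniq s -> (forall x, x \in s -> M x) ->
  {in s &, forall x y, x != y -> ~ congr_mod a M x y} -> (size s <= #|k| ^ S)%N.
Proof.
move=> us Ms Es; have [t [x [tS Mx xP]]] := exists_generators_mod.
have [c cP] := choice (fun i : 'I_(size s) => xP _ (Ms _ (mem_nth 0 (ltn_ord i)))).
have cinj : injective (fun i => [ffun j => c i j] : {ffun 'I_t -> k}).
  move=> i j /ffunP cij; apply: contrapT => ij.
  apply: (Es s`_i s`_j); rewrite ?mem_nth// ?nth_uniq//.
    by apply: contra_notN ij => /eqP/val_inj.
  apply: congr_mod_trans (cP i) _; apply: congr_mod_sym.
  rewrite (_ : \sum_(_ < _) _ = \sum_l g (const F (c j l)) * x l); first exact: cP.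
  by apply: eq_bigr => l _; have := cij l; rewrite !ffunE => ->.
have := leq_card _ cinj; rewrite card_ord card_ffun card_ord => /leq_trans; apply.
by rewrite leq_pexp2l// ltnW// finRing_gt1.
Qed.

End ModuleReduction.

Lemma regular_ev_rank a : exists S, ev_rank_le idfun a S A.
Proof.
have [D [_ [_ dimD]]] := exists_ev_dim a; exists D => I x _ DI.
have [|p [p0 pE]] := @dimD unit I (fun i _ => x i); first by rewrite card_unit mul1n.
by exists p; split=> //; exact: pE tt.
Qed.

Lemma regular_submodule : is_submodule idfun A.
Proof.
split; first exact: (subring0 regular_subring).
  exact: (subringD regular_subring).
by move=> b x Ab Ax; exact: (subringM regular_subring).
Qed.

(** A has finite rank over k[b], so that A / b A is finite by [incongruent_leq].
    *)
(** * Ideals of the ring of regular functions *)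

Lemma finite_residues b : A b -> b != 0 -> exists s : seq F,
  (forall x, x \in s -> A x) /\
  (forall x, A x -> exists2 r, r \in s & exists2 w, A w & x - r = b * w).
Proof.
move=> Ab b0; have [S rkS] := regular_ev_rank b.
have HA := regular_submodule.
have [||s [us As Es cov]] :=
    @exists_transversal F A (congr_mod idfun b A) (#|k| ^ S)%N.
- by move=> x y; exact: (congr_mod_sym HA).
- by move=> s; exact: (incongruent_leq Ab b0 HA rkS).
exists s; split=> // x Ax; have [xs|//] := cov x Ax.
by exists x => //; exists 0; [exact: (subring0 regular_subring)|rewrite subrr mulr0].
Qed.

Let sA := regular_subring.

(** The powers of y cannot all be different in the finite ring A / b A. *)
Lemma power_congruent b y : A b -> b != 0 -> A y ->
  exists n m, (n < m)%N /\ exists2 w, A w & y ^+ n - y ^+ m = b * w.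
Proof.
move=> Ab b0 Ay; have [s [As sP]] := finite_residues Ab b0.
have sP' n : exists r, r \in s /\ exists2 w, A w & y ^+ n - r = b * w.
  by have [r rs rP] := sP _ (subringX sA n Ay); exists r.
have [f fP] := choice sP'.
suff [i [j [ij fij]]] : exists i j, (i < j)%N /\ f i = f j.
  exists i, j; split=> //; case: (fP i) => _ [w Aw wE]; case: (fP j) => _ [w' Aw' wE'].
  exists (w - w'); first exact: (subringB sA).
  by rewrite mulrBr -wE -wE' fij; ring.
have : ~~ uniq [seq f i | i <- iota 0 (size s).+1].
  apply/negP => /uniq_leq_size; move=> /(_ s); rewrite size_map size_iota => H.
  have : (size s < size s)%N; last by rewrite ltnn.
  by apply: H => z /mapP[i _ ->]; case: (fP i).
move=> /(uniqPn 0)[i [j [ij]]]; rewrite size_map size_iota => js.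
rewrite !(nth_map 0%N) ?size_iota ?(ltn_trans ij)// !nth_iota ?(ltn_trans ij)//.
by move=> E; exists i, j.
Qed.

(** For b in I, a non-zero element of A / b A that is killed by I, divided by b,
    is a solution. To find one, the congruences y^n = y^m modulo b for
    representatives y of I give an element c0 of 1 + I, hence not in b A, that
    is killed by a power of each y. *)
Lemma ideal_colon I : is_ideal infty I -> (exists2 b, I b & b != 0) -> ~ I 1 ->
  exists2 x, ~ A x & forall y, I y -> A (x * y).
Proof.
move=> [IA I0 ID IZ] [b Ib b0] I1; have Ab := IA _ Ib.
have [s [As sP]] := finite_residues Ab b0.
have IN y : I y -> I (- y).
  by rewrite -mulN1r; apply: IZ; apply: (subringN sA); exact: subring1.
pose bA : set F := [set x | exists2 w, A w & x = b * w].
have bAI x : bA x -> I x by move=> [w Aw ->]; rewrite mulrC; exact: IZ.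
have bAZ u x : A u -> bA x -> bA (u * x).
  by move=> Au [w Aw ->]; exists (u * w); [exact: (subringM sA)|ring].
pose ys := [seq y <- s | `[< I y >]].
have ysI y : y \in ys -> I y by rewrite mem_filter => /andP[/asboolP].
(* c0 is the product of the 1 - y^(m - n) *)
have [c0 [Ac0 nc0 c0P]] : exists c0, [/\ A c0, ~ bA c0 &
    forall y, y \in ys -> exists n, bA (c0 * y ^+ n)].
  suff [c0 [Ac0 c01 c0P]] : exists c0, [/\ A c0, I (1 - c0) &
      forall y, y \in ys -> exists n, bA (c0 * y ^+ n)].
    exists c0; split=> // /bAI Ic0; apply: I1; rewrite -[1](subrK c0).
    exact: ID.
  elim: ys ysI => [|y ys' IH] ysI.
    by exists 1; split=> //; [exact: subring1|rewrite subrr].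
  have [|c0 [Ac0 c01 c0P]] := IH; first by move=> z zs; apply: ysI; rewrite inE zs orbT.
  have Iy : I y by apply: ysI; rewrite inE eqxx.
  have Ay := IA _ Iy.
  have [n [m [nm [w Aw wE]]]] := power_congruent Ab b0 Ay.
  have Iym : I (y ^+ (m - n)).
    have -> : (m - n = (m - n).-1.+1)%N by rewrite prednK// subn_gt0.
    by rewrite exprSr; apply: IZ => //; exact: (subringX sA).
  exists (c0 * (1 - y ^+ (m - n))); split.
  - apply: (subringM sA) => //; apply: (subringB sA); first exact: subring1.
    exact: IA.
  - have -> : 1 - c0 * (1 - y ^+ (m - n)) = (1 - c0) + c0 * y ^+ (m - n) by ring.
    by apply: ID => //; exact: IZ.
  move=> z; rewrite inE => /predU1P[->|zs]; last first.
    have [e eP] := c0P _ zs; exists e; rewrite mulrAC [_ * (1 - _)]mulrC.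
    by apply: bAZ => //; apply: (subringB sA); [exact: subring1|exact: IA].
  exists n; have -> : c0 * (1 - y ^+ (m - n)) * y ^+ n = c0 * (y ^+ n - y ^+ m).
    by rewrite -[X in y ^+ n - y ^+ X](subnK (ltnW nm)) exprD; ring.
  by rewrite wE; apply: bAZ => //; exists w.
(* c is a product of powers of the y, each as large as possible without killing
   c0 *)
have [c [Ac nc cP]] : exists c, [/\ A c, ~ bA (c * c0) &
    forall y, y \in ys -> bA (c * c0 * y)].
  move: c0 Ac0 nc0 c0P; elim: ys ysI => [|y ys' IH] ysI c0 Ac0 nc0 c0P.
    by exists 1; split=> //; [exact: subring1|rewrite mul1r].
  have Ay : A y by apply: IA; apply: ysI; rewrite inE eqxx.
  have yn : exists n, `[< bA (c0 * y ^+ n) >].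
    by have [|n] := c0P y; [rewrite inE eqxx|exists n; apply/asboolP].
  case: (ex_minnP yn) => -[|m] /asboolP mP mmin.
    by rewrite expr0 mulr1 in mP.
  have [||||c [Ac nc cP]] := IH _ (c0 * y ^+ m).
  - by move=> z zs; apply: ysI; rewrite inE zs orbT.
  - by apply: (subringM sA) => //; exact: (subringX sA).
  - by move=> /asboolP/mmin; rewrite ltnn.
  - move=> z zs; have [|e eP] := c0P z; first by rewrite inE zs orbT.
    exists e; rewrite mulrAC mulrC; apply: bAZ => //.
    exact: (subringX sA).
  exists (c * y ^+ m); split.
  - by apply: (subringM sA) => //; exact: (subringX sA).
  - by rewrite -mulrA [_ * c0]mulrC.
  move=> z; rewrite inE => /predU1P[->|zs].
    have -> : c * y ^+ m * c0 * y = c * (c0 * y ^+ m.+1) by rewrite exprS; ring.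
    exact: bAZ.
  by have := cP z zs; congr bA; ring.
exists (c * c0 / b).
  move=> Ax; apply: nc; exists (c * c0 / b) => //.
  by rewrite [RHS]mulrC divfK.
move=> y Iy; have [r rs [w Aw yr]] := sP _ (IA _ Iy).
have Ir : I r.
  have -> : r = y - (b * w) by rewrite -yr; ring.
  by apply: ID => //; apply: IN; apply: bAI; exists w.
have [|z Az zE] := cP r; first by rewrite mem_filter rs andbT; apply/asboolP.
have -> : c * c0 / b * y = z + c * c0 * w.
  have -> : y = r + b * w by rewrite -yr; ring.
  rewrite mulrDr; congr (_ + _); last by field.
  by apply: (mulfI b0); rewrite -zE; field.
apply: (subringD sA) => //; apply: (subringM sA) => //.
exact: (subringM sA).
Qed.

(** At a pole of x the values of x^n f are not bounded below. *)
Lemma colon_val_ge0 x f : f != 0 -> (forall n, A (x ^+ n * f)) -> A x.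
Proof.
move=> f0 H P Pi; rewrite leNgt; apply/negP => xneg.
have x0 : x != 0 by apply: contraTneq xneg => ->; rewrite place_val0.
have := H (absz (P f)).+1 P Pi.
rewrite place_valM ?expf_neq0// place_valX => {}H.
have : P x *+ `|P f|.+1 <= - (`|P f|.+1)%:Z.
  have -> : - (`|P f|.+1)%:Z = (-1) *+ `|P f|.+1 by rewrite mulNrn natz.
  by apply: ler_wMn2r; lia.
by lia.
Qed.

(** If I I^-1 were a proper ideal, [ideal_colon] would give an x not in A with x
    I I^-1 in A. As x then maps I^-1 into itself, all the x^n I are in A, so
    that x is in A after all. *)
Lemma ideal_inverse I : is_ideal infty I -> (exists2 b, I b & b != 0) ->
  exists (m : nat) (x y : 'I_m -> F), [/\ forall i, I (x i),
    forall i, inv_ideal infty I (y i) & \sum_i x i * y i = 1].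
Proof.
move=> II [b Ib b0]; have [IA I0 ID IZ] := II.
have inv1 : inv_ideal infty I 1 by move=> n In; rewrite mul1r; exact: IA.
pose J : set F := [set z | exists (m : nat) (x y : 'I_m -> F),
  [/\ forall i, I (x i), forall i, inv_ideal infty I (y i) & \sum_i x i * y i = z]].
suff : J 1 by [].
apply: contrapT => J1.
have J_ideal : is_ideal infty J.
  split.
  - move=> z [m [x [y [Ix Iy <-]]]]; apply: (subring_sum sA) => i _.
    by rewrite mulrC; exact: Iy.
  - by exists 0%N, (fun=> 0), (fun=> 0); split=> [[]|[]|]//; rewrite big_ord0.
  - move=> _ _ [m [x [y [Ix Iy <-]]]] [m' [x' [y' [Ix' Iy' <-]]]].
    exists (m + m')%N, (fun i : 'I_(m + m') => match fintype.split i with inl j => x j | inr j => x' j end),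
      (fun i : 'I_(m + m') => match fintype.split i with inl j => y j | inr j => y' j end); split.
    + by move=> i; case: (fintype.split i).
    + by move=> i; case: (fintype.split i).
    rewrite big_split_ord/=; congr (_ + _); apply: eq_bigr => i _.
      by rewrite (unsplitK (inl _ i)).
    by rewrite (unsplitK (inr _ i)).
  move=> a _ Aa [m [x [y [Ix Iy <-]]]].
  exists m, (fun i => a * x i), y; split=> // [i|]; first exact: IZ.
  by rewrite mulr_sumr; apply: eq_bigr => i _; rewrite mulrA.
have Jmul x y : I x -> inv_ideal infty I y -> J (x * y).
  by move=> Ix Iy; exists 1%N, (fun=> x), (fun=> y); split=> //; rewrite big_ord1.
have [|x nAx Jx] := ideal_colon J_ideal _ J1.
  by exists b => //; rewrite -[b]mulr1; exact: Jmul.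
apply: nAx; apply: (@colon_val_ge0 x b b0) => n.
suff : inv_ideal infty I (x ^+ n) by apply.
elim: n => [|n IH]; first by rewrite expr0.
move=> y Iy; have -> : x ^+ n.+1 * y = x * (y * x ^+ n) by rewrite exprS; ring.
by apply: Jx; exact: Jmul.
Qed.

(** A common denominator reduces this to [ideal_inverse]. *)
Lemma fractional_inverse (a : F) (I : finType) (f : I -> F) :
  A a -> infty a < 0 -> (exists i, f i != 0) ->
  exists t : I -> F, (forall i j, A (t i * f j)) /\ \sum_i t i * f i = 1.
Proof.
move=> Aa a0 [i0 fi0]; have [c [Ac c0 cf]] := regular_common_denom f Aa a0.
pose J : set F := [set z | exists x : I -> F, (forall i, A (x i)) /\
   \sum_i x i * (c * f i) = z].
have Jf i : J (c * f i).
  exists (fun j => (j == i)%:R); split.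
    by move=> j; case: eqP => _; [exact: subring1|exact: (subring0 sA)].
  rewrite (bigD1 i)//= eqxx mul1r big1 ?addr0// => j /negPf ->.
  by rewrite mul0r.
have J_ideal : is_ideal infty J.
  split.
  - by move=> z [x [Ax <-]]; apply: (subring_sum sA) => i _; exact: (subringM sA).
  - exists (fun=> 0); split; first by move=> _; exact: (subring0 sA).
    by rewrite big1// => i _; rewrite mul0r.
  - move=> _ _ [x [Ax <-]] [y [Ay <-]]; exists (fun i => x i + y i); split.
      by move=> i; exact: (subringD sA).
    by rewrite -big_split; apply: eq_bigr => i _; rewrite mulrDl.
  move=> b _ Ab [x [Ax <-]]; exists (fun i => b * x i); split.
    by move=> i; exact: (subringM sA).
  by rewrite mulr_sumr; apply: eq_bigr => i _; rewrite [RHS]mulrA.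
have [|m [x [y [Jx Jy xy]]]] := ideal_inverse J_ideal.
  by exists (c * f i0) => //; rewrite mulf_neq0.
have [u uP] := choice Jx.
exists (fun i => \sum_l y l * u l i * c); split.
  move=> i j; rewrite mulr_suml; apply: (subring_sum sA) => l _.
  have -> : y l * u l i * c * f j = u l i * (y l * (c * f j)) by ring.
  by apply: (subringM sA); [case: (uP l)|exact: Jy].
rewrite -xy; under eq_bigr do rewrite mulr_suml.
rewrite exchange_big/=; apply: eq_bigr => l _.
case: (uP l) => _ <-; rewrite mulr_suml; apply: eq_bigr => i _; ring.
Qed.

(** As the products in [fractional_inverse] add up to 1, one of them is not in
    m. *)
Lemma primitive_multiple (a : F) (I : finType) (f : I -> F) (m : set F) :
  A a -> infty a < 0 -> (exists i, f i != 0) -> is_ideal infty m -> ~ m 1 ->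
  exists t : F, (forall i, A (t * f i)) /\ exists i, ~ m (t * f i).
Proof.
move=> Aa a0 f0 [_ m0 mD _] m1; have [t [At tf]] := fractional_inverse Aa a0 f0.
have [i mi] : exists i, ~ m (t i * f i).
  apply: contrapT => nm; apply: m1; rewrite -tf.
  elim/big_rec: _ => [//|i x _ mx]; apply: mD => //.
  by apply: contrapT => mi; apply: nm; exists i.
by exists (t i); split=> [j|]; [exact: At|exists i].
Qed.

Definition maximal_ideal (m : set F) := [/\ is_ideal infty m, ~ m 1 &
  forall x, A x -> ~ m x -> exists2 w, A w & m (1 - w * x)].

Lemma maximal_prime m x y : maximal_ideal m -> A x -> A y -> m (x * y) ->
  m x \/ m y.
Proof.
move=> [[mA m0 mD mZ] m1 mM] Ax Ay mxy.
have [mx|nx] := pselect (m x); [by left|right].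
have [w Aw mw] := mM _ Ax nx.
have -> : y = y * (1 - w * x) + w * (x * y) by ring.
by apply: mD; exact: mZ.
Qed.

(** Take x outside I such that (I : x) is as large as possible. It is prime, and
    therefore maximal, as A / I is finite. *)
Lemma exists_maximal_colon I b : is_ideal infty I -> I b -> b != 0 -> ~ I 1 ->
  exists2 x, A x & maximal_ideal [set y | A y /\ I (y * x)].
Proof.
move=> [IA I0 ID IZ] Ib b0 I1; have Ab := IA _ Ib.
have [s [As sP]] := finite_residues Ab b0.
pose cnt x := count (fun r => `[< I (r * x) >]) s.
have ex0 : exists n, `[< exists x, [/\ A x, ~ I x & cnt x = n] >].
  by exists (cnt 1); apply/asboolP; exists 1; split=> //; exact: subring1.
have ub n : `[< exists x, [/\ A x, ~ I x & cnt x = n] >] -> (n <= size s)%N.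
  by move=> /asboolP[x [_ _ <-]]; exact: count_size.
case: (ex_maxnP ex0 ub) => n /asboolP[x [Ax nx cx]] xmax.
exists x => //; set m := [set y | _].
have IB y z : I y -> I z -> I (y - z).
  move=> Iy Iz; apply: ID => //; rewrite -mulN1r; apply: IZ => //.
  by apply: (subringN sA); exact: subring1.
have Im y : I y -> m y by move=> Iy; split; [exact: IA|rewrite mulrC; exact: IZ].
have m_ideal : is_ideal infty m.
  split; first by move=> y [].
  - by apply: Im.
  - move=> y z [Ay Iy] [Az Iz]; split; first exact: (subringD sA).
    by rewrite mulrDl; exact: ID.
  - move=> c y Ac [Ay Iy]; split; first exact: (subringM sA).
    by rewrite -mulrA; exact: IZ.
have m1 : ~ m 1 by move=> []; rewrite mul1r.
have m_prime y z : A y -> A z -> ~ m y -> ~ m z -> ~ m (y * z).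
  move=> Ay Az ny nz [_ Iyz].
  have nyx : ~ I (y * x) by move=> Iyx; apply: ny.
  have : (cnt (y * x)%R <= cnt x)%N.
    by rewrite cx; apply: xmax; apply/asboolP; exists (y * x); split=> //; exact: (subringM sA).
  rewrite leqNgt => /negP; apply.
  have [r rs [w Aw zr]] := sP _ Az.
  have rE : r = z - b * w by rewrite -zr; ring.
  have Ibu u : A u -> I (b * u) by move=> Au; rewrite mulrC; exact: IZ.
  apply: (@count_lt _ r) => // [u /asboolP Iux||].
  - by apply/asboolP; rewrite mulrCA; exact: IZ.
  - apply/asboolP; rewrite rE mulrBl; apply: IB; first by rewrite mulrA [z * y]mulrC.
    by rewrite -mulrA; apply: Ibu; do 2![apply: (subringM sA) => //].
  apply/asboolPn => Irx; apply: nz; split=> //.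
  have -> : z * x = r * x + b * (w * x) by rewrite rE; ring.
  by apply: ID => //; apply: Ibu; exact: (subringM sA).
split=> // y Ay ny; have [i [j [ij [w Aw wE]]]] := power_congruent Ab b0 Ay.
have nyX l : ~ m (y ^+ l).
  elim: l => [|l IHl]; first by rewrite expr0.
  by rewrite exprS; apply: m_prime => //; exact: (subringX sA).
have Ay1 : A (1 - y ^+ (j - i)).
  by apply: (subringB sA); [exact: subring1|exact: (subringX sA)].
have : m (1 - y ^+ (j - i)).
  apply: contrapT => n1; apply: (m_prime (y ^+ i) (1 - y ^+ (j - i))) => //.
    exact: (subringX sA).
  have -> : y ^+ i * (1 - y ^+ (j - i)) = y ^+ i - y ^+ j.
    by rewrite mulrBr mulr1 -exprD subnKC// ltnW.
  by rewrite wE; apply: Im; rewrite mulrC; exact: IZ.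
have -> : (j - i = (j - i).-1.+1)%N by rewrite prednK// subn_gt0.
by rewrite exprSr; exists (y ^+ (j - i).-1) => //; exact: (subringX sA).
Qed.

(** An ideal that contains b is determined by the residues modulo b that it
    contains. *)
Lemma finitely_many_maximal b : A b -> b != 0 -> exists s : seq (set F),
  uniq s /\ forall m, m \in s <-> maximal_ideal m /\ m b.
Proof.
move=> Ab b0; have [s [As sP]] := finite_residues Ab b0.
pose idl (B : {ffun 'I_(size s) -> bool}) : set F :=
  [set x | A x /\ exists2 i, B i & exists2 w, A w & x - s`_i = b * w].
exists (undup [seq m <- [seq idl B | B <- enum {ffun 'I_(size s) -> bool}] |
   `[< maximal_ideal m /\ m b >]]); split; first exact: undup_uniq.
move=> m; rewrite mem_undup mem_filter; split; first by move=> /andP[/asboolP].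
move=> H; apply/andP; split; first exact/asboolP.
move: H => [[[mA m0 mD mZ] _ _] mb].
apply/mapP; exists [ffun i : 'I_(size s) => `[< m s`_i >]]; first by rewrite mem_enum.
apply/seteqP; split=> [x mx|x [Ax [i /[!ffunE]/asboolP mi [w Aw xw]]]]; last first.
  have -> : x = s`_i + w * b by rewrite [w * b]mulrC -xw; ring.
  by apply: mD => //; exact: mZ.
split; first exact: mA.
have [r rs [w Aw xw]] := sP _ (mA _ mx).
have ir : (index r s < size s)%N by rewrite index_mem.
exists (Ordinal ir); last by exists w => //=; rewrite nth_index.
rewrite ffunE; apply/asboolP; rewrite /= nth_index//.
have -> : r = x + (- w) * b by rewrite mulNr [w * b]mulrC -xw; ring.
by apply: mD => //; apply: mZ => //; exact: (subringN sA).
Qed.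

Lemma maximal_sub m m' : maximal_ideal m -> maximal_ideal m' -> m `<=` m' -> m = m'.
Proof.
move=> [_ _ mM] [[mA' _ mD' mZ'] m1' _] mm'.
apply/seteqP; split=> // x mx; apply: contrapT => nx.
have [w Aw mw] := mM _ (mA' _ mx) nx; apply: m1'.
rewrite -[1](subrK (w * x)); apply: mD'; first exact: mm'.
exact: mZ'.
Qed.

(** The product, over the other maximal ideals m', of elements of m' outside m.
    *)
Lemma maximal_separator b : A b -> b != 0 -> exists d : set F -> F,
  forall m, maximal_ideal m -> m b -> [/\ A (d m), ~ m (d m) &
    forall m', maximal_ideal m' -> m' b -> m' <> m -> m' (d m)].
Proof.
move=> Ab b0; have [s [us sP]] := finitely_many_maximal Ab b0.
suff H m : exists d, maximal_ideal m -> m b -> [/\ A d, ~ m d &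
    forall m', maximal_ideal m' -> m' b -> m' <> m -> m' d].
  by have [d dP] := choice H; exists d => m; exact: dP.
have [[mm mb]|nm] := pselect (maximal_ideal m /\ m b); last first.
  by exists 0 => mm mb; case: nm.
have H m' : exists x, m' \in s -> m' <> m -> m' x /\ ~ m x.
  have [[/sP[mm' _] ne]|ne] := pselect (m' \in s /\ m' <> m); last first.
    by exists 0 => m's ne'; case: ne.
  apply: contrapT => nx; case: ne.
  apply: maximal_sub => // x m'x; apply: contrapT => nmx; apply: nx.
  by exists x.
have [f fP] := choice H.
have fA m' : m' \in s -> m' <> m -> A (f m').
  move=> m's ne; have [mf _] := fP _ m's ne.
  by move: m's => /sP[[[mA _ _ _] _ _] _]; exact: mA.
exists (\prod_(m' <- s | `[< m' <> m >]) f m') => _ _.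
have [[mA m0 mD mZ] m1 _] := mm.
split.
- rewrite big_seq_cond; apply: (subring_prod sA) => m' /andP[m's /asboolP ne].
  exact: fA.
- suff [_] : A (\prod_(m' <- s | `[< m' <> m >]) f m') /\
    ~ m (\prod_(m' <- s | `[< m' <> m >]) f m') by [].
  rewrite big_seq_cond; elim/big_rec: _ => [|m' x /andP[m's /asboolP ne] [Ax nx]].
    by split=> //; exact: subring1.
  split; first by apply: (subringM sA) => //; exact: fA.
  move=> /(maximal_prime mm (fA _ m's ne) Ax)[|//].
  by case: (fP _ m's ne).
move=> m' mm' mb' ne; have m's : m' \in s by apply/sP.
rewrite (big_rem m')//= (asboolT ne) mulrC.
have [[mA' m0' mD' mZ'] _ _] := mm'; apply: mZ'; last by case: (fP _ m's ne).
rewrite big_seq_cond; apply: (subring_prod sA) => m'' /andP[/mem_rem m's' /asboolP ne'].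
exact: fA.
Qed.

(** Constants other than 0 are units of A. *)
Lemma exists_nonconstant N : is_ideal infty N -> (exists2 x, N x & x != 0) ->
  N <> A -> exists2 a, N a & infty a < 0.
Proof.
move=> [NA N0 ND NZ] [x Nx x0] neq; exists x => //.
rewrite ltNge; apply/negP => vx; apply: neq.
have [c xc] := regular_bounded_const (NA _ Nx) vx.
have c0 : c != 0 by apply: contraNneq x0 => c0; rewrite xc c0 rmorph0.
apply/seteqP; split=> // y Ay; have -> : y = y * const F c^-1 * x.
  by rewrite xc -mulrA -rmorphM mulVf// rmorph1 mulr1.
by apply: NZ => //; apply: (subringM sA) => //; exact: regular_const.
Qed.

Variable delta : nat.
Hypothesis Hdelta : has_degree infty delta.

Lemma degree_gt0 : (0 < delta)%N.
Proof.
case: Hdelta => b [_ H]; rewrite lt0n; apply/negP => /eqP d0.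
have [|c [cP _]] := H 1; first by rewrite place_val1.
move: cP; rewrite big1 ?subr0.
  by move=> [/eqP|]; [rewrite oner_eq0|rewrite place_val1].
by move=> i; have := ltn_ord i; rewrite [X in (_ < X)%N]d0.
Qed.

(** Functions with a pole of order at most n + 1 whose leading coefficients in
    the finite residue field agree differ by a function with a pole of order at
    most n. *)
Lemma finite_regular_val (n : nat) : finite_set [set x | A x /\ - n%:Z <= infty x].
Proof.
elim: n => [|n IH].
  apply: (@sub_finite_set _ _ (range (@const k F))); last exact: finite_image.
  move=> x [Ax]; rewrite oppr0 => /(regular_bounded_const Ax)[c ->].
  by exists c.
have [p p1] := place_val_unif infty; have p0 : p != 0.
  by apply: contra_eq_neq p1 => ->; rewrite place_val0.
case: Hdelta => b [b0 H].
pose S := [set x | A x /\ - n.+1%:Z <= infty x].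
have code x : S x -> exists c : {ffun 'I_delta -> k},
    in_max_ideal infty (x * p ^+ n.+1 - \sum_i const F (c i) * b i).
  move=> [Ax vx]; have [|c [cP _]] := H (x * p ^+ n.+1); last by exists c.
  have [->|x0] := eqVneq x 0; first by rewrite mul0r place_val0.
  by rewrite place_valM ?expf_neq0// place_valX p1 natz; lia.
have [r rP] : {r : {ffun 'I_delta -> k} -> F & forall c : {ffun 'I_delta -> k}, (exists2 x, S x &
    in_max_ideal infty (x * p ^+ n.+1 - \sum_i const F (c i) * b i)) ->
    S (r c) /\ in_max_ideal infty (r c * p ^+ n.+1 - \sum_i const F (c i) * b i)}.
  apply: (@choice _ _ (fun (c : {ffun 'I_delta -> k}) y => (exists2 x, S x &
    in_max_ideal infty (x * p ^+ n.+1 - \sum_i const F (c i) * b i)) ->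
    S y /\ in_max_ideal infty (y * p ^+ n.+1 - \sum_i const F (c i) * b i))) => c.
  have [[x Sx xc]|nx] := pselect (exists2 x, S x &
    in_max_ideal infty (x * p ^+ n.+1 - \sum_i const F (c i) * b i)).
    by exists x.
  by exists 0 => /nx.
apply: (@sub_finite_set _ _ ((fun z => r z.1 + z.2) @`
   ([set: {ffun 'I_delta -> k}] `*` [set x | A x /\ - n%:Z <= infty x]))); last first.
  by apply: finite_image; apply: finite_setX.
move=> x Sx; have [c xc] := code _ Sx.
have [|[Arc vrc] rc] := rP c; first by exists x.
exists (c, x - r c) => /=; last by rewrite addrC subrK.
split=> //; have [Ax vx] := Sx; split; first exact: (subringB sA).
have in_max z : in_max_ideal infty z <-> val_ge infty 1 z.
  by split=> [[->|zp]|[->|zp]]; [left|right; lia|left|right; lia].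
have := val_geB (iffLR (in_max _) xc) (iffLR (in_max _) rc).
rewrite opprB addrA subrK -mulrBl.
have [->|xr0] := eqVneq (x - r c) 0; first by rewrite place_val0; lia.
move=> [/eqP|]; first by rewrite mulf_eq0 (negPf xr0) expf_eq0 (negPf p0) andbF.
rewrite place_valM ?expf_neq0// place_valX p1 natz.
by move: (infty (x - r c)) => z; lia.
Qed.

End RegularRing.

(** * Exponential functions of discrete subgroups *)

Lemma exists_min (T : eqType) (R : realDomainType) (f : T -> R) (s : seq T) x0 :
  x0 \in s -> exists2 x, x \in s & forall y, y \in s -> f x <= f y.
Proof.
elim: s x0 => // a s IH x0 _; case: s IH => [_|b s /(_ b)[|x xs xmin]].
- by exists a; [rewrite inE|move=> y; rewrite inE => /eqP ->].
- by rewrite inE eqxx.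
have [le|lt] := leP (f a) (f x).
  exists a; first by rewrite inE eqxx.
  by move=> y; rewrite inE => /predU1P[->//|/xmin]; exact: le_trans.
exists x; first by rewrite inE xs orbT.
by move=> y; rewrite inE => /predU1P[->|/xmin//]; exact: ltW.
Qed.

Section FiniteSubgroup.
Variable C : fieldType.

(** The scalar multiple with derivative 1 at 0 of the monic polynomial with
    zeros s, if 0 occurs once in s. *)
Definition zpoly (s : seq C) (z : C) := z * \prod_(l <- s | l != 0) (1 - z / l).

Record finite_subgroup (V : seq C) : Prop := FiniteSubgroup {
  fsg_uniq : uniq V ;
  fsg0 : 0 \in V ;
  fsgB : forall x y, x \in V -> y \in V -> x - y \in V }.

Variable V : seq C.
Hypothesis HV : finite_subgroup V.

Lemma fsgD x y : x \in V -> y \in V -> x + y \in V.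
Proof.
move=> Vx Vy; rewrite -[y]opprK; apply: (fsgB HV) => //.
by rewrite -sub0r; apply: (fsgB HV) => //; exact: fsg0.
Qed.

Lemma fsg_translate x : x \in V -> perm_eq [seq x + w | w <- V] V.
Proof.
move=> Vx; have ux : uniq [seq x + w | w <- V].
  by rewrite map_inj_uniq; [exact: fsg_uniq|exact: addrI].
apply: uniq_perm => //; first exact: fsg_uniq.
have sub : {subset [seq x + w | w <- V] <= V}.
  by move=> _ /mapP[w Vw ->]; exact: fsgD.
have sz : (size V <= size [seq (x + w)%R | w <- V])%N by rewrite size_map.
by have [] := uniq_min_size ux sub sz.
Qed.

(** As polynomials in x both sides are monic of degree #|V|, and they agree at
    the #|V| points of V, where the factors on the left are permuted. *)
Lemma root_prod_additive x y :
  \prod_(w <- V) (x + y - w) = \prod_(w <- V) (x - w) + \prod_(w <- V) (y - w).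
Proof.
pose P := \prod_(w <- V) ('X - w%:P).
pose P' := \prod_(w <- V) ('X - (w - y)%:P).
have PE z : P.[z] = \prod_(w <- V) (z - w).
  by rewrite horner_prod; apply: eq_bigr => w _; rewrite hornerXsubC.
have PE' z : P'.[z] = \prod_(w <- V) (z + y - w).
  rewrite horner_prod; apply: eq_bigr => w _; rewrite hornerXsubC.
  by rewrite opprB addrA addrAC.
have szP : size P = (size V).+1 by rewrite size_prod_XsubC.
have szP' : size P' = (size V).+1 by rewrite size_prod_XsubC.
have mP : P \is monic by exact: monic_prod_XsubC.
have mP' : P' \is monic by exact: monic_prod_XsubC.
have V0 : (0 < size V)%N by move: (fsg0 HV); case: (V).
pose Q := P' - P - P.[y]%:P.
suff : Q = 0.
  move=> /(congr1 (fun q => q.[x])); rewrite !hornerE PE' !PE => /eqP.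
  by rewrite subr_eq0 subr_eq addrC => /eqP ->; rewrite addrC.
apply/eqP; apply: contraT => Q0.
have szQ : (size Q <= size V)%N.
  apply/leq_sizeP => j jV; rewrite !coefB coefC.
  have -> : (j == 0)%N = false by apply/eqP; lia.
  rewrite subr0; move: jV; rewrite leq_eqVlt => /predU1P[<-|ltj].
    have := monicP mP; have := monicP mP'; rewrite /lead_coef szP szP' /=.
    by move=> -> ->; rewrite subrr.
  by rewrite !nth_default ?subrr// ?szP ?szP'.
have : (size V < size Q)%N.
  apply: max_poly_roots => //; last exact: fsg_uniq.
  apply/allP => w Vw; rewrite /root !hornerE PE' !PE.
  have -> : \prod_(w' <- V) (w - w') = 0.
    by rewrite (big_rem w)//= subrr mul0r.
  rewrite subr0 subr_eq0; apply/eqP.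
  rewrite -(perm_big _ (fsg_translate Vw))/= big_map.
  by apply: eq_bigr => w' _; ring.
by rewrite ltnNge szQ.
Qed.

Definition zpoly_const := \prod_(l <- V | l != 0) (- l).

Lemma zpoly_const_neq0 : zpoly_const != 0.
Proof.
by rewrite prodf_seq_neq0; apply/allP => l _; apply/implyP; rewrite oppr_eq0.
Qed.

Lemma root_prodE z : \prod_(w <- V) (z - w) = zpoly_const * zpoly V z.
Proof.
rewrite /zpoly (bigID (fun w => w == 0))/=.
rewrite -big_filter.
have -> : [seq i <- V | i == 0] = [:: 0].
  by apply: (@filter_pred1_uniq _ V 0); [exact: fsg_uniq|exact: fsg0].
rewrite big_seq1 subr0 mulrCA -big_split/=; congr (_ * _).
by apply: eq_bigr => l l0; field.
Qed.

Lemma zpolyD x y : zpoly V (x + y) = zpoly V x + zpoly V y.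
Proof.
apply: (mulfI zpoly_const_neq0); rewrite mulrDr -!root_prodE.
exact: root_prod_additive.
Qed.

Lemma zpolyN x : zpoly V (- x) = - zpoly V x.
Proof.
apply/eqP; rewrite -addr_eq0 -zpolyD addNr.
by rewrite /zpoly mul0r.
Qed.

Lemma zpoly_eq0 z : (zpoly V z == 0) = (z \in V).
Proof.
rewrite -(mulrI_eq0 _ (mulfI zpoly_const_neq0)) -root_prodE prodf_seq_eq0.
apply/hasP/idP => [[w Vw]|Vz]; last by exists z => //=; rewrite subrr.
by rewrite /= subr_eq0 => /eqP ->.
Qed.

(** Here W is the disjoint union of V and of the cosets l + V. The factors of W
    that belong to one coset combine to a single factor in terms of the additive
    polynomial of V. *)
Lemma zpoly_cosets (W ls : seq C) z :
  (forall l, l \in ls -> l \notin V) ->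
  perm_eq W (V ++ [seq l + x | l <- ls, x <- V]) ->
  zpoly W z = zpoly V z * \prod_(l <- ls) (1 - zpoly V z / zpoly V l).
Proof.
move=> nV WE; rewrite /zpoly (perm_big _ WE)/= big_cat/= mulrA; congr (_ * _).
rewrite big_mkcond big_allpairs_dep/= big_seq [RHS]big_seq; apply: eq_bigr => l ls_l.
have lx x : x \in V -> l + x != 0.
  move=> Vx; apply: contraNneq (nV _ ls_l) => /eqP.
  rewrite addr_eq0 => /eqP ->; rewrite -sub0r.
  by apply: (fsgB HV) => //; exact: fsg0.
transitivity (\prod_(x <- V) ((z - l - x) / (- l - x))).
  rewrite big_seq [RHS]big_seq; apply: eq_bigr => x Vx; rewrite lx//.
  field; rewrite lx//= -oppr_eq0 opprB opprK addrC.
  by rewrite lx.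
rewrite prodf_div !root_prodE -/(zpoly V z) -/(zpoly V l) zpolyN -mulf_div.
rewrite divff ?zpoly_const_neq0// mul1r zpolyD zpolyN.
have : zpoly V l != 0 by rewrite zpoly_eq0 nV.
move: (zpoly V l) (zpoly V z) => p q p0.
by rewrite invrN mulrN -mulNr opprB mulrBl divff.
Qed.

End FiniteSubgroup.

Section Ultrametric.
Variables (R : realType) (C : fieldType) (v : absolute_value R C).

Lemma absv0 : v 0 = 0. Proof. by apply/eqP; rewrite absv_eq0. Qed.

Lemma absv_gt0 x : (0 < v x) = (x != 0).
Proof. by rewrite lt_neqAle absv_ge0 andbT eq_sym absv_eq0. Qed.

Lemma absv1 : v 1 = 1.
Proof.
have v10 : v 1 != 0 by rewrite absv_eq0 oner_eq0.
by apply: (mulfI v10); rewrite -absvM !mulr1.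
Qed.

Lemma absvV x : v x^-1 = (v x)^-1.
Proof.
have [->|x0] := eqVneq x 0; first by rewrite !invr0 absv0 invr0.
have vx0 : v x != 0 by rewrite absv_eq0.
by apply: (mulfI vx0); rewrite -absvM !divff// absv1.
Qed.

Lemma absvX x n : v (x ^+ n) = v x ^+ n.
Proof. by elim: n => [|n IH]; rewrite ?expr0 ?absv1// !exprS absvM IH. Qed.

Lemma absv_prod (I : Type) (r : seq I) (P : pred I) (f : I -> C) :
  v (\prod_(i <- r | P i) f i) = \prod_(i <- r | P i) v (f i).
Proof. by elim/big_ind2: _ => [|x1 x2 y1 y2|//]; [exact: absv1|rewrite absvM => -> ->]. Qed.

Lemma absvD_le x y e : v x <= e -> v y <= e -> v (x + y) <= e.
Proof. by move=> xe ye; rewrite (le_trans (absvD v x y))// ge_max xe. Qed.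

Lemma absvB_le x y e : v x <= e -> v y <= e -> v (x - y) <= e.
Proof. by move=> xe ye; apply: absvD_le => //; rewrite absvN. Qed.

Lemma absvD_lt x y e : v x < e -> v y < e -> v (x + y) < e.
Proof. by move=> xe ye; rewrite (le_lt_trans (absvD v x y))// gt_max xe. Qed.

Lemma absvB_lt x y e : v x < e -> v y < e -> v (x - y) < e.
Proof. by move=> xe ye; apply: absvD_lt => //; rewrite absvN. Qed.

Lemma absvB_trans y x z e : v (x - y) <= e -> v (y - z) <= e -> v (x - z) <= e.
Proof. by move=> xy yz; rewrite -(subrKA y); exact: absvD_le. Qed.

Lemma absvD_eqr x y : v x < v y -> v (x + y) = v y.
Proof.
move=> xy; apply/eqP; rewrite eq_le absvD_le ?(ltW xy)//=.
rewrite leNgt; apply/negP => lt.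
have := absvB_lt lt xy; rewrite addrAC subrr add0r ltxx//.
Qed.

Lemma absvB_eqr x y : v x < v y -> v (x - y) = v y.
Proof. by move=> xy; rewrite absvD_eqr absvN. Qed.

Lemma absvB_eql x y : v y < v x -> v (x - y) = v x.
Proof. by move=> xy; rewrite absv_distC absvB_eqr. Qed.

Lemma absv_eq_near x y : v (x - y) < v y -> v x = v y.
Proof. by move=> xy; rewrite -[x](subrK y) absvD_eqr. Qed.

Lemma absv_sum_le (I : Type) (r : seq I) (P : pred I) (f : I -> C) e : 0 <= e ->
  (forall i, P i -> v (f i) <= e) -> v (\sum_(i <- r | P i) f i) <= e.
Proof.
move=> e0 fe; elim/big_ind: _ => [|x y|//]; first by rewrite absv0.
exact: absvD_le.
Qed.

(** In a product of factors close to 1 the errors do not accumulate. *)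
Lemma absv_prod_near1 (I : eqType) (r : seq I) (P : pred I) (f : I -> C) e :
  0 <= e -> e <= 1 -> (forall i, i \in r -> P i -> v (f i - 1) <= e) ->
  v (\prod_(i <- r | P i) f i - 1) <= e.
Proof.
move=> e0 e1 fe; rewrite big_seq_cond.
elim/big_rec: _ => [|i x /andP[ir Pi] IH]; first by rewrite subrr absv0.
have -> : f i * x - 1 = (f i - 1) * x + (x - 1) by ring.
apply: absvD_le => //; rewrite absvM.
have x1 : v x <= 1.
  by rewrite -[x](subrK 1); apply: absvD_le; rewrite ?absv1// (le_trans IH).
by rewrite -[leRHS]mulr1 ler_pM ?absv_ge0// fe.
Qed.

Definition cvgv (u : nat -> C) (l : C) := forall e, 0 < e ->
  exists n0, forall n, (n0 <= n)%N -> v (u n - l) <= e.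

Definition cauchyv (u : nat -> C) := forall e, 0 < e ->
  exists n0, forall n m, (n0 <= n)%N -> (n0 <= m)%N -> v (u n - u m) <= e.

Lemma absv_small0 x : (forall e, 0 < e -> v x <= e) -> x = 0.
Proof.
move=> H; apply/eqP; apply: contraT => x0; have vx : 0 < v x by rewrite absv_gt0.
by have := H (v x / 2) (divr_gt0 vx (ltr0n _ 2)); lra.
Qed.

Lemma cvgv_unique u l l' : cvgv u l -> cvgv u l' -> l = l'.
Proof.
move=> ul ul'; apply/eqP; rewrite -subr_eq0; apply/eqP/absv_small0 => e e0.
have [n nP] := ul _ e0; have [n' nP'] := ul' _ e0.
apply: (@absvB_trans (u (maxn n n'))); last by apply: nP'; exact: leq_maxr.
by rewrite absv_distC; apply: nP; exact: leq_maxl.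
Qed.

Lemma cvgv_cst c : cvgv (fun=> c) c.
Proof. by move=> e e0; exists 0%N => n _; rewrite subrr absv0 ltW. Qed.

Lemma cvgv_eq n0 u u' l : (forall n, (n0 <= n)%N -> u n = u' n) -> cvgv u l -> cvgv u' l.
Proof.
move=> E ul e e0; have [n nP] := ul _ e0; exists (maxn n0 n) => m.
by rewrite geq_max => /andP[m0 mn]; rewrite -E//; exact: nP.
Qed.

Lemma cvgvD u u' l l' : cvgv u l -> cvgv u' l' -> cvgv (fun n => u n + u' n) (l + l').
Proof.
move=> ul ul' e e0; have [n nP] := ul _ e0; have [n' nP'] := ul' _ e0.
exists (maxn n n') => m; rewrite geq_max => /andP[nm nm'].
by rewrite opprD addrACA; apply: absvD_le; [exact: nP|exact: nP'].
Qed.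

Lemma cvgvMl c u l : cvgv u l -> cvgv (fun n => c * u n) (c * l).
Proof.
move=> ul e e0; have c0 : 0 < v c + 1 by rewrite ltr_wpDl ?absv_ge0.
have [n nP] := ul _ (divr_gt0 e0 c0); exists n => m /nP um.
rewrite -mulrBr absvM -(divfK (lt0r_neq0 c0) e) mulrC.
by rewrite ler_pM ?absv_ge0// lerDl.
Qed.

Lemma cvgvN u l : cvgv u l -> cvgv (fun n => - u n) (- l).
Proof.
move=> /(cvgvMl (-1)); rewrite mulN1r; apply: (@cvgv_eq 0%N) => n _.
by rewrite mulN1r.
Qed.

Lemma cvgvB u u' l l' : cvgv u l -> cvgv u' l' -> cvgv (fun n => u n - u' n) (l - l').
Proof. by move=> ul /cvgvN; exact: cvgvD. Qed.

Lemma cvgv_bounded u l : cvgv u l -> exists n0, forall n, (n0 <= n)%N -> v (u n) <= v l + 1.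
Proof.
move=> /(_ 1 ltr01)[n nP]; exists n => m /nP um.
rewrite -[u m](subrK l); apply: absvD_le; last by rewrite lerDl.
by rewrite (le_trans um)// lerDr absv_ge0.
Qed.

Lemma cvgvM u u' l l' : cvgv u l -> cvgv u' l' -> cvgv (fun n => u n * u' n) (l * l').
Proof.
move=> ul ul' e e0; have [n0 n0P] := cvgv_bounded ul.
have b0 : 0 < v l + 1 by rewrite ltr_wpDl ?absv_ge0.
have b0' : 0 < v l' + 1 by rewrite ltr_wpDl ?absv_ge0.
have [n nP] := ul _ (divr_gt0 e0 b0'); have [n' nP'] := ul' _ (divr_gt0 e0 b0).
exists (maxn n0 (maxn n n')) => m; rewrite !geq_max => /and3P[m0 m1 m2].
have -> : u m * u' m - l * l' = u m * (u' m - l') + (u m - l) * l' by ring.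
apply: absvD_le; rewrite absvM.
  rewrite -(divfK (lt0r_neq0 b0) e) mulrC; apply: ler_pM; rewrite ?absv_ge0//.
    exact: nP'.
  exact: n0P.
rewrite -(divfK (lt0r_neq0 b0') e); apply: ler_pM; rewrite ?absv_ge0//.
  exact: nP.
by rewrite lerDl.
Qed.

Lemma cvgv_prod (I : Type) (s : seq I) (P : pred I) (u : I -> nat -> C) (l : I -> C) :
  (forall i, P i -> cvgv (u i) (l i)) ->
  cvgv (fun n => \prod_(i <- s | P i) u i n) (\prod_(i <- s | P i) l i).
Proof.
move=> H; elim: s => [|i s IH].
  by rewrite big_nil; apply: (@cvgv_eq 0%N) (@cvgv_cst 1) => n _; rewrite big_nil.
rewrite big_cons; case: ifPn => Pi.
  by apply: (@cvgv_eq 0%N) (cvgvM (H _ Pi) IH) => n _; rewrite big_cons Pi.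
by apply: (@cvgv_eq 0%N) IH => n _; rewrite big_cons (negPf Pi).
Qed.

Lemma cvgv_sum (I : Type) (s : seq I) (P : pred I) (u : I -> nat -> C) (l : I -> C) :
  (forall i, P i -> cvgv (u i) (l i)) ->
  cvgv (fun n => \sum_(i <- s | P i) u i n) (\sum_(i <- s | P i) l i).
Proof.
move=> H; elim: s => [|i s IH].
  by rewrite big_nil; apply: (@cvgv_eq 0%N) (@cvgv_cst 0) => n _; rewrite big_nil.
rewrite big_cons; case: ifPn => Pi.
  by apply: (@cvgv_eq 0%N) (cvgvD (H _ Pi) IH) => n _; rewrite big_cons Pi.
by apply: (@cvgv_eq 0%N) IH => n _; rewrite big_cons (negPf Pi).
Qed.

Lemma cvgv_norm u l : cvgv u l -> l != 0 -> exists n0, forall n, (n0 <= n)%N -> v (u n) = v l.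
Proof.
move=> ul l0; have vl : 0 < v l by rewrite absv_gt0.
have [n nP] := ul _ (divr_gt0 vl (ltr0n R 2)); exists n => m /nP um.
by apply: absv_eq_near; lra.
Qed.

Lemma cvgvV u l : cvgv u l -> l != 0 -> cvgv (fun n => (u n)^-1) l^-1.
Proof.
move=> ul l0 e e0; have vl : 0 < v l by rewrite absv_gt0.
have [n0 n0P] := cvgv_norm ul l0.
have [n nP] := ul (e * (v l * v l)) (mulr_gt0 e0 (mulr_gt0 vl vl)).
exists (maxn n0 n) => m; rewrite geq_max => /andP[m0 mn].
have um0 : u m != 0 by rewrite -absv_gt0 n0P.
have -> : (u m)^-1 - l^-1 = (l - u m) / (u m * l) by field; rewrite um0 l0.
rewrite absvM absvV absvM n0P// absv_distC ler_pdivrMr ?mulr_gt0//.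
exact: nP.
Qed.

Lemma cvgv_le u l n0 M : cvgv u l -> (forall n, (n0 <= n)%N -> v (u n) <= M) -> v l <= M.
Proof.
move=> ul uM; have [->|l0] := eqVneq l 0.
  by rewrite absv0 (le_trans (absv_ge0 v (u n0)))// uM.
have [n nP] := cvgv_norm ul l0; rewrite -(nP (maxn n0 n)) ?leq_maxr//.
by apply: uM; exact: leq_maxl.
Qed.

Lemma cvgv_neq0_ge u l n0 M : cvgv u l -> l != 0 ->
  (forall n, (n0 <= n)%N -> u n != 0 -> M <= v (u n)) -> M <= v l.
Proof.
move=> ul l0 uM; have [n nP] := cvgv_norm ul l0.
rewrite -(nP (maxn n0 n)) ?leq_maxr//; apply: uM; first exact: leq_maxl.
by rewrite -absv_gt0 nP ?leq_maxr// absv_gt0.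
Qed.

Lemma ball_metrized (x y : metrized v) e : ball x e y = (v ((x : C) - y) < e) :> Prop.
Proof. by rewrite ballEmdist. Qed.

Lemma cvg_cvgv (u : nat -> C) (l : C) :
  ((u : nat -> metrized v) @ \oo --> (l : metrized v)) <-> cvgv u l.
Proof.
split=> [/cvg_ballP H e e0|H].
  have [n _ nP] := H _ e0; exists n => m nm; have := nP m nm.
  by rewrite /= ball_metrized absv_distC => /ltW.
apply/cvg_ballP => e e0; have [n nP] := H _ (divr_gt0 e0 (ltr0n R 2)).
exists n => // m nm /=; rewrite ball_metrized absv_distC.
by rewrite (le_lt_trans (nP _ nm))//; lra.
Qed.

Lemma limv_eq (u : nat -> C) (l : C) : cvgv u l ->
  (lim ((u : nat -> metrized v) @ \oo) : C) = l.
Proof. by move=> /cvg_cvgv/cvg_lim; apply; exact: metric_hausdorff. Qed.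

Hypothesis HC : complete_space (metrized v).

Lemma cauchyv_cvgv u : cauchyv u -> exists l, cvgv u l.
Proof.
move=> cu; pose G : set_system (metrized v) := (u : nat -> metrized v) @ \oo.
have PG : ProperFilter G by exact: fmap_proper_filter.
have [|l ul] := HC (G := G).
  apply: cauchy_exP => e e0; have [n nP] := cu _ (divr_gt0 e0 (ltr0n R 2)).
  exists (u n); exists n => // m nm /=; rewrite ball_metrized.
  by rewrite (le_lt_trans (nP _ _ (leqnn _) nm))//; lra.
by exists l; apply/cvg_cvgv.
Qed.

Record discrete_subgroup (L : set C) : Prop := DiscreteSubgroup {
  dsg0 : L 0 ;
  dsgB : forall x y, L x -> L y -> L (x - y) ;
  dsg_finite : forall M : R, finite_set [set x | L x /\ v x <= M] }.

(** For discrete L only: fset_set is empty on infinite sets. *)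
Definition pts (L : set C) (T : R) : seq C := fset_set [set x | L x /\ v x <= T].

Section Exponential.
Variable L : set C.
Hypothesis HL : discrete_subgroup L.

Lemma dsgN x : L x -> L (- x).
Proof. by move=> Lx; rewrite -sub0r; apply: (dsgB HL) => //; exact: dsg0. Qed.

Lemma dsgD x y : L x -> L y -> L (x + y).
Proof. by move=> Lx Ly; rewrite -[y]opprK; apply: (dsgB HL) => //; exact: dsgN. Qed.

Lemma mem_pts T x : (x \in pts L T) <-> L x /\ v x <= T.
Proof.
rewrite /pts in_fset_set; last exact: dsg_finite.
by split=> [/set_mem|/mem_set].
Qed.

Lemma pts_uniq T : uniq (pts L T). Proof. exact: fset_uniq. Qed.

Lemma pts_subgroup T : 0 <= T -> finite_subgroup (pts L T).
Proof.
move=> T0; split; first exact: pts_uniq.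
  by apply/mem_pts; split; [exact: dsg0|rewrite absv0].
move=> x y /mem_pts[Lx xT] /mem_pts[Ly yT]; apply/mem_pts; split.
  exact: (dsgB HL).
exact: absvB_le.
Qed.

Local Notation E T := (zpoly (pts L T)).

(** The factors 1 - z / l with |l| > T are within |z| / T of 1. *)
Lemma zpoly_pts_tail z T S : 0 < T -> v z <= T -> T <= S ->
  v (E S z - E T z) <= v (E T z) * (v z / T).
Proof.
move=> T0 zT TS; have -> : E S z = E T z * \prod_(l <- pts L S | (l != 0) && ~~ (v l <= T)) (1 - z / l).
  rewrite /zpoly (bigID (fun l => v l <= T)) /= mulrA; congr (_ * _ * _).
  rewrite -big_filter -[RHS]big_filter; apply: perm_big; apply: uniq_perm.
  - by apply: filter_uniq; exact: pts_uniq.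
  - by apply: filter_uniq; exact: pts_uniq.
  move=> x; rewrite !mem_filter; apply/andP/andP => [[/andP[-> xT] /mem_pts[Lx _]]|[-> /mem_pts[Lx xT]]].
    by split=> //; apply/mem_pts.
  by split; [rewrite xT|apply/mem_pts; split=> //; exact: le_trans TS].
rewrite -[X in _ - X]mulr1 -mulrBr absvM ler_wpM2l ?absv_ge0//.
apply: absv_prod_near1.
- by rewrite divr_ge0 ?absv_ge0// ltW.
- by rewrite ler_pdivrMr// mul1r.
move=> l _ /andP[l0]; rewrite -ltNge => Tl.
rewrite addrAC subrr add0r absvN absvM absvV.
by rewrite ler_wpM2l ?absv_ge0// lef_pV2 ?posrE ?absv_gt0// ltW.
Qed.

Lemma zpoly_pts_norm z T S : v z < T -> T <= S -> v (E S z) = v (E T z).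
Proof.
move=> zT TS; have T0 : 0 < T by exact: le_lt_trans (absv_ge0 v z) zT.
have [E0|E0] := eqVneq (E T z) 0.
  have := zpoly_pts_tail T0 (ltW zT) TS.
  by rewrite E0 absv0 mul0r subr0 => H; apply/eqP; rewrite eq_le H absv_ge0.
apply: absv_eq_near; apply: (le_lt_trans (zpoly_pts_tail T0 (ltW zT) TS)).
by rewrite -[ltRHS]mulr1 ltr_pM2l ?absv_gt0// ltr_pdivrMr// mul1r.
Qed.

Lemma zpoly_pts_cauchy z : cauchyv (fun n => E n%:R z).
Proof.
move=> e e0; pose T0 := v z + 1; pose K := v (E T0 z) * v z.
have K0 : 0 <= K by rewrite mulr_ge0 ?absv_ge0.
pose n0 := (Num.truncn (T0 + K / e)).+1.
have Tn : T0 + K / e < n0%:R.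
  by rewrite /n0 truncnS_gt.
have Ke : 0 <= K / e by rewrite divr_ge0// ltW.
have T0p : 0 < T0 by rewrite ltr_wpDl ?absv_ge0.
have key m : (n0 <= m)%N -> v (E m%:R z - E n0%:R z) <= e.
  move=> nm; apply: (le_trans (zpoly_pts_tail _ _ _)).
  - by lra.
  - by apply: ltW; apply: (@lt_trans _ _ T0); [rewrite ltrDl|lra].
  - by rewrite ler_nat.
  rewrite (@zpoly_pts_norm z T0)//; [|by rewrite ltrDl|by lra].
  rewrite mulrA ler_pdivrMr; last by lra.
  by rewrite -/K -ler_pdivrMl// mulrC; lra.
exists n0 => n m nn nm; apply: (@absvB_trans (E n0%:R z)); first exact: key.
by rewrite absv_distC; exact: key.
Qed.

(** In the definition of exp_lattice the factor z is outside the limit. It is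
    divided out of the limit of the polynomials if z is not 0. *)
Lemma exp_lattice_cvg z : cvgv (fun n => E n%:R z) (exp_lattice v L z).
Proof.
have [l lP] := cauchyv_cvgv (@zpoly_pts_cauchy 1).
pose P z n := \prod_(l <- pts L n%:R | l != 0) (1 - z / l).
suff [q qP] : exists q, cvgv (P z) q.
  suff -> : exp_lattice v L z = z * q by exact: cvgvMl.
  rewrite /exp_lattice; congr (_ * _); apply: limv_eq.
  apply: (@cvgv_eq 0%N) qP => n _; apply/esym.
  transitivity (\prod_(l <- fset_set [set l | [/\ L l, l != 0 & v l <= n%:R]]) (1 - z / l)).
    apply: (@fsbig_finite C 1 *%R C).
    by apply: (sub_finite_set _ (dsg_finite HL n%:R)) => x [].
  rewrite /P -[RHS]big_filter.
  apply: perm_big; apply: uniq_perm; first exact: fset_uniq.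
    by apply: filter_uniq; exact: pts_uniq.
  have fin : finite_set [set l | [/\ L l, l != 0 & v l <= n%:R]].
    by apply: (sub_finite_set _ (dsg_finite HL n%:R)) => x [].
  move=> x; rewrite mem_filter in_fset_set//.
  apply/idP/andP => [/set_mem[Lx x0 xn]|[x0 /mem_pts[Lx xn]]].
    by split=> //; apply/mem_pts.
  by apply/mem_set; split.
have [->|z0] := eqVneq z 0.
  exists 1; apply: (@cvgv_eq 0%N (fun=> 1)) (@cvgv_cst 1) => n _.
  by rewrite /P big1// => x _; rewrite mul0r subr0.
have [e eP] := cauchyv_cvgv (@zpoly_pts_cauchy z).
exists (z^-1 * e); apply: (@cvgv_eq 0%N (fun n => z^-1 * E n%:R z)); last exact: cvgvMl.
by move=> n _; rewrite /zpoly mulKf.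
Qed.

Local Notation e := (exp_lattice v L).

(** The factors 1 - z / l with |l| > |z| have norm 1. *)
Lemma exp_lattice_norm z T : v z < T -> v (e z) = v (E T z).
Proof.
move=> zT; have ec := exp_lattice_cvg z.
have nT m : (Num.truncn T < m)%N -> T <= m%:R.
  by move=> Tm; apply: ltW; rewrite (lt_le_trans (truncnS_gt _))// ler_nat.
have Em m : (Num.truncn T < m)%N -> v (E m%:R z) = v (E T z).
  by move=> /nT; exact: zpoly_pts_norm.
have [e0|e0] := eqVneq (e z) 0.
  rewrite e0 absv0; apply/eqP; rewrite eq_sym absv_eq0; apply/eqP.
  apply: (@absv_small0) => d d0; have [n nP] := ec _ d0.
  rewrite -(Em (maxn n (Num.truncn T).+1)) ?leq_maxr//.
  by have := nP _ (leq_maxl n (Num.truncn T).+1); rewrite e0 subr0.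
have [n nP] := cvgv_norm ec e0.
by rewrite -(Em (maxn n (Num.truncn T).+1)) ?leq_maxr// nP// leq_maxl.
Qed.

Lemma exp_lattice_tail z T : v z < T -> v (e z - E T z) <= v (e z) * (v z / T).
Proof.
move=> zT; have T0 : 0 < T by exact: le_lt_trans (absv_ge0 v z) zT.
apply: (@cvgv_le (fun n => E n%:R z - E T z) _ (Num.truncn T).+1).
  by apply: cvgvB; [exact: exp_lattice_cvg|exact: cvgv_cst].
move=> n Tn; rewrite (exp_lattice_norm zT); apply: zpoly_pts_tail => //.
  exact: ltW.
by apply: ltW; rewrite (lt_le_trans (truncnS_gt _))// ler_nat.
Qed.

(** Radii c * n are needed to compare L with a multiple of L. *)
Lemma exp_lattice_cvgT z c : 0 < c -> cvgv (fun n => E (c * n%:R) z) (e z).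
Proof.
move=> c0 d d0; pose K := v (e z) * v z.
have K0 : 0 <= K by rewrite mulr_ge0 ?absv_ge0.
exists (Num.truncn ((v z + 1 + K / d) / c)).+1 => n nn.
have Kd : 0 <= K / d by rewrite divr_ge0// ltW.
have : (v z + 1 + K / d) / c < n%:R.
  by rewrite (lt_le_trans (truncnS_gt _))// ler_nat.
rewrite ltr_pdivrMr// mulrC => H.
have vz := absv_ge0 v z.
rewrite absv_distC (le_trans (exp_lattice_tail _))//; first by lra.
rewrite mulrA ler_pdivrMr; last by lra.
by rewrite -/K -ler_pdivrMl// mulrC; lra.
Qed.

(** The exponential function is a limit of additive polynomials. *)
Lemma exp_latticeD x y : e (x + y) = e x + e y.
Proof.
apply: (cvgv_unique (exp_lattice_cvg (x + y))).
apply: (@cvgv_eq 0%N (fun n => E n%:R x + E n%:R y)).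
  by move=> n _; rewrite zpolyD//; apply: pts_subgroup.
by apply: cvgvD; exact: exp_lattice_cvg.
Qed.

Lemma exp_lattice0 : e 0 = 0.
Proof. by apply: (addrI (e 0)); rewrite -exp_latticeD !addr0. Qed.

Lemma exp_latticeN x : e (- x) = - e x.
Proof. by apply/eqP; rewrite -addr_eq0 -exp_latticeD addNr exp_lattice0. Qed.

Lemma exp_latticeB x y : e (x - y) = e x - e y.
Proof. by rewrite exp_latticeD exp_latticeN. Qed.

Lemma exp_lattice_eq0 z : e z = 0 <-> L z.
Proof.
have zT : v z < v z + 1 by rewrite ltrDl.
have T0 : 0 <= v z + 1 by rewrite addr_ge0 ?absv_ge0.
split=> [ez|Lz].
  have : v (E (v z + 1) z) = 0 by rewrite -(exp_lattice_norm zT) ez absv0.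
  move/eqP; rewrite absv_eq0 zpoly_eq0; last exact: pts_subgroup.
  by move=> /mem_pts[].
apply/eqP; rewrite -(absv_eq0 v) (exp_lattice_norm zT) absv_eq0.
rewrite zpoly_eq0; last exact: pts_subgroup.
by apply/mem_pts; split=> //; exact: ltW.
Qed.

Lemma exp_lattice_coset x y : L (x - y) -> e x = e y.
Proof. by move/exp_lattice_eq0; rewrite exp_latticeB => /subr0_eq. Qed.

(** If 0 is a point of L nearest to z then |1 - z / l| >= 1 for all l. *)
Lemma exp_lattice_ge z : (forall l, L l -> v z <= v (z - l)) -> v z <= v (e z).
Proof.
move=> zmin; rewrite (@exp_lattice_norm z (v z + 1)) ?ltrDl// /zpoly absvM.
rewrite -[leLHS]mulr1 ler_wpM2l ?absv_ge0// absv_prod big_seq_cond.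
elim/big_rec: _ => // l x /andP[/mem_pts[Ll _] l0] x1.
suff l1 : 1 <= v (1 - z / l) by rewrite -[leLHS]mulr1 ler_pM.
have -> : 1 - z / l = (l - z) / l by field.
rewrite absvM absvV ler_pdivlMr ?absv_gt0// mul1r absv_distC.
have := zmin _ Ll => zl; have : v (z - (z - l)) <= v (z - l) by exact: absvB_le.
by rewrite opprB addrC subrK.
Qed.

Lemma exists_nearest z : exists2 l, L l & forall l', L l' -> v (z - l) <= v (z - l').
Proof.
have z0 : 0 \in pts L (v z) by apply/mem_pts; split; [exact: dsg0|rewrite absv0 absv_ge0].
have [l /mem_pts[Ll lz] lmin] := exists_min (fun l => v (z - l)) z0.
exists l => // l' Ll'; have [l'z|zl'] := leP (v l') (v z).
  by apply: lmin; apply/mem_pts.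
rewrite (absvB_eqr zl'); have := lmin _ z0; rewrite subr0 => /le_trans; apply.
exact: ltW.
Qed.

(** By periodicity z may be assumed to be as close to 0 as to any point of L.
    This is how the metric controls the position of lattice points. *)
Lemma exp_lattice_near z : exists2 l, L l & v (z - l) <= v (e z).
Proof.
have [l Ll lmin] := exists_nearest z; exists l => //.
rewrite -(exp_lattice_coset (x := z - l)); last first.
  by rewrite addrAC subrr add0r; exact: dsgN.
apply: exp_lattice_ge => l' Ll'; rewrite -addrA -opprD; apply: lmin.
exact: dsgD.
Qed.

Lemma exp_lattice_iso z : (forall l, L l -> l != 0 -> v z < v l) -> v (e z) = v z.
Proof.
move=> zl; rewrite (@exp_lattice_norm z (v z + 1)) ?ltrDl// /zpoly absvM.
rewrite -[RHS]mulr1 absv_prod big_seq_cond; congr (_ * _).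
apply: big1 => l /andP[/mem_pts[Ll _] l0].
have -> : 1 - z / l = (l - z) / l by field.
rewrite absvM absvV absvB_eql ?zl// divff// absv_eq0//.
Qed.

Lemma exp_lattice_bounded T : exists K, forall z, v z <= T -> v (e z) <= K.
Proof.
have [T0|T0] := leP 0 T; last first.
  by exists 0 => z zT; have := absv_ge0 v z; lra.
exists (T * \prod_(l <- pts L (T + 1) | l != 0) Num.max 1 (T / v l)) => z zT.
rewrite (@exp_lattice_norm z (T + 1)); last by lra.
rewrite /zpoly absvM absv_prod ler_pM ?absv_ge0//.
  by apply: prodr_ge0 => l _; exact: absv_ge0.
apply: ler_prod => l l0; rewrite absv_ge0/=.
apply: absvB_le; first by rewrite absv1 le_max lexx.
rewrite absvM absvV le_max; apply/orP; right.
by rewrite ler_wpM2r// invr_ge0 absv_ge0.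
Qed.

End Exponential.

(** The limit of [zpoly_cosets]: L' is the union of L and of the cosets l + L.
    *)
Lemma exp_isogeny (L L' : set C) (ls : seq C) z :
  discrete_subgroup L -> discrete_subgroup L' -> L `<=` L' -> uniq ls ->
  (forall l, l \in ls -> L' l /\ ~ L l) ->
  {in ls &, forall x y, x != y -> ~ L (x - y)} ->
  (forall x, L' x -> L x \/ exists2 l, l \in ls & L (x - l)) ->
  exp_lattice v L' z =
  exp_lattice v L z * \prod_(l <- ls) (1 - exp_lattice v L z / exp_lattice v L l).
Proof.
move=> HL HL' LL' uls lsP lsL cov.
pose n0 := Num.truncn (\sum_(l <- ls) v l).
have lsn n l : (n0 < n)%N -> l \in ls -> v l <= n%:R.
  move=> nn ll; apply: ltW; rewrite (le_lt_trans (y := \sum_(l <- ls) v l))//.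
    by rewrite (big_rem l)//= lerDl sumr_ge0// => i _; exact: absv_ge0.
  by rewrite (lt_le_trans (truncnS_gt _))// ler_nat.
apply: (cvgv_unique (exp_lattice_cvg HL' z)).
apply: (@cvgv_eq n0.+1 (fun n => zpoly (pts L n%:R) z *
    \prod_(l <- ls) (1 - zpoly (pts L n%:R) z / zpoly (pts L n%:R) l))).
  move=> n nn; have HV : finite_subgroup (pts L n%:R) by exact: pts_subgroup.
  rewrite -(@zpoly_cosets _ _ HV (pts L' n%:R))//.
    by move=> l /lsP[_ nLl]; apply/negP => /(mem_pts HL)[].
  have nL l x : l \in ls -> L x -> ~ L (l + x).
    move=> /lsP[_ nl] Lx Llx; apply: nl; rewrite -[l](addrK x).
    exact: (dsgB HL).
  apply: uniq_perm; first exact: pts_uniq.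
    rewrite cat_uniq pts_uniq/=; apply/andP; split.
      apply/hasPn => _ /allpairsP[[l x] [/= ll /(mem_pts HL)[Lx _] ->]].
      by apply/negP => /(mem_pts HL)[+ _]; exact: nL.
    apply: allpairs_uniq => //; first exact: pts_uniq.
    move=> [l x] [l' x'] /allpairsP[[a b] [/= al /(mem_pts HL)[Lb _] [-> ->]]].
    move=> /allpairsP[[a' b'] [/= al' /(mem_pts HL)[Lb' _] [-> ->]]] /= E.
    have [aa'|aa'] := eqVneq a a'.
      by move: E; rewrite aa' => /addrI ->.
    case: (lsL _ _ al al' aa'); have -> : a - a' = b' - b.
      by have -> : a = a' + b' - b by [rewrite -E addrK]; ring.
    exact: (dsgB HL).
  move=> x; rewrite mem_cat; apply/idP/orP.
    move=> /(mem_pts HL')[L'x xn]; have [Lx|[l ll Lxl]] := cov _ L'x.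
      by left; apply/(mem_pts HL).
    right; apply/allpairsP; exists (l, x - l); split => //=; last by ring.
    apply/(mem_pts HL); split => //; apply: absvB_le => //; exact: lsn.
  move=> [/(mem_pts HL)[Lx xn]|]; first by apply/(mem_pts HL'); split => //; exact: LL'.
  move=> /allpairsP[[l y] [/= ll /(mem_pts HL)[Ly yn] ->]].
  apply/(mem_pts HL'); split.
    by apply: (dsgD HL'); [case: (lsP _ ll)|exact: LL'].
  by apply: absvD_le => //; exact: lsn.
apply: cvgvM; first exact: exp_lattice_cvg.
rewrite big_seq; apply: (@cvgv_eq 0%N (fun n => \prod_(l <- ls | l \in ls)
    (1 - zpoly (pts L n%:R) z / zpoly (pts L n%:R) l))).
  by move=> n _; rewrite [RHS]big_seq.
apply: cvgv_prod => l ll; apply: cvgvB; first exact: cvgv_cst.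
apply: cvgvM; first exact: exp_lattice_cvg.
apply: cvgvV; first exact: exp_lattice_cvg.
by apply/eqP => /(exp_lattice_eq0 HL); case: (lsP _ ll).
Qed.

Lemma discrete_scale (L : set C) (a : C) : discrete_subgroup L -> a != 0 ->
  discrete_subgroup [set x | L (a * x)].
Proof.
move=> HL a0; have va : 0 < v a by rewrite absv_gt0.
split=> /=; first by rewrite mulr0; exact: dsg0.
  by move=> x y Lx Ly; rewrite mulrBr; exact: (dsgB HL).
move=> M; apply: (@sub_finite_set _ _ ((fun x => a^-1 * x) @` [set x | L x /\ v x <= v a * M])).
  move=> x [Lx xM]; exists (a * x); last by rewrite mulKf.
  by split=> //; rewrite absvM ler_pM2l.
by apply: finite_image; exact: dsg_finite.
Qed.

Lemma exp_scale (L : set C) (a z : C) : discrete_subgroup L -> a != 0 ->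
  exp_lattice v [set x | L (a * x)] z = a^-1 * exp_lattice v L (a * z).
Proof.
move=> HL a0; have va : 0 < v a by rewrite absv_gt0.
have HL' := discrete_scale HL a0.
apply: (cvgv_unique (exp_lattice_cvg HL' z)).
apply: (@cvgv_eq 0%N (fun n => a^-1 * zpoly (pts L (v a * n%:R)) (a * z))); last first.
  by apply: cvgvMl; exact: exp_lattice_cvgT.
move=> n _; rewrite /zpoly mulrA mulKf//; congr (_ * _).
have E : perm_eq (pts L (v a * n%:R)) [seq a * x | x <- pts [set x | L (a * x)] n%:R].
  apply: uniq_perm; first exact: pts_uniq.
    by rewrite map_inj_uniq; [exact: pts_uniq|exact: mulfI].
  move=> x; apply/idP/mapP => [/(mem_pts HL)[Lx xn]|[y /(mem_pts HL')[Ly yn] ->]].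
    exists (a^-1 * x); last by rewrite mulVKf.
    apply/(mem_pts HL'); split => /=; first by rewrite mulVKf.
    by rewrite absvM absvV ler_pdivrMl.
  by apply/(mem_pts HL); split => //; rewrite absvM ler_pM2l.
rewrite (perm_big _ E)/= big_map; apply: eq_big => [x|x].
  by rewrite mulf_eq0 (negPf a0).
by move=> _; rewrite -mulf_div divff// mul1r.
Qed.

End Ultrametric.

(** * Limits of discrete modules *)

Section Interpolation.
Variables (K : fieldType) (m : nat).

(** Lagrange's interpolation formula. *)
Definition lagrange_eval (w y : 'I_m -> K) (x : K) :=
  \sum_i y i * \prod_(j | j != i) ((x - w j) * (w i - w j)^-1).

Lemma lagrange_evalE (Q : {poly K}) (w : 'I_m -> K) x : injective w ->
  (size Q <= m)%N -> Q.[x] = lagrange_eval w (fun i => Q.[w i]) x.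
Proof.
move=> winj szQ.
pose T := \sum_i Q.[w i] *: \prod_(j | j != i) ((w i - w j)^-1 *: ('X - (w j)%:P)).
have TE z : T.[z] = lagrange_eval w (fun i => Q.[w i]) z.
  rewrite horner_sum; apply: eq_bigr => i _; rewrite hornerZ horner_prod.
  by congr (_ * _); apply: eq_bigr => j _; rewrite hornerZ hornerXsubC mulrC.
rewrite -TE; congr (_.[_]); apply/eqP; rewrite -subr_eq0; apply: contraT => QT0.
have szT : (size T <= m)%N.
  apply: (leq_trans (size_sum _ _ _)); apply/bigmax_leqP => i _.
  apply: (leq_trans (size_scale_leq _ _)).
  rewrite scaler_prod; apply: (leq_trans (size_scale_leq _ _)).
  rewrite -big_filter size_prod_XsubC size_filter -sum1_count sum1_card.
  rewrite (eq_card (B := predC1 i))// cardC1 card_ord.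
  by have := ltn_ord i; lia.
have szQT : (size (Q - T)%R <= m)%N.
  by rewrite (leq_trans (size_polyD _ _))// geq_max szQ size_polyN.
suff : (m < size (Q - T)%R)%N by rewrite ltnNge szQT.
rewrite -[ltnLHS](size_enum_ord m) -(size_map w).
apply: max_poly_roots => //; last by rewrite map_inj_uniq// enum_uniq.
apply/allP => _ /mapP[i _ ->]; rewrite /root hornerD hornerN TE /lagrange_eval.
rewrite (bigD1 i)//= [\prod_(_ | _) _]big1 ?mulr1; last first.
  by move=> j ji; rewrite divff// subr_eq0 (inj_eq winj) eq_sym.
rewrite big1 ?addr0 ?subrr// => j ji.
by rewrite (bigD1 i) 1?eq_sym//= subrr mul0r mul0r mulr0.
Qed.

End Interpolation.

Section Close.
Variables (R : realType) (C : fieldType) (v : absolute_value R C).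

(** Bounded by K and d-close: a relation compatible with sums and products. *)
Definition close (K d : R) (f g : C) := [/\ v f <= K, v g <= K & v (f - g) <= d].

Lemma closeM K d f g f' g' : 0 <= K -> close K d f g -> close K d f' g' ->
  close (K * K) (K * d) (f * f') (g * g').
Proof.
move=> K0 [fK gK fg] [fK' gK' fg']; split; rewrite ?absvM ?ler_pM ?absv_ge0//.
have -> : f * f' - g * g' = f * (f' - g') + (f - g) * g' by ring.
by apply: absvD_le; rewrite absvM; [|rewrite mulrC]; apply: ler_pM; rewrite ?absv_ge0.
Qed.

Lemma close_le K K' d d' f g : K <= K' -> d <= d' -> close K d f g -> close K' d' f g.
Proof. by move=> KK dd [fK gK fg]; split; [exact: le_trans KK|exact: le_trans KK|exact: le_trans dd]. Qed.

Lemma closeD K d f g f' g' : close K d f g -> close K d f' g' ->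
  close K d (f + f') (g + g').
Proof.
move=> [fK gK fg] [fK' gK' fg']; split; try exact: absvD_le.
by rewrite opprD addrACA; exact: absvD_le.
Qed.

Lemma closeN K d f g : close K d f g -> close K d (- f) (- g).
Proof. by move=> [fK gK fg]; split; rewrite ?absvN// -opprD absvN. Qed.

Lemma close_prod (I : Type) (s : seq I) (P : pred I) (f g : I -> C) K d :
  1 <= K -> 0 <= d -> (forall i, P i -> close K d (f i) (g i)) ->
  close (K ^+ size s) (K ^+ size s * d) (\prod_(i <- s | P i) f i)
    (\prod_(i <- s | P i) g i).
Proof.
move=> K1 d0 fg; have K0 : 0 <= K by lra.
elim: s => [|i s IH].
  by rewrite !big_nil expr0 mul1r; split; rewrite ?absv1// subrr absv0.
have Ks : 1 <= K ^+ size s by rewrite exprn_ege1.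
rewrite !big_cons/= exprS; case: ifPn => Pi; last first.
  have Kss : K ^+ size s <= K * K ^+ size s by rewrite ler_peMl//; lra.
  by apply: close_le IH => //; rewrite ler_wpM2r.
have [fK gK fgd] := fg _ Pi; have [pK qK pq] := IH.
split; rewrite ?absvM ?ler_pM ?absv_ge0//.
set p := \prod_(_ <- _ | _) f _ in pK pq *; set q := \prod_(_ <- _ | _) g _ in qK pq *.
have -> : f i * p - g i * q = f i * (p - q) + (f i - g i) * q by ring.
apply: absvD_le; rewrite absvM.
  by rewrite -mulrA; apply: ler_pM; rewrite ?absv_ge0.
rewrite mulrC; apply: ler_pM; rewrite ?absv_ge0//.
by rewrite (le_trans qK)// ler_peMl//; lra.
Qed.

Lemma closeV K d f g : 0 <= d -> f != 0 -> g != 0 -> v f^-1 <= K -> v g^-1 <= K ->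
  v (f - g) <= d -> close K (K * K * d) f^-1 g^-1.
Proof.
move=> d0 f0 g0 fK gK fg; split => //.
have -> : f^-1 - g^-1 = (g - f) * (f^-1 * g^-1) by field; rewrite f0 g0.
rewrite !absvM mulrC absv_distC; apply: ler_pM; rewrite ?mulr_ge0 ?absv_ge0//.
by apply: ler_pM; rewrite ?absv_ge0.
Qed.

Lemma close_sum (I : Type) (s : seq I) (P : pred I) (f g : I -> C) K d :
  0 <= K -> 0 <= d -> (forall i, P i -> close K d (f i) (g i)) ->
  close K d (\sum_(i <- s | P i) f i) (\sum_(i <- s | P i) g i).
Proof.
move=> K0 d0 fg; elim/big_ind2: _ => [||//]; last by move=> *; exact: closeD.
by split; rewrite ?subrr absv0.
Qed.

(** Interpolation depends continuously on the nodes, the values and the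
    argument, uniformly as long as the nodes stay separated. *)
Lemma lagrange_close m K : 1 <= K -> exists2 K', 0 < K' &
  forall d (w y w' y' : 'I_m -> C) x x', 0 <= d ->
  (forall i, close K d (w i) (w' i)) -> (forall i, close K d (y i) (y' i)) ->
  close K d x x' ->
  (forall i j, i != j -> [/\ w i != w j, w' i != w' j, v (w i - w j)^-1 <= K &
     v (w' i - w' j)^-1 <= K]) ->
  v (lagrange_eval w y x - lagrange_eval w' y' x') <= K' * d.
Proof.
move=> K1; have K0 : 0 <= K by lra.
have K0' : 0 < K by lra.
pose s := index_enum 'I_m; pose K2 := (K * K) ^+ size s.
have KK : 1 <= K * K by rewrite -[1]mulr1 ler_pM.
have K21 : 1 <= K2 by rewrite exprn_ege1.
pose K3 := K * K2; have K31 : 1 <= K3 by rewrite -[1]mulr1 ler_pM//; lra.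
pose K4 := K2 * (K * (K * K)).
exists (K3 * (K + K4)).
  have : 0 < K4 by rewrite !mulr_gt0// (lt_le_trans _ K21).
  by move=> K40; rewrite mulr_gt0 ?addr_gt0//; lra.
move=> d w y w' y' x x' d0 ww yy xx wij.
suff : close (K3 * K3) (K3 * ((K + K4) * d)) (lagrange_eval w y x) (lagrange_eval w' y' x').
  by case=> _ _; rewrite mulrA.
have K40 : 0 <= K4 by rewrite !mulr_ge0//; lra.
apply: close_sum; [by rewrite mulr_ge0; lra|by rewrite !mulr_ge0 ?addr_ge0//; lra|].
move=> i _; apply: closeM; first by lra.
  apply: close_le (yy i); first by rewrite /K3 ler_peMr.
  by rewrite ler_peMl//; move: K40 K1; lra.
apply: (@close_le K2 _ (K2 * (K * (K * K * d)))).
- by rewrite /K3 ler_peMl//; lra.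
- rewrite !mulrA -/K4 mulrDl [X in _ <= _ + X](_ : _ = K4 * d)//.
  have -> : K2 * K * K * K * d = K4 * d by rewrite /K4 !mulrA.
  by rewrite lerDr mulr_ge0.
apply: close_prod => //; first by rewrite !mulr_ge0.
move=> j; rewrite eq_sym => ji; have [wij0 wij0' wK wK'] := wij _ _ ji.
have dKd : d <= K * K * d by rewrite ler_peMl.
apply: closeM => //.
  apply: (close_le (lexx K) dKd); apply: closeD; first exact: xx.
  exact: closeN.
apply: closeV; rewrite ?subr_eq0//.
by case: (closeD (ww i) (closeN (ww j))).
Qed.

End Close.

Section PlaceAbs.
Variables (R : realType) (k : finFieldType) (F : fieldExtType {fraction {poly k}}).
Hypothesis Hk : is_constant_field F.
Variables (infty : place F) (delta : nat).
Hypothesis Hdelta : has_degree infty delta.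
Local Notation A := (regular infty).

Lemma card_gt1R : 1 < #|k|%:R :> R.
Proof. by rewrite ltr1n finRing_gt1. Qed.

Lemma place_abs_ge1 y : A y -> y != 0 -> 1 <= place_abs R infty delta y.
Proof.
move=> Ay y0; rewrite /place_abs (negPf y0) -[leLHS](expr0z #|k|%:R).
rewrite ler_eXz2l ?card_gt1R//.
have := regular_val Hk Ay; have := degree_gt0 Hdelta.
by move: (infty y) => z; nia.
Qed.

Lemma place_abs_gt1 y : infty y < 0 -> 1 < place_abs R infty delta y.
Proof.
move=> yneg; have y0 : y != 0 by apply: contraTneq yneg => ->; rewrite place_val0.
rewrite /place_abs (negPf y0) -[ltLHS](expr0z #|k|%:R) ltr_eXz2l ?card_gt1R//.
have := degree_gt0 Hdelta; move: (infty y) yneg => z; nia.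
Qed.

Lemma place_abs_le_val y (M : R) : y != 0 -> place_abs R infty delta y <= M ->
  - (Num.truncn M).+1%:Z <= infty y.
Proof.
move=> y0; rewrite /place_abs (negPf y0) leNgt => yM; rewrite leNgt; apply/negP => H.
move: yM => /negP; apply.
have M1 : M < (Num.truncn M).+1%:R by exact: truncnS_gt.
apply: (lt_le_trans M1).
set n := (Num.truncn M).+1.
have d0 := degree_gt0 Hdelta.
apply: (@le_trans _ _ (#|k|%:R ^+ n)).
  rewrite -natrX ler_nat ltnW// ltn_expl//; exact: finRing_gt1.
rewrite exprnP ler_eXz2l ?card_gt1R//.
move: (infty y) H => z; rewrite -/n; nia.
Qed.

End PlaceAbs.

Lemma eventually_all (T : eqType) (s : seq T) (P : T -> nat -> Prop) :
  (forall z, z \in s -> exists n0, forall n, (n0 <= n)%N -> P z n) ->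
  exists n0, forall n, (n0 <= n)%N -> forall z, z \in s -> P z n.
Proof.
elim: s => [|x s IH] H; first by exists 0%N.
have [|n0 n0P] := IH; first by move=> z zs; apply: H; rewrite inE zs orbT.
have [n1 n1P] := H x (mem_head _ _).
exists (maxn n0 n1) => n; rewrite geq_max => /andP[nn0 nn1] z.
by rewrite inE => /predU1P[->|zs]; [exact: n1P|exact: n0P].
Qed.

Section Modules.
Variables (R : realType) (k : finFieldType) (F : fieldExtType {fraction {poly k}}).
Hypothesis Hk : is_constant_field F.
Variables (infty : place F) (delta : nat).
Hypothesis Hdelta : has_degree infty delta.
Variables (C : fieldType) (v : absolute_value R C) (emb : {rmorphism F -> C}).
Hypothesis HC : complete_space (metrized v).
Hypothesis Hv : forall x, v (emb x) = place_abs R infty delta x.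
Local Notation A := (regular infty).
Variable a : F.
Hypotheses (Aa : A a) (a_pole : infty a < 0).

Lemma a_neq0 : a != 0.
Proof. by apply: contraTneq a_pole => ->; rewrite place_val0. Qed.

Lemma emb_a_neq0 : emb a != 0.
Proof. by rewrite fmorph_eq0 a_neq0. Qed.

Lemma absv_a_gt1 : 1 < v (emb a).
Proof. by rewrite Hv place_abs_gt1. Qed.

Lemma absv_regular_ge1 y : A y -> y != 0 -> 1 <= v (emb y).
Proof. by move=> Ay y0; rewrite Hv place_abs_ge1. Qed.

Lemma exists_pow_a (M : R) : exists n : nat, M < v (emb a) ^+ n.
Proof.
have a1 := absv_a_gt1; pose x := v (emb a) - 1.
have x0 : 0 < x by rewrite subr_gt0.
have bern n : 1 + n%:R * x <= v (emb a) ^+ n.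
  elim: n => [|n IH]; first by rewrite mul0r addr0 expr0.
  have q1 : 1 <= v (emb a) ^+ n by rewrite exprn_ege1// ltW.
  rewrite exprS; move: IH q1; set X := _ ^+ n => IH q1.
  by have qE : v (emb a) = x + 1 by [rewrite subrK]; rewrite qE -natr1; nra.
exists (Num.truncn (M / x)).+1; apply: lt_le_trans (bern _).
have : M / x < (Num.truncn (M / x)).+1%:R by exact: truncnS_gt.
by rewrite ltr_pdivrMr// => H; lra.
Qed.

Lemma finite_regular_ball (M : R) : finite_set [set y | A y /\ v (emb y) <= M].
Proof.
apply: (@sub_finite_set _ _ ([set y | A y /\ - (Num.truncn M).+1%:Z <= infty y] `|` [set 0])).
  move=> y [Ay yM]; have [->|y0] := eqVneq y 0; [by right|left].
  by split=> //; apply: (place_abs_le_val Hdelta y0); rewrite -Hv.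
by rewrite finite_setU; split; [exact: finite_regular_val Hdelta _|exact: finite_set1].
Qed.

(** What limits of lattices are, as long as they are not known to be finitely
    generated. *)
Record discrete_module (L : set C) : Prop := DiscreteModule {
  dm_submodule : is_submodule infty emb L ;
  dm_discrete : discrete_subgroup v L }.

Lemma lattice_discrete_module L : is_lattice infty v emb L -> discrete_module L.
Proof.
move=> [L0 LD LZ _ Lfin]; have sL : is_submodule infty emb L by split.
split=> //; split=> // x y Lx Ly.
exact: (submoduleB sL).
Qed.

Lemma dependent_over_F n (L : set C) (I : finType) (x : I -> C) : has_rank emb L n ->
  (forall i, L (x i)) -> (n < #|I|)%N ->
  exists c : I -> F, (exists i, c i != 0) /\ \sum_i emb (c i) * x i = 0.
Proof.
move=> [b [Lb bfree bspan]] Lx nI.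
have [c cP] := choice (fun i => bspan _ (Lx i)).
have [|u [u0 uc]] := @field_left_kernel _ _ _ c; first by rewrite card_ord.
exists u; split=> //.
under eq_bigr do rewrite cP mulr_sumr.
rewrite exchange_big big1// => j _ /=.
under eq_bigr do rewrite mulrA -rmorphM.
by rewrite -mulr_suml -rmorph_sum uc rmorph0 mul0r.
Qed.

Variables (D : nat) (f : 'I_D -> F).
Hypothesis fP : forall p : 'I_D -> {poly k}, \sum_i ev a (p i) * f i = 0 ->
     forall i, p i = 0.
Hypothesis dimD : forall (L I : finType) (x : I -> L -> F), (#|L| * D < #|I|)%N ->
     dependent a x.

Lemma has_rank_ev_rank n L : has_rank emb L n -> ev_rank_le emb a (n * D) L.
Proof.
move=> [b [Lb bfree bspan]] I x Lx nI.
have [c cP] := choice (fun i => bspan _ (Lx i)).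
have [|p [p0 pE]] := @dimD _ _ c; first by rewrite card_ord.
exists p; split=> //.
under eq_bigr do rewrite cP mulr_sumr.
rewrite exchange_big big1// => j _ /=.
under eq_bigr do rewrite mulrA -rmorphM.
by rewrite -mulr_suml -rmorph_sum pE rmorph0 mul0r.
Qed.

Lemma ev_rank_leW S S' (L : set C) : (S <= S')%N -> ev_rank_le emb a S L ->
  ev_rank_le emb a S' L.
Proof. by move=> SS' H I x Lx SI; apply: H => //; exact: leq_ltn_trans SI. Qed.

(** [exp_isogeny] for the inclusion of L in a^-1 L, together with e_(a^-1 L) (z)
    = a^-1 e_L (a z). The degree of Q is bounded because the index of L in a^-1
    L is at most #|k| ^ S. *)
Lemma exp_functional S L : discrete_module L -> ev_rank_le emb a S L ->
  exists2 Q : {poly C}, (size Q <= (#|k| ^ S).+2)%N &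
    forall z, exp_lattice v L (emb a * z) = Q.[exp_lattice v L z].
Proof.
move=> [sL dL] rkL; have ea0 := emb_a_neq0.
pose L' := [set x | L (emb a * x)].
have HL' : discrete_subgroup v L' := discrete_scale dL ea0.
have LL' : L `<=` L' by move=> x Lx; exact: (submoduleZ sL).
have bound s : uniq s -> (forall x, x \in s -> L' x /\ ~ L x) ->
    {in s &, forall x y, x != y -> ~ L (x - y)} -> (size s <= #|k| ^ S)%N.
  move=> us sM sE; rewrite -(size_map (fun x => emb a * x)).
  apply: (incongruent_leq Aa a_neq0 sL rkL).
  + by rewrite map_inj_uniq//; exact: mulfI.
  + by move=> _ /mapP[x /sM[L'x _] ->].
  move=> _ _ /mapP[x xs ->] /mapP[y ys ->] xy [w Lw].
  rewrite -mulrBr => /(mulfI ea0) E; apply: (sE _ _ xs ys); last by rewrite E.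
  by apply: contraNneq xy => ->.
have [||s [us sM sE scov]] := @exists_transversal C [set x | L' x /\ ~ L x]
    (fun x y => L (x - y)) (#|k| ^ S)%N.
- by move=> x y Lxy; rewrite -opprB; exact: (dsgN dL).
- exact: bound.
pose fac l : {poly C} := 1 - (exp_lattice v L l)^-1 *: 'X.
exists (emb a *: ('X * \prod_(l <- s) fac l)).
  apply: (leq_trans (size_scale_leq _ _)).
  have szX : size ('X : {poly C}) = 2%N by exact: size_polyX.
  apply: (leq_trans (size_polyMleq _ _)); rewrite szX.
  have : (size (\prod_(l <- s) fac l)%R <= (size s).+1)%N.
    elim: s {us sM sE scov} => [|l s IH]; first by rewrite big_nil size_poly1.
    rewrite big_cons; apply: (leq_trans (size_polyMleq _ _)).
    have : (size (fac l) <= 2)%N.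
      rewrite (leq_trans (size_polyD _ _))// geq_max size_poly1/= size_polyN.
      by rewrite (leq_trans (size_scale_leq _ _))// size_polyX.
    by move: IH => /=; lia.
  by move=> H; rewrite add2n/= ltnS (leq_trans H)// ltnS; exact: bound.
move=> z; rewrite hornerZ hornerM hornerX horner_prod.
have := exp_scale HC z dL ea0; rewrite -/L' => E.
have -> : exp_lattice v L (emb a * z) = emb a * exp_lattice v L' z by rewrite E mulVKf.
congr (_ * _); rewrite (exp_isogeny HC z dL HL' LL' us sM sE).
  by congr (_ * _); apply: eq_bigr => l _; rewrite /fac hornerD hornerN hornerZ hornerX [1 in RHS](_ : _ = 1%:P)// hornerC [in RHS]mulrC.
move=> x L'x; have [Lx|nLx] := pselect (L x); [by left|right].
have [xs|//] := scov x (conj L'x nLx).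
by exists x => //; rewrite subrr; exact: (dsg0 dL).
Qed.

Hypothesis Hroot : forall (m : nat) (x : F), (0 < m)%N -> exists c, c ^+ m = emb x.

Let q := v (emb a).
Let q1 : 1 < q. Proof. exact: absv_a_gt1. Qed.
Let q0 : 0 < q. Proof. exact: lt_trans q1. Qed.

(** The (i + 2)-th roots of a^-1 have different norms, for i = 0, 1, ..., all
    between q^-1 and 1. *)
Lemma exists_avoiding_norm (s : seq C) : exists z, [/\ q^-1 <= v z, v z < 1 &
  forall l, l \in s -> v l != v z].
Proof.
have H (i : nat) : exists c, c ^+ i.+2 = emb a^-1 by exact: Hroot.
have [c cP] := choice H.
have cq i : v (c i) ^+ i.+2 = q^-1.
  by rewrite -absvX cP fmorphV absvV.
have qV1 : q^-1 < 1 by rewrite invf_lt1.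
have qV0 : 0 < q^-1 by rewrite invr_gt0.
have c1 i : v (c i) < 1.
  rewrite ltNge; apply/negP => ci; have := cq i.
  by have : 1 <= v (c i) ^+ i.+2 by [rewrite exprn_ege1]; lra.
have cge i : q^-1 <= v (c i).
  rewrite -(cq i) exprS ler_piMr ?absv_ge0// exprn_ile1 ?absv_ge0// ltW//.
have cpos i : 0 < v (c i) by exact: lt_le_trans (cge i).
have cinj : injective (fun i => v (c i)).
  move=> i j cij; have : v (c i) ^+ i.+2 = v (c i) ^+ j.+2 by rewrite cq cij cq.
  move/eqP; rewrite eq_sym; have := c1 i; have := cpos i; move: (v (c i)) => t t0 t1.
  by have tn1 := lt_eqF t1; move=> /eqP/(ieexprIn t0 (negbT tn1)) [].
pose us := [seq v (c i) | i <- iota 0 (size s).+1].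
have uus : uniq us by rewrite map_inj_uniq// iota_uniq.
have : ~~ all (fun t => t \in [seq v l | l <- s]) us.
  apply/negP => /allP sub; have := uniq_leq_size uus sub.
  by rewrite !size_map size_iota ltnn.
move=> /allPn[_ /mapP[i _ ->]] ni; exists (c i); split=> // l ls.
by apply: contraNneq ni => <-; exact: map_f.
Qed.

(** At a point z of nearly maximal norm in the unit ball whose norm is not that
    of a lattice point, all factors 1 - z / l have norm at least 1, and the
    factor of mu has norm |z| / |mu| if mu is smaller than z. So a bound for e_L
    on the unit ball bounds mu from below. *)
Lemma norm_lower_bound L K mu : discrete_subgroup v L -> 0 < K ->
  (forall z, v z <= 1 -> v (exp_lattice v L z) <= K) -> L mu -> mu != 0 ->
  Num.min q^-1 (q^-1 * q^-1 / K) <= v mu.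
Proof.
move=> dL K0 eK Lmu mu0; have [z [zq z1 zl]] := exists_avoiding_norm (pts v L 1).
have [zmu|muz] := leP (v z) (v mu); first by rewrite ge_min (le_trans zq).
have qV0 : 0 < q^-1 by rewrite invr_gt0.
have vmu : 0 < v mu by rewrite absv_gt0.
have z0 : 0 < v z by exact: lt_le_trans zq.
have vf l : l != 0 -> v l != v z -> v (1 - z / l) = Num.max (v l) (v z) / v l.
  move=> l0 lz; have -> : 1 - z / l = (l - z) / l by field.
  rewrite absvM absvV; congr (_ / _).
  by case: ltgtP lz => // lt _; [exact: absvB_eqr|exact: absvB_eql].
suff H : v z * (v z / v mu) <= K.
  rewrite ge_min; apply/orP; right; rewrite ler_pdivrMr//.
  have zz : v z * v z <= K * v mu by move: H; rewrite mulrA ler_pdivrMr.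
  by rewrite [leRHS]mulrC; apply: le_trans zz; apply: ler_pM; rewrite ?(ltW qV0).
apply: le_trans (eK _ (ltW z1)).
rewrite (exp_lattice_norm HC dL z1) /zpoly absvM ler_wpM2l ?absv_ge0//.
have mupts : mu \in pts v L 1 by apply/(mem_pts dL); split=> //; lra.
rewrite absv_prod (big_rem mu)//= mu0 vf// ?zl// max_r; last exact: ltW.
rewrite -[leLHS]mulr1; apply: ler_wpM2l; first by rewrite divr_ge0// ltW.
rewrite big_seq_cond; elim/big_rec: _ => // l x /andP[/mem_rem ls l0] x1.
rewrite -[leLHS]mulr1; apply: ler_pM => //; rewrite vf ?zl//.
by rewrite ler_pdivlMr ?absv_gt0// mul1r le_max lexx.
Qed.

Section Limit.
Variables (L : nat -> set C) (S : nat).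
Hypothesis HM : forall n, discrete_module (L n).
Hypothesis Hrk : forall n, ev_rank_le emb a S (L n).

Local Notation e n := (exp_lattice v (L n)).
Let dL n : discrete_subgroup v (L n). Proof. by case: (HM n). Qed.
Let sL n : is_submodule infty emb (L n). Proof. by case: (HM n). Qed.

(** The metric gives this condition for T = 1. *)
Definition exp_cauchy T := forall eps, 0 < eps -> exists n0, forall n m,
  (n0 <= n)%N -> (n0 <= m)%N -> forall z, v z <= T -> v (e n z - e m z) <= eps.

Lemma exp_cauchy_bounded T : exp_cauchy T -> exists K n0, 1 <= K /\
  forall n, (n0 <= n)%N -> forall z, v z <= T -> v (e n z) <= K.
Proof.
move=> /(_ 1 ltr01)[n0 n0P]; have [K KP] := exp_lattice_bounded HC (dL n0) T.
exists (Num.max 1 K), n0; split; first by rewrite le_max lexx.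
move=> n nn z zT; rewrite -[e n z](subrK (e n0 z)); apply: absvD_le.
  by rewrite le_max n0P.
by rewrite le_max KP ?orbT.
Qed.

(** The exponential functions are uniformly bounded on the unit ball, so that
    [norm_lower_bound] applies to all of them. *)
Lemma exp_cauchy_norm : exp_cauchy 1 -> exists rho n0, [/\ 0 < rho, rho <= 1 &
  forall n, (n0 <= n)%N -> forall mu, L n mu -> mu != 0 -> rho <= v mu].
Proof.
move=> /exp_cauchy_bounded[K [n0 [K1 KP]]]; have K0 : 0 < K by lra.
have qV0 : 0 < q^-1 by rewrite invr_gt0.
exists (Num.min q^-1 (q^-1 * q^-1 / K)), n0; split.
- by rewrite lt_min qV0 divr_gt0// mulr_gt0.
- by rewrite ge_min invf_le1// ltW.
move=> n nn mu Lmu mu0; apply: (norm_lower_bound (dL n) K0) => //.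
exact: KP.
Qed.

Variable rho : R.
Hypotheses (rho0 : 0 < rho) (rho1 : rho <= 1).
Hypothesis Hrho : forall n mu, L n mu -> mu != 0 -> rho <= v mu.
Hypothesis Hcau : exp_cauchy 1.

Lemma exp_iso n z : v z < rho -> v (e n z) = v z.
Proof.
move=> zr; apply: (exp_lattice_iso HC (dL n)) => l Ll l0.
exact: lt_le_trans (Hrho Ll l0).
Qed.

(** On the ball of radius q T, e_n (a u) is the value at e_n u of a polynomial
    of bounded degree. By interpolation this polynomial is a continuous function
    of the values of e_n at finitely many small points; as e_n preserves small
    distances, the nodes stay apart. *)
Lemma exp_cauchy_step T : 1 <= T -> exp_cauchy T -> exp_cauchy (q * T).
Proof.
move=> T1 cT; have [K [n0 [K1 KP]]] := exp_cauchy_bounded cT.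
pose m0 := (#|k| ^ S).+2.
have [j0 j0P] := exists_pow_a rho^-1.
(* so small that e_n preserves the norms of zz i and of a zz i *)
pose zz (i : 'I_m0) := (emb a)^-1 ^+ (j0.+1 + i).
have ea0 : emb a != 0 by exact: emb_a_neq0.
have vzz (i : 'I_m0) : v (zz i) = q^-1 ^+ (j0.+1 + i) by rewrite absvX absvV.
have azz (i : 'I_m0) : v (emb a * zz i) < rho.
  have -> : emb a * zz i = (emb a)^-1 ^+ (j0 + i).
    by rewrite /zz addSn exprS mulrA divff// mul1r.
  rewrite absvX absvV -/q exprD exprVn.
  apply: (@le_lt_trans _ _ (q ^- j0)).
    rewrite ler_piMr ?invr_ge0 ?exprn_ge0 ?(ltW q0)//.
    by rewrite exprVn invf_le1 ?exprn_gt0// exprn_ege1// ltW.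
  by rewrite -[ltRHS]invrK ltf_pV2 ?posrE ?exprn_gt0 ?invr_gt0.
have zzr i : v (zz i) < rho.
  apply: le_lt_trans (azz i); rewrite absvM ler_peMl ?absv_ge0//.
  exact: ltW.
have zzinj : injective zz.
  move=> i j zij; have : q^-1 ^+ (j0.+1 + i) = q^-1 ^+ (j0.+1 + j).
    by rewrite -!vzz zij.
  have qV0 : 0 < q^-1 by rewrite invr_gt0.
  have qV1 : q^-1 != 1 by rewrite lt_eqF// invf_lt1.
  by move=> /(ieexprIn qV0 qV1)/addnI/val_inj.
have wE n i j : v (e n (zz i) - e n (zz j)) = v (zz i - zz j).
  rewrite -(exp_latticeB HC (dL n)); apply: exp_iso.
  exact: absvB_lt.
have winj n : injective (fun i => e n (zz i)).
  move=> i j eij; apply: zzinj; apply/eqP; rewrite -subr_eq0 -(absv_eq0 v) -(wE n).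
  by rewrite eij subrr absv0.
pose K' := K + \sum_i \sum_j v (zz i - zz j)^-1.
have sum0 : 0 <= \sum_i \sum_j v (zz i - zz j)^-1.
  by apply: sumr_ge0 => i _; apply: sumr_ge0 => j _; exact: absv_ge0.
have KK' : K <= K' by rewrite lerDl.
have K'1 : 1 <= K' by exact: le_trans KK'.
have [K'' K''0 lagP] := lagrange_close v m0 K'1.
move=> eps eps0; have de : 0 < eps / K'' by rewrite divr_gt0.
have [n1 n1P] := cT _ de.
exists (maxn n0 n1) => n m; rewrite !geq_max => /andP[nn0 nn1] /andP[mn0 mn1] z zT.
have [u uT zE] : exists2 u, v u <= T & z = emb a * u.
  exists (z / emb a); last by rewrite mulrC divfK.
  by rewrite absvM absvV ler_pdivrMr// mulrC.
have [Q szQ QE] := exp_functional (HM n) (@Hrk n).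
have [Q' szQ' QE'] := exp_functional (HM m) (@Hrk m).
rewrite zE QE QE' (lagrange_evalE _ (winj n) szQ) (lagrange_evalE _ (winj m) szQ').
rewrite -(divfK (lt0r_neq0 K''0) eps) mulrC.
have cl x : v x <= T -> close v K' (eps / K'') (e n x) (e m x).
  by move=> xT; split; [apply: le_trans KK'; exact: KP|apply: le_trans KK'; exact: KP|exact: n1P].
apply: lagP; first exact: ltW.
- move=> i; apply: cl; apply: le_trans T1; apply: le_trans rho1; exact: ltW.
- move=> i; rewrite -QE -QE'; apply: cl.
  by apply: le_trans T1; apply: le_trans rho1; exact: ltW.
- exact: cl.
move=> i j ij; split.
- by rewrite (inj_eq (winj n)).
- by rewrite (inj_eq (winj m)).
- rewrite absvV wE -absvV /K' (bigD1 i)//= (bigD1 j)//=.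
  rewrite addrCA -addrA lerDl addr_ge0//; first by apply: sumr_ge0 => l _; exact: absv_ge0.
  rewrite addr_ge0//; first by lra.
  by apply: sumr_ge0 => l _; apply: sumr_ge0 => l' _; exact: absv_ge0.
rewrite absvV wE -absvV /K' (bigD1 i)//= (bigD1 j)//=.
rewrite addrCA -addrA lerDl addr_ge0//; first by apply: sumr_ge0 => l _; exact: absv_ge0.
rewrite addr_ge0//; first by lra.
by apply: sumr_ge0 => l _; apply: sumr_ge0 => l' _; exact: absv_ge0.
Qed.

Lemma exp_cauchy_all T : exp_cauchy T.
Proof.
have H (n : nat) : exp_cauchy (q ^+ n).
  elim: n => [|n IH]; first by rewrite expr0.
  by rewrite exprS; apply: exp_cauchy_step => //; rewrite exprn_ege1// ltW.
have [n nT] := exists_pow_a T => eps /(H n)[n0 n0P].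
exists n0 => i j ni nj z zT; apply: n0P => //.
by rewrite (le_trans zT)// ltW.
Qed.

(** If l is in L n then e_m l is close to e_n l = 0, and [exp_lattice_near]
    applies. *)
Lemma near_other T eps : 0 < eps -> exists n0, forall n m, (n0 <= n)%N -> (n0 <= m)%N ->
  forall l, L n l -> v l <= T -> exists2 l', L m l' & v (l - l') <= eps.
Proof.
move=> /(@exp_cauchy_all T)[n0 n0P]; exists n0 => n m nn mm l Ll lT.
have [l' Ll' ll'] := exp_lattice_near HC (dL m) l; exists l' => //.
apply: (le_trans ll'); have := n0P m n mm nn l lT.
by rewrite (iffRL (exp_lattice_eq0 HC (dL n) l) Ll) subr0.
Qed.

Definition limset := [set z | exists s : nat -> C, (forall n, L n (s n)) /\ cvgv v s z].

Lemma limset_submodule : is_submodule infty emb limset.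
Proof.
split.
- by exists (fun=> 0); split; [move=> n; exact: (submodule0 (sL n))|exact: cvgv_cst].
- move=> x y [s [Ls sx]] [t [Lt ty]]; exists (fun n => s n + t n).
  by split; [move=> n; exact: (submoduleD (sL n))|exact: cvgvD].
move=> b x Ab [s [Ls sx]]; exists (fun n => emb b * s n).
by split; [move=> n; exact: (submoduleZ (sL n))|exact: cvgvMl].
Qed.

Lemma limset_norm z : limset z -> z != 0 -> rho <= v z.
Proof.
move=> [s [Ls sz]] z0; apply: (cvgv_neq0_ge (n0 := 0%N) sz z0) => n _.
exact: Hrho.
Qed.

Lemma limset_sep x y : limset x -> limset y -> v (x - y) < rho -> x = y.
Proof.
move=> lx ly xy; apply/eqP; rewrite -subr_eq0; apply: contraTT xy => xy0.
by rewrite -leNgt limset_norm//; exact: (submoduleB limset_submodule).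
Qed.

Lemma seq_sep n x y : L n x -> L n y -> v (x - y) < rho -> x = y.
Proof.
move=> lx ly xy; apply/eqP; rewrite -subr_eq0; apply: contraTT xy => xy0.
by rewrite -leNgt (@Hrho n)//; exact: (submoduleB (sL n)).
Qed.

(** The points near l in the lattices L m are unique by the separation of
    lattice points, and they form a Cauchy sequence. *)
Lemma near_limset T eps : 0 < eps -> exists n0, forall n, (n0 <= n)%N ->
  forall l, L n l -> v l <= T -> exists2 z, limset z & v (l - z) <= eps.
Proof.
move=> eps0; pose ep := Num.min eps (rho / 2).
have ep0 : 0 < ep by rewrite lt_min eps0 divr_gt0.
have r2 : rho / 2 < rho by move: rho0; lra.
have epr : ep < rho by rewrite gt_min r2 orbT.
have [n0 n0P] := near_other T ep0; exists n0 => n nn l Ll lT.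
have H m : exists l', L m l' /\ ((n0 <= m)%N -> v (l - l') <= ep).
  have [nm|mn] := leqP n0 m.
    by have [l' Ll' ll'] := n0P n m nn nm l Ll lT; exists l'.
  by exists 0; split=> //; exact: (submodule0 (sL m)).
have [s sP] := choice H; have Ls m : L m (s m) by case: (sP m).
have sl m : (n0 <= m)%N -> v (l - s m) <= ep by case: (sP m).
pose T' := Num.max T ep.
have sT m : (n0 <= m)%N -> v (s m) <= T'.
  move=> nm; have -> : s m = l - (l - s m) by ring.
  by apply: absvB_le; rewrite le_max ?lT// sl ?orbT.
have cs : cauchyv v s.
  move=> d d0; pose d' := Num.min d ep.
  have d'0 : 0 < d' by rewrite lt_min d0.
  have [n1 n1P] := near_other T' d'0; exists (maxn n0 n1) => i j.
  rewrite !geq_max => /andP[i0 i1] /andP[j0 j1].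
  have [l' Ll' sl'] := n1P i j i1 j1 (s i) (Ls i) (sT _ i0).
  have <- : l' = s j.
    apply: (@seq_sep j) => //; apply: le_lt_trans epr.
    have -> : l' - s j = (l - s j) - (l - s i) - (s i - l') by ring.
    apply: absvB_le; first by apply: absvB_le; exact: sl.
    by rewrite (le_trans sl')// ge_min lexx orbT.
  by rewrite (le_trans sl')// ge_min lexx.
have [z sz] := cauchyv_cvgv HC cs.
exists z; first by exists s.
have : v (l - z) <= ep.
  apply: (@cvgv_le _ _ v (fun m => l - s m) _ n0) => //.
  by apply: cvgvB => //; exact: cvgv_cst.
by move=> /le_trans; apply; rewrite ge_min lexx.
Qed.

Lemma limset_near T eps : 0 < eps -> exists n0, forall n, (n0 <= n)%N ->
  forall z, limset z -> v z <= T -> exists2 l, L n l & v (z - l) <= eps.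
Proof.
move=> eps0; have [n0 n0P] := near_other (Num.max T eps) eps0.
exists n0 => n nn z [s [Ls sz]] zT; have [n1 n1P] := sz _ eps0.
pose m := maxn n0 n1; have sm := n1P m (leq_maxr _ _).
have smT : v (s m) <= Num.max T eps.
  by rewrite -[s m](subrK z); apply: absvD_le; rewrite le_max ?sm ?zT ?orbT.
have [l Ll sl] := n0P m n (leq_maxl _ _) nn _ (Ls m) smT.
by exists l => //; apply: absvB_trans sl; rewrite absv_distC.
Qed.

Lemma limset_discrete : discrete_subgroup v limset.
Proof.
split; first exact: (submodule0 limset_submodule).
  by move=> x y; exact: (submoduleB limset_submodule).
have r2 : rho / 2 < rho by move: rho0; lra.
move=> M; have [n0 n0P] := limset_near M (divr_gt0 rho0 (ltr0n R 2)).
have H l : exists z, (exists z', [/\ limset z', v z' <= M & v (z' - l) <= rho / 2]) ->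
    [/\ limset z, v z <= M & v (z - l) <= rho / 2].
  have [[z zP]|nz] := pselect (exists z', [/\ limset z', v z' <= M & v (z' - l) <= rho / 2]).
    by exists z.
  by exists 0.
have [g gP] := choice H.
apply: (@sub_finite_set _ _ (g @` [set l | L n0 l /\ v l <= Num.max M rho])).
  move=> z [lz zM]; have [l Ll zl] := n0P n0 (leqnn _) z lz zM.
  have [|lg gM gl] := gP l; first by exists z.
  exists l.
    split=> //; have -> : l = z - (z - l) by ring.
    by apply: absvB_le; rewrite le_max ?zM// (le_trans zl (ltW r2)) orbT.
  apply: limset_sep => //.
  have -> : g l - z = (g l - l) - (z - l) by ring.
  by apply: le_lt_trans r2; exact: absvB_le.
by apply: finite_image; exact: dsg_finite.
Qed.

Lemma limset_module : discrete_module limset.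
Proof. by split; [exact: limset_submodule|exact: limset_discrete]. Qed.

(** Choosing nearby points is injective if the points of L1 are further apart
    than the errors. *)
Lemma pts_size_le (L1 L2 : set C) d T : discrete_subgroup v L1 ->
  discrete_subgroup v L2 -> d <= T ->
  (forall x y, L1 x -> L1 y -> v (x - y) <= d -> x = y) ->
  (forall l, L1 l -> v l <= T -> exists2 l', L2 l' & v (l - l') <= d) ->
  (size (pts v L1 T) <= size (pts v L2 T))%N.
Proof.
move=> d1 d2 dT sep near12.
have H l : exists l', L1 l -> v l <= T -> L2 l' /\ v (l - l') <= d.
  have [[Ll lT]|nl] := pselect (L1 l /\ v l <= T); last first.
    by exists 0 => Ll lT; case: nl.
  by have [l' Ll' ll'] := near12 l Ll lT; exists l'.
have [g gP] := choice H.
rewrite -(size_map g); apply: uniq_leq_size.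
  rewrite map_inj_in_uniq; first exact: pts_uniq.
  move=> x y /(mem_pts d1)[Lx xT] /(mem_pts d1)[Ly yT] gxy.
  have [_ xg] := gP x Lx xT; have [_ yg] := gP y Ly yT.
  apply: sep => //; apply: (@absvB_trans _ _ _ (g x)) => //.
  by rewrite gxy absv_distC.
move=> _ /mapP[x /(mem_pts d1)[Lx xT] ->]; have [Lg xg] := gP x Lx xT.
apply/(mem_pts d2); split=> //; have -> : g x = x - (x - g x) by ring.
by apply: absvB_le => //; exact: le_trans dT.
Qed.

(** Up to the radius T the points of L n converge to those of the limit, hence
    so do the partial products up to T; the tails are uniformly small for large
    T. *)
Lemma exp_limset_cvg z : cvgv v (fun n => e n z) (exp_lattice v limset z).
Proof.
have dI := limset_discrete.
have r2 : rho / 2 < rho by move: rho0; lra.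
have r20 : 0 < rho / 2 by rewrite divr_gt0.
have H y : exists s : nat -> C, limset y -> (forall n, L n (s n)) /\ cvgv v s y.
  have [[s sP]|ny] := pselect (limset y); first by exists s.
  by exists (fun=> 0) => /ny.
have [sg sgP] := choice H.
have perm T : rho <= T -> exists n0, forall n, (n0 <= n)%N ->
    perm_eq (pts v (L n) T) [seq sg y n | y <- pts v limset T].
  move=> rT; have [n0 n0P] := near_limset T r20.
  have [|n1 n1P] := @eventually_all _ (pts v limset T)
      (fun y n => v (sg y n - y) <= rho / 2).
    by move=> y /(mem_pts dI)[/sgP[_ sy] _]; exact: sy.
  exists (maxn n0 n1) => n; rewrite geq_max => /andP[nn0 nn1].
  have un : uniq [seq sg y n | y <- pts v limset T].
    rewrite map_inj_in_uniq; first exact: pts_uniq.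
    move=> x y xs ys sxy; have := n1P n nn1 _ xs; have := n1P n nn1 _ ys.
    move: xs ys => /(mem_pts dI)[lx _] /(mem_pts dI)[ly _] yy xx.
    apply: limset_sep => //; apply: le_lt_trans r2.
    by apply: (@absvB_trans _ _ _ (sg x n)); [rewrite absv_distC|rewrite sxy].
  apply: uniq_perm => //; first exact: pts_uniq.
  move=> l; apply/idP/mapP => [/(mem_pts (dL n))[Ll lT]|[y ys ->]].
    have [y ly yl] := n0P n nn0 l Ll lT.
    have ys : y \in pts v limset T.
      apply/(mem_pts dI); split=> //; have -> : y = l - (l - y) by ring.
      by apply: absvB_le => //; rewrite (le_trans yl)// (le_trans (ltW r2)).
    exists y => //; apply: (@seq_sep n) => //; first by case: (sgP _ ly).
    apply: le_lt_trans r2; apply: (@absvB_trans _ _ _ y) => //.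
    by rewrite absv_distC; exact: n1P.
  have ysg := n1P n nn1 _ ys; move: ys => /(mem_pts dI)[ly yT].
  apply/(mem_pts (dL n)); split; first by case: (sgP _ ly).
  rewrite -[sg y n](subrK y); apply: absvD_le => //.
  by rewrite (le_trans ysg)// (le_trans (ltW r2)).
have cvgT T : rho <= T -> cvgv v (fun n => zpoly (pts v (L n) T) z) (zpoly (pts v limset T) z).
  move=> rT; have [n0 n0P] := perm T rT.
  have [|n1 n1P] := @eventually_all _ (pts v limset T)
      (fun y n => (sg y n != 0) = (y != 0)).
    move=> y /(mem_pts dI)[ly _]; have [Ls sy] := sgP _ ly.
    have [->|y0] := eqVneq y 0.
      have ly0 : limset 0 by exact: (submodule0 limset_submodule).
      have [Ls0 s0] := sgP _ ly0; have [n nP] := s0 _ r20.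
      exists n => m /nP; rewrite subr0 => sm; apply/negbTE; rewrite negbK.
      rewrite -[X in _ == X](@seq_sep m (sg 0 m) 0)//; first exact: (submodule0 (sL m)).
      by rewrite subr0; exact: le_lt_trans r2.
    have [n nP] := cvgv_norm sy y0; exists n => m /nP sm.
    by rewrite -(absv_gt0 v) sm absv_gt0.
  apply: (@cvgv_eq _ _ v (maxn n0 n1) (fun n => z * \prod_(y <- pts v limset T |
      (y \in pts v limset T) && (y != 0)) (1 - z / sg y n))).
    move=> n; rewrite geq_max => /andP[nn0 nn1]; rewrite /zpoly.
    rewrite (perm_big _ (n0P n nn0))/= big_map; congr (_ * _).
    rewrite [RHS]big_seq_cond; apply: eq_bigl => y.
    by case: (boolP (y \in _)) => //= ys; rewrite (n1P n nn1).
  rewrite /zpoly; apply: cvgvMl; rewrite [X in cvgv _ _ X]big_seq_cond.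
  apply: cvgv_prod => y /andP[/(mem_pts dI)[ly _] y0].
  apply: cvgvB; first exact: cvgv_cst.
  by apply: cvgvMl; apply: cvgvV => //; case: (sgP _ ly).
have [K [n0 [K1 KP]]] := exp_cauchy_bounded (@exp_cauchy_all (v z)).
move=> eps eps0; set M := exp_lattice v limset z.
pose B := (K + v M) * v z.
have B0 : 0 <= B by rewrite mulr_ge0 ?addr_ge0 ?absv_ge0//; lra.
have BT0 : 0 <= B / eps by rewrite divr_ge0// ltW.
pose T := v z + 1 + B / eps.
have vz0 := absv_ge0 v z.
have zT : v z < T by rewrite /T; move: vz0 BT0; lra.
have T0 : 0 < T by exact: le_lt_trans zT.
have rT : rho <= T by rewrite (le_trans rho1)// /T; move: vz0 BT0; lra.
have small x : v x <= K + v M -> v x * (v z / T) <= eps.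
  move=> xK; rewrite mulrA ler_pdivrMr//.
  apply: (@le_trans _ _ B); first by rewrite /B ler_wpM2r.
  rewrite -ler_pdivrMl// mulrC /T; move: vz0; lra.
have [n1 n1P] := cvgT T rT _ eps0.
exists (maxn n0 n1) => n; rewrite geq_max => /andP[nn0 nn1].
apply: (@absvB_trans _ _ _ (zpoly (pts v (L n) T) z)).
  apply: (le_trans (exp_lattice_tail HC (dL n) zT)); apply: small.
  by rewrite (le_trans (KP n nn0 z (lexx _)))// lerDl absv_ge0.
apply: (@absvB_trans _ _ _ (zpoly (pts v limset T) z)); first exact: n1P.
rewrite absv_distC; apply: (le_trans (exp_lattice_tail HC dI zT)); apply: small.
by rewrite lerDr; lra.
Qed.

(** There are at most #|k| ^ S classes modulo a L0, and in each of them division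
    by a after subtraction of a representative leads to a smaller ball. *)
Lemma pts_growth (L0 : set C) T : discrete_module L0 -> ev_rank_le emb a S L0 ->
  (size (pts v L0 (q * T)) <= #|k| ^ S * size (pts v L0 T))%N.
Proof.
move=> [sL0 dL0] rk0; have ea0 : emb a != 0 := emb_a_neq0.
have [||s [us sM sE scov]] := @exists_transversal C [set x | L0 x /\ v x <= q * T]
    (congr_mod emb a L0) (#|k| ^ S)%N.
- by move=> x y; exact: (congr_mod_sym sL0).
- move=> s us sM sE; apply: (incongruent_leq Aa a_neq0 sL0 rk0) => // x /sM[].
  done.
have bound : (size s <= #|k| ^ S)%N.
  by apply: (incongruent_leq Aa a_neq0 sL0 rk0) => // x /sM[].
apply: (@leq_trans (size s * size (pts v L0 T))); last by rewrite leq_mul2r bound orbT.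
rewrite -(size_allpairs (fun x w => x + emb a * w)); apply: uniq_leq_size.
  exact: pts_uniq.
move=> x /(mem_pts dL0)[Lx xT]; apply/allpairsP.
have [xs|[y ys [w Lw xy]]] := scov x (conj Lx xT).
  have T0 : 0 <= T by rewrite -(pmulr_rge0 _ q0) (le_trans (absv_ge0 v x)).
  exists (x, 0); split => //=; last by rewrite mulr0 addr0.
  by apply/(mem_pts dL0); split; [exact: (submodule0 sL0)|rewrite absv0].
exists (y, w); split => //=; last by rewrite -xy addrC subrK.
apply/(mem_pts dL0); split => //; rewrite -(ler_pM2l q0) -absvM -xy.
by apply: absvB_le => //; case: (sM _ ys).
Qed.

(** Independence of elements is not inherited from the limit by the L n, but the
    number of points in a ball is. If the limit had more than S independent
    elements, it would have at least #|k| ^ ((S + 1) m) points of norm at most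
    q^m M, whereas [pts_growth] allows only a constant multiple of #|k| ^ (S m)
    of them. *)
Lemma limset_ev_rank : ev_rank_le emb a S limset.
Proof.
move=> I x lx SI; apply: contrapT => nrel.
have dI := limset_discrete; have r2 : rho / 2 < rho by move: rho0; lra.
have r20 : 0 < rho / 2 by rewrite divr_gt0.
pose M := 1 + \sum_i v (x i).
have sum0 : 0 <= \sum_i v (x i) by apply: sumr_ge0 => i _; exact: absv_ge0.
have xM i : v (x i) <= M.
  rewrite /M (bigD1 i)//= addrCA lerDl addr_ge0//.
  by apply: sumr_ge0 => j _; exact: absv_ge0.
have M1 : 1 <= M by rewrite lerDl.
have [n1 n1P] := near_other M r20.
pose c0 := size (pts v (L n1) M).
have base n : (n1 <= n)%N -> (size (pts v (L n) M) <= c0)%N.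
  move=> nn; apply: (@pts_size_le _ _ (rho / 2)) => //.
  - by rewrite (le_trans (ltW r2))// (le_trans rho1).
  - by move=> u w Lu Lw uw; apply: (@seq_sep n) => //; exact: le_lt_trans r2.
  by move=> l; apply: n1P.
have grow n m : (n1 <= n)%N ->
    (size (pts v (L n) (q ^+ m * M)) <= (#|k| ^ S) ^ m * c0)%N.
  move=> nn; elim: m => [|m IH]; first by rewrite expr0 mul1r expn0 mul1n base.
  rewrite exprS -mulrA; apply: (leq_trans (pts_growth _ (HM n) (@Hrk n))).
  by rewrite expnS -mulnA leq_mul2l IH orbT.
have qm1 m : 1 <= q ^+ m by rewrite exprn_ege1// ltW.
have growI m : (size (pts v limset (q ^+ m * M)) <= (#|k| ^ S) ^ m * c0)%N.
  have [n2 n2P] := limset_near (q ^+ m * M) r20.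
  apply: leq_trans (grow (maxn n1 n2) m (leq_maxl _ _)).
  apply: (@pts_size_le _ _ (rho / 2)) => //.
  - rewrite (le_trans (ltW r2))// (le_trans rho1)//.
    by rewrite -[leLHS]mulr1 ler_pM.
  - by move=> u w lu lw uw; apply: limset_sep => //; exact: le_lt_trans r2.
  by apply: n2P; exact: leq_maxr.
(* c lists the coefficients of polynomials of degree less than m *)
have lower m : (#|k| ^ (#|I| * m) <= size (pts v limset (q ^+ m * M)))%N.
  pose po (c : {ffun I * 'I_m -> k}) i : {poly k} := \poly_(j < m) (
     if insub j is Some j' then c (i, j') else 0).
  have poE (c : {ffun I * 'I_m -> k}) i (j : 'I_m) : (po c i)`_j = c (i, j).
    rewrite coef_poly ltn_ord; case: insubP => [j' _ jj'|]; last by rewrite ltn_ord.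
    by congr (c (_, _)); apply: val_inj.
  pose g c := \sum_i emb (ev a (po c i)) * x i.
  have ginj : injective g.
    move=> c c' cc'; apply/ffunP => -[i j]; rewrite -!poE.
    apply: contrapT => /eqP ne; apply: nrel.
    exists (fun i => po c i - po c' i); split.
      exists i; apply: contraNneq ne => /subr0_eq ->; exact: eqxx.
    under eq_bigr do rewrite !rmorphB mulrBl.
    by rewrite sumrB; apply/eqP; rewrite subr_eq0; apply/eqP.
  have -> : (#|k| ^ (#|I| * m))%N = size (map g (enum {ffun I * 'I_m -> k})).
    by rewrite size_map -cardT card_ffun card_prod card_ord.
  apply: uniq_leq_size; first by rewrite map_inj_uniq// enum_uniq.
  move=> _ /mapP[c _ ->]; apply/(mem_pts dI); split.
    apply: (submodule_sum limset_submodule) => i _.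
    by apply: (submoduleZ limset_submodule) => //; exact: regular_ev.
  apply: absv_sum_le; first by rewrite mulr_ge0//; move: M1 (qm1 m); lra.
  move=> i _; rewrite absvM; apply: ler_pM; rewrite ?absv_ge0//.
  rewrite /ev/= horner_evalE horner_coef rmorph_sum.
  apply: absv_sum_le; first by move: (qm1 m); lra.
  move=> j _; rewrite coef_map !rmorphM rmorphXn !absvM/= absvX -/q.
  have cst1 (t : k) : v (emb (const F t)) <= 1.
    rewrite Hv /place_abs; case: ifP => _ //.
    by rewrite place_const mulr0 oppr0 expr0z.
  rewrite -[leRHS]mul1r; apply: ler_pM; rewrite ?absv_ge0 ?exprn_ge0 ?(ltW q0)//.
  apply: ler_weXn2l; first exact: ltW.
  apply: ltnW; apply: leq_trans (size_poly m _).
  by apply: leq_trans (ltn_ord j) _; exact: size_poly.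
(* m = c0 is large enough, as c0 < #|k| ^ c0 *)
have := leq_trans (lower c0) (growI c0).
rewrite -expnM leqNgt => /negP; apply.
apply: (@leq_trans (#|k| ^ (S * c0) * #|k| ^ c0)).
  by rewrite ltn_pmul2l ?expn_gt0 ?(ltnW (finRing_gt1 k))//; apply: ltn_expl; exact: finRing_gt1.
rewrite -expnD -mulSnr leq_pexp2l ?(ltnW (finRing_gt1 k))//.
by rewrite leq_mul2r SI orbT.
Qed.

End Limit.
(** Descent: modulo a L each x is congruent to a combination y over k of the
    elements of [exists_generators_mod]. These y are bounded, and (x - y) / a is
    smaller than x if x is large. *)
Lemma discrete_module_fg S (L : set C) : discrete_module L -> ev_rank_le emb a S L ->
  exists (m : nat) (g : 'I_m -> C), (forall i, L (g i)) /\
    forall x, L x -> exists b : 'I_m -> F,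
      (forall i, A (b i)) /\ x = \sum_i emb (b i) * g i.
Proof.
move=> [sL dL] rk; have ea0 : emb a != 0 := emb_a_neq0.
have sA := regular_subring infty.
have [t [g [_ Lg gcov]]] := exists_generators_mod Aa a_neq0 sL rk.
pose M := 1 + \sum_i v (g i).
have gM i : v (g i) <= M.
  rewrite /M (bigD1 i)//= addrCA lerDl addr_ge0//.
  by apply: sumr_ge0 => j _; exact: absv_ge0.
have M1 : 1 <= M by rewrite lerDl; apply: sumr_ge0 => i _; exact: absv_ge0.
pose s := pts v L M; pose h (i : 'I_(size s)) := s`_i.
exists (size s), h; split; first by move=> i; case/(mem_pts dL): (mem_nth 0 (ltn_ord i)).
pose spanned x := exists b : 'I_(size s) -> F,
   (forall i, A (b i)) /\ x = \sum_i emb (b i) * h i.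
have span_mem x : x \in s -> spanned x.
  move=> xs; have ix : (index x s < size s)%N by rewrite index_mem.
  exists (fun i => (i == Ordinal ix)%:R); split.
    by move=> i; case: (_ == _); [exact: subring1|exact: (subring0 sA)].
  rewrite (bigD1 (Ordinal ix))//= eqxx rmorph1 mul1r big1 ?addr0.
    by rewrite /h nth_index.
  by move=> i /negPf ->; rewrite rmorph0 mul0r.
have spanD x y : spanned x -> spanned y -> spanned (x + y).
  move=> [b [Ab ->]] [b' [Ab' ->]]; exists (fun i => b i + b' i); split.
    by move=> i; exact: (subringD sA).
  by rewrite -big_split; apply: eq_bigr => i _; rewrite rmorphD mulrDl.
have spanZ c x : A c -> spanned x -> spanned (emb c * x).
  move=> Ac [b [Ab ->]]; exists (fun i => c * b i); split.
    by move=> i; exact: (subringM sA).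
  by rewrite mulr_sumr; apply: eq_bigr => i _; rewrite rmorphM mulrA.
have key n x : L x -> v x <= q ^+ n * M -> spanned x.
  elim: n x => [|n IH] x Lx xM.
    by apply: span_mem; apply/(mem_pts dL); rewrite expr0 mul1r in xM.
  have [c [w Lw xw]] := gcov x Lx.
  set y := \sum_i _ in xw.
  have yM : v y <= M.
    apply: absv_sum_le; first by move: M1; lra.
    move=> i _; rewrite absvM -[leRHS]mul1r; apply: ler_pM; rewrite ?absv_ge0//.
    rewrite Hv /place_abs; case: ifP => _ //.
    by rewrite place_const mulr0 oppr0 expr0z.
  have Ly : L y.
    apply: (submodule_sum sL) => i _; apply: (submoduleZ sL) => //.
    exact: regular_const.
  have qn : 1 <= q ^+ n by rewrite exprn_ege1// ltW.
  have wM : v w <= q ^+ n * M.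
    rewrite -(ler_pM2l q0) -absvM -xw mulrA -exprS; apply: absvB_le => //.
    apply: (le_trans yM); rewrite ler_peMl//; first by move: M1; lra.
    by rewrite exprn_ege1// ltW.
  have -> : x = y + emb a * w by rewrite -xw addrC subrK.
  apply: spanD; first by apply: span_mem; apply/(mem_pts dL).
  by apply: spanZ => //; exact: IH.
move=> x Lx; have [n xn] := exists_pow_a (v x).
apply: (key n) => //; apply: (le_trans (ltW xn)).
by rewrite ler_peMr// exprn_ge0// ltW.
Qed.

Lemma dim_gt0 : (0 < D)%N.
Proof.
rewrite lt0n; apply/negP => /eqP D0.
have [|p [[i pi] pE]] := @dimD unit unit (fun _ _ => 1).
  by rewrite D0 muln0 card_unit.
case: i pi => pi; have := pE tt; rewrite (big_pred1 tt) => [|[]//].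
by rewrite mulr1 => /(ev_eq0 a_pole)/eqP; rewrite (negPf pi).
Qed.

(** The products of n elements independent over F with the D elements of a basis
    over k(a) are n D elements independent over k[a]. *)
Lemma ev_rank_has_rank r (L : set C) : is_submodule infty emb L ->
  ev_rank_le emb a (r * D) L -> exists2 n, (n <= r)%N & has_rank emb L n.
Proof.
move=> sL rk; have [c [Ac c0 cf]] := regular_common_denom f Aa a_pole.
have D0 := dim_gt0.
pose indep n := exists x : 'I_n -> C, (forall i, L (x i)) /\
  forall b : 'I_n -> F, \sum_i emb (b i) * x i = 0 -> forall i, b i = 0.
have ub n : `[< indep n >] -> (n <= r)%N.
  move=> /asboolP[x [Lx xi]]; rewrite leqNgt; apply/negP => rn.
  have [||p [[[i j] pij] pE]] := @rk ('I_n * 'I_D)%type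
      (fun ij => emb (c * f ij.2) * x ij.1).
  - by move=> [i j]; exact: (submoduleZ sL).
  - by rewrite card_prod !card_ord ltn_pmul2r.
  have : \sum_i emb (\sum_j ev a (p (i, j)) * (c * f j)) * x i = 0.
    rewrite -[RHS]pE; under eq_bigr do rewrite rmorph_sum mulr_suml.
    rewrite pair_bigA/=; apply: eq_bigr => -[i' j'] _ /=.
    by rewrite rmorphM mulrA.
  move=> /xi/(_ i) E; have : \sum_j' ev a (p (i, j')) * f j' = 0.
    apply: (mulfI c0); rewrite mulr0 -[RHS]E mulr_sumr.
    by apply: eq_bigr => j' _; rewrite mulrCA.
  by move=> /fP/(_ j)/eqP; rewrite (negPf pij).
have ex0 : exists n, `[< indep n >].
  by exists 0%N; apply/asboolP; exists (fun=> 0); split=> [[]|b _ []].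
case: (ex_maxnP ex0 ub) => n /asboolP[x [Lx xi]] nmax.
exists n; first by apply: ub; apply/asboolP; exists x.
exists x; split=> // y Ly; apply: contrapT => ny.
suff /asboolP/nmax : indep n.+1 by rewrite ltnn.
exists (fun i => if unlift ord0 i is Some j then x j else y); split.
  by move=> i; case: unliftP.
move=> b; rewrite big_ord_recl unlift_none.
under eq_bigr do rewrite liftK.
have [b0|b0] := eqVneq (b ord0) 0.
  rewrite b0 rmorph0 mul0r add0r => /xi E i.
  by case: (unliftP ord0 i) => [j|] ->.
move=> E; case: ny; exists (fun j => - (b ord0)^-1 * b (lift ord0 j)).
have eb0 : emb (b ord0) != 0 by rewrite fmorph_eq0.
apply: (mulfI eb0); rewrite mulr_sumr.
apply/eqP; rewrite -subr_eq0 -[X in _ == X]E -sumrN; apply/eqP; congr (_ + _).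
apply: eq_bigr => j _; rewrite rmorphM rmorphN fmorphV; field; exact: eb0.
Qed.

End Modules.

(** * Level structures as modules of pairs *)

Section Quotients.
Variables (V : zmodType) (M L : set V).
Hypotheses (L0 : L 0) (LB : forall x y, L x -> L y -> L (x - y)).
Hypotheses (LM : L `<=` M) (MD : forall x y, M x -> M y -> M (x + y)).
Implicit Types X Y : quotient M L.

Let LN x : L x -> L (- x).
Proof. by move=> Lx; rewrite -sub0r; exact: LB. Qed.

Lemma quotient_nonempty X : exists x, coset X x.
Proof. by case: (cosetP X) => m Mm ->; exists (m + 0); exists 0. Qed.

Lemma quotient_sub X x y : coset X x -> coset X y -> L (x - y).
Proof.
case: (cosetP X) => m Mm -> [l Ll <-] [l' Ll' <-].
by rewrite opprD addrACA subrr add0r; exact: LB.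
Qed.

Lemma quotient_shift X x y : coset X x -> L (y - x) -> coset X y.
Proof.
case: (cosetP X) => m Mm -> [l Ll <-] yx; exists (y - m); last by rewrite addrC subrK.
have -> : y - m = (y - (m + l)) - (- l) by rewrite opprK opprD addrA subrK.
by apply: LB => //; exact: LN.
Qed.

Lemma quotient_dom X x : coset X x -> M x.
Proof. by case: (cosetP X) => m Mm -> [l Ll <-]; apply: MD => //; exact: LM. Qed.

Lemma quotient_eq X Y x : coset X x -> coset Y x -> X = Y.
Proof.
move=> Xx Yx; have E : coset X = coset Y.
  apply/seteqP; split=> y.
    by move=> Xy; apply: (quotient_shift Yx); exact: (quotient_sub Xy Xx).
  by move=> Yy; apply: (quotient_shift Xx); exact: (quotient_sub Yy Yx).
clear Xx Yx; case: X Y E => X pX [Y pY] /= E.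
by case: _ / E pY => pY; congr Defs.Quotient; exact: Prop_irrelevance.
Qed.

Lemma exists_quotient m : M m -> exists X : quotient M L, coset X m.
Proof.
move=> Mm; have p : exists2 m', M m' & [set m + l | l in L] = [set m' + l | l in L].
  by exists m.
by exists (Defs.Quotient p); exists 0; rewrite ?addr0.
Qed.

End Quotients.

Section Levels.
Variables (R : realType) (k : finFieldType) (F : fieldExtType {fraction {poly k}}).
Variables (infty : place F).
Variables (C : fieldType) (v : absolute_value R C) (emb : {rmorphism F -> C}).
Variables (N : set F) (r : nat).
Hypotheses (HN : is_ideal infty N) (HN0 : exists2 x, N x & x != 0).

Local Notation A := (regular infty).
Local Notation Ninv := (inv_ideal infty N).
Local Notation NL L := (Ninv_mul infty emb N L).
Local Notation level := (level_module infty N r).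
Local Notation partial := (partial_level_lattice infty v emb N r).

Let sA : is_subring A := regular_subring infty.

Lemma Ninv_regular x : A x -> Ninv x.
Proof.
move=> Ax y Ny; apply: (subringM sA) => //; by case: HN => sub _ _ _; exact: sub.
Qed.

Lemma NinvD x y : Ninv x -> Ninv y -> Ninv (x + y).
Proof. by move=> Nx Ny n Nn; rewrite mulrDl; apply: (subringD sA); [exact: Nx|exact: Ny]. Qed.

Lemma NinvZ b x : A b -> Ninv x -> Ninv (b * x).
Proof. by move=> Ab Nx n Nn; rewrite -mulrA; apply: (subringM sA) => //; exact: Nx. Qed.

(** A consequence of N N^-1 = A. In this form membership in N^-1 L is stable
    under limits. *)
Lemma Ninv_mulP L : is_submodule infty emb L ->
  forall z, NL L z <-> forall y, N y -> L (emb y * z).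
Proof.
move=> sL z; split=> [[m [x [l [Nx Ll ->]]]] y Ny|H].
  rewrite mulr_sumr; apply: (submodule_sum sL) => i _.
  by rewrite mulrA -rmorphM; apply: (submoduleZ sL) => //; rewrite mulrC; exact: Nx.
have [m [x [y [Nx Ny E]]]] := ideal_inverse HN HN0.
exists m, y, (fun i => emb (x i) * z); split=> // [i|]; first exact: H.
rewrite -[LHS]mul1r -(rmorph1 emb) -E rmorph_sum mulr_suml.
by apply: eq_bigr => i _; rewrite rmorphM mulrA [emb (y i) * _]mulrC.
Qed.

Lemma Ninv_mul_sub L : is_submodule infty emb L -> L `<=` NL L.
Proof.
move=> sL z Lz; apply/(Ninv_mulP sL) => y Ny; apply: (submoduleZ sL) => //.
by case: HN => sub _ _ _; exact: sub.
Qed.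

Lemma Ninv_mul_submodule L : is_submodule infty emb L -> is_submodule infty emb (NL L).
Proof.
move=> sL; split=> [|x y|b x Ab].
- by apply: Ninv_mul_sub => //; exact: (submodule0 sL).
- move=> /(Ninv_mulP sL) Hx /(Ninv_mulP sL) Hy; apply/(Ninv_mulP sL) => n Nn.
  by rewrite mulrDr; apply: (submoduleD sL); [exact: Hx|exact: Hy].
- move=> /(Ninv_mulP sL) Hx; apply/(Ninv_mulP sL) => n Nn.
  by rewrite mulrCA; apply: (submoduleZ sL) => //; exact: Hx.
Qed.

Lemma lattice_submodule (L : lattice infty v emb) : is_submodule infty emb L.
Proof. by have [? ? ? _ _] := latticeP L; split. Qed.

Definition represents (l : level) (c : 'I_r -> F) := forall i : 'I_r, coset (l i) (c i).

Lemma level_repr (l : level) : exists c : 'I_r -> F, represents l c.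
Proof.
have H (i : 'I_r) : exists c, coset (l i) c.
  by apply: quotient_nonempty; exact: subring0 sA.
by have [c cP] := choice H; exists c.
Qed.

Let A0 : A 0 := subring0 sA.
Let AB x y : A x -> A y -> A (x - y). Proof. exact: (subringB sA). Qed.

Lemma level_sub (l : level) c c' : represents l c -> represents l c' ->
  forall i, A (c i - c' i).
Proof. by move=> lc lc' i; have := quotient_sub AB (lc i) (lc' i). Qed.

Lemma level_shift (l : level) c c' : represents l c -> (forall i, A (c' i - c i)) ->
  represents l c'.
Proof. by move=> lc cc' i; apply: (quotient_shift A0 AB (lc i)). Qed.

Lemma level_Ninv (l : level) c : represents l c -> forall i, Ninv (c i).
Proof. by move=> lc i; apply: quotient_dom (lc i); [exact: Ninv_regular|exact: NinvD]. Qed.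

Lemma level_eq (l l' : level) c : represents l c -> represents l' c -> l = l'.
Proof. by move=> lc lc'; apply/ffunP => i; exact: (quotient_eq A0 AB (lc i) (lc' i)). Qed.

Lemma exists_level c : (forall i, Ninv (c i)) -> exists l : level, represents l c.
Proof.
move=> Nc; have H (i : 'I_r) : exists q : quotient Ninv A, coset q (c i).
  exact: (exists_quotient A0).
by have [q qP] := choice H; exists [ffun i => q i] => i; rewrite ffunE.
Qed.

Lemma is_zero_levelP (l : level) c : represents l c ->
  is_zero_level l <-> forall i, A (c i).
Proof.
move=> lc; split=> [l0 i|Ac].
  by rewrite -[c i]subr0; exact: (quotient_sub AB (lc i) (l0 i)).
by move=> i; apply: (quotient_shift A0 AB (lc i)); apply: (AB A0).
Qed.

(** The module of all pairs (z, c) with iota [z] = [c], for a level structure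
    iota of L. It determines iota, and unlike iota it can be constructed without
    choices of representatives. *)
Record level_graph (L : set C) (G : C -> ('I_r -> F) -> Prop) : Prop := LevelGraph {
  graph_Ninv : forall z c, G z c -> forall i, Ninv (c i) ;
  graph_total : forall z, NL L z -> exists c, G z c ;
  graph_dom : forall z c, G z c -> NL L z ;
  graphD : forall z c z' c', G z c -> G z' c' -> G (z + z') (fun i => c i + c' i) ;
  graphZ : forall b z c, A b -> G z c -> G (emb b * z) (fun i => b * c i) ;
  graph_lattice : forall z c, L z -> (forall i, A (c i)) -> G z c ;
  graph_inj : forall z c, G z c -> (forall i, A (c i)) -> L z ;
  graph_zero : forall z c, G z c -> L z -> forall i, A (c i) }.

Section GraphTheory.
Variables (L : set C) (G : C -> ('I_r -> F) -> Prop).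
Hypotheses (sL : is_submodule infty emb L) (HG : level_graph L G).

Lemma graph_congr z c z' c' : G z c -> L (z' - z) -> (forall i, A (c' i - c i)) -> G z' c'.
Proof.
move=> Gz Lz Ac; have := graphD HG Gz (graph_lattice HG Lz Ac).
by rewrite addrC subrK; congr G; apply/funext => i; rewrite addrC subrK.
Qed.

Lemma graphB z c z' c' : G z c -> G z' c' -> G (z - z') (fun i => c i - c' i).
Proof.
move=> Gz Gz'; have AN1 : A (- 1) by exact: (subringN sA (subring1 sA)).
have := graphD HG Gz (graphZ HG AN1 Gz').
rewrite rmorphN rmorph1 mulN1r; congr G.
by apply/funext => i; rewrite mulN1r.
Qed.

Lemma graph_sum (I : Type) (s : seq I) (z : I -> C) (c : I -> 'I_r -> F) :
  (forall i, G (z i) (c i)) -> G (\sum_(i <- s) z i) (fun j => \sum_(i <- s) c i j).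
Proof.
move=> Gzc; elim: s => [|i s IH].
  rewrite big_nil; apply: (graph_lattice HG) => [|j]; first exact: (submodule0 sL).
  by rewrite big_nil; exact: (subring0 sA).
rewrite big_cons.
have -> : (fun j => \sum_(i' <- i :: s) c i' j) = (fun j => c i j + \sum_(i' <- s) c i' j).
  by apply/funext => j; rewrite big_cons.
exact: (graphD HG).
Qed.

Lemma graph_functional z c c' : G z c -> G z c' -> forall i, A (c i - c' i).
Proof.
move=> Gc Gc'; have := graphB Gc Gc'; rewrite subrr => H.
exact: (graph_zero HG H (submodule0 sL)).
Qed.

Lemma graph_injective z z' c c' : G z c -> G z' c' -> (forall i, A (c i - c' i)) -> L (z - z').
Proof. by move=> Gc Gc' H; apply: (graph_inj HG (graphB Gc Gc')). Qed.

End GraphTheory.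

Definition graph (x : partial) z c :=
  exists2 X : torsion infty emb N (plat x), coset X z & represents (plat_iota X) c.

Section GraphOf.
Variable x : partial.
Let L : set C := plat x.
Let sL : is_submodule infty emb L := lattice_submodule (plat x).
Let L0 : L 0 := submodule0 sL.
Let LB y z : L y -> L z -> L (y - z). Proof. exact: (submoduleB sL). Qed.
Let LNL : L `<=` NL L := Ninv_mul_sub sL.
Let NLD y z : NL L y -> NL L z -> NL L (y + z).
Proof. exact: (submoduleD (Ninv_mul_submodule sL)). Qed.

Lemma iota_invP (l : level) c z : represents l c -> iota_inv x l z <-> graph x z c.
Proof.
move=> lc; split=> [[X Xl Xz]|[X Xz Xc]]; first by exists X; rewrite ?Xl.
by exists X => //; exact: level_eq Xc lc.
Qed.

Lemma graphP : level_graph L (graph x).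
Proof.
have zero c : (forall i, A (c i)) -> graph x 0 c.
  move=> Ac; have [X X0] := exists_quotient L0 (submodule0 (Ninv_mul_submodule sL)).
  exists X => //; have [c0 c0P] := level_repr (plat_iota X).
  apply: (level_shift c0P) => i; apply: AB => //.
  have SX : coset_sum X X X.
    move=> u u' Xu Xu'; apply: (quotient_shift L0 LB Xu); rewrite addrC addKr.
    by rewrite -[u']subr0; exact: (quotient_sub LB Xu' X0).
  have := (plat_iota_linear x).1 _ _ _ SX i _ _ (c0P i) (c0P i) => S.
  by have := quotient_sub AB S (c0P i); rewrite addrK.
split.
- by move=> z c [X Xz Xc]; exact: level_Ninv Xc.
- move=> z NLz; have [X Xz] := exists_quotient L0 NLz.
  by have [c cP] := level_repr (plat_iota X); exists c; exists X.
- by move=> z c [X Xz _]; exact: (quotient_dom LNL NLD Xz).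
- move=> z c z' c' [X Xz Xc] [X' Xz' Xc'].
  have Nz : NL L (z + z').
    by apply: NLD; [exact: (quotient_dom LNL NLD Xz)|exact: (quotient_dom LNL NLD Xz')].
  have [Y Yz] := exists_quotient L0 Nz; exists Y => //.
  move=> i; apply: ((plat_iota_linear x).1 _ _ _ _ i) => //.
  move=> u u' Xu Xu'; apply: (quotient_shift L0 LB Yz); rewrite opprD addrACA.
  by apply: (submoduleD sL); [exact: quotient_sub Xu Xz|exact: quotient_sub Xu' Xz'].
- move=> b z c Ab [X Xz Xc].
  have Nz : NL L (emb b * z).
    by apply: (submoduleZ (Ninv_mul_submodule sL)) => //; exact: (quotient_dom LNL NLD Xz).
  have [Y Yz] := exists_quotient L0 Nz; exists Y => //.
  move=> i; apply: ((plat_iota_linear x).2 b X Y) => // u Xu.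
  apply: (quotient_shift L0 LB Yz); rewrite -mulrBr; apply: (submoduleZ sL) => //.
  exact: quotient_sub Xu Xz.
- move=> z c Lz /zero [X X0 Xc]; exists X => //.
  by apply: (quotient_shift L0 LB X0); rewrite subr0.
- move=> z c [X Xz Xc] Ac; have [X' X0 X'c] := zero _ Ac.
  have E : X = X' by apply: plat_iota_inj; exact: level_eq Xc X'c.
  by rewrite -[z]subr0; apply: (quotient_sub LB Xz); rewrite E.
- move=> z c [X Xz Xc] Lz i; have [X' X0 X'c] := zero (fun=> 0) (fun=> A0).
  have E : X = X'.
    by apply: quotient_eq X0 => //; apply: (quotient_shift L0 LB Xz); rewrite sub0r -[- z]sub0r; apply: LB.
  rewrite E in Xc; rewrite -[c i]subr0; exact: (level_sub Xc X'c).
Qed.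

Hypothesis HC : complete_space (metrized v).
Let dL : discrete_subgroup v L.
Proof. by case: (lattice_discrete_module (latticeP (plat x))). Qed.

Lemma muE (l : level) c z : represents l c -> graph x z c -> ~ (forall i, A (c i)) ->
  mu x l = (exp_lattice v L z)^-1.
Proof.
move=> lc Gz nc; rewrite /mu; case: asboolP => [[[y ly] _]|]; last first.
  by case; split; [exists z; apply/(iota_invP z lc)|move/(is_zero_levelP lc)].
have := xgetPex 0 (ex_intro _ y ly).
move: (xget _ _) => w /(iota_invP _ lc) Gw.
congr (_^-1); apply: (exp_lattice_coset HC dL).
apply: (graph_injective graphP Gw Gz) => i.
by rewrite subrr.
Qed.

Lemma mu_neq0 (l : level) c : represents l c -> mu x l != 0 ->
  exists2 z, graph x z c & ~ (forall i, A (c i)) /\ mu x l = (exp_lattice v L z)^-1.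
Proof.
move=> lc; rewrite /mu; case: asboolP => [[ne nz] _|]; last by rewrite eqxx.
have := xgetPex 0 ne; move: (xget _ _) => w /(iota_invP _ lc) Gw.
by exists w => //; split=> // /(is_zero_levelP lc).
Qed.

End GraphOf.

(** Conversely, each such module of pairs comes from a level structure. *)
Lemma exists_partial_level (L : lattice infty v emb) G n :
  (n <= r)%N -> has_rank emb L n -> level_graph L G ->
  exists2 x : partial, plat x = L & forall z c, graph x z c <-> G z c.
Proof.
move=> nr rkL HG.
have sL : is_submodule infty emb L := lattice_submodule L.
have L0 : (L : set C) 0 := submodule0 sL.
have LB y z : (L : set C) y -> (L : set C) z -> (L : set C) (y - z) by exact: (submoduleB sL).
have sNL := Ninv_mul_submodule sL.
have LNL : L `<=` NL L := Ninv_mul_sub sL.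
have NLD y z : NL L y -> NL L z -> NL L (y + z) by exact: (submoduleD sNL).
have H (X : torsion infty emb N L) : exists l : level,
    forall z c, coset X z -> (G z c <-> represents l c).
  have [z Xz] := quotient_nonempty L0 X.
  have [c Gc] := graph_total HG (quotient_dom LNL NLD Xz).
  have [l lc] := exists_level (graph_Ninv HG Gc).
  exists l => z' c' Xz'; have Lz := quotient_sub LB Xz' Xz; split.
    move=> Gz'; apply: (level_shift lc) => i.
    apply: (graph_functional sL HG Gz'); apply: (graph_congr HG Gc Lz) => j.
    by rewrite subrr.
  by move=> lc'; apply: (graph_congr HG Gc Lz) => i; exact: (level_sub lc' lc).
have [f fP] := choice H.
have lin : linear_to_level f.
  split=> [X Y Z XYZ i u u' Xu Yu'|b X Y Ab XY i u Xu].
    have [z Xz] := quotient_nonempty L0 X; have [z' Yz'] := quotient_nonempty L0 Y.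
    have [c Gc] := graph_total HG (quotient_dom LNL NLD Xz).
    have [c' Gc'] := graph_total HG (quotient_dom LNL NLD Yz').
    have /(fP _ _ _ (XYZ _ _ Xz Yz')) rep := graphD HG Gc Gc'.
    apply: (quotient_shift A0 AB (rep i)); rewrite opprD addrACA.
    apply: (subringD sA).
      by apply: (quotient_sub AB Xu); exact: (fP _ _ _ Xz).1.
    by apply: (quotient_sub AB Yu'); exact: (fP _ _ _ Yz').1.
  have [z Xz] := quotient_nonempty L0 X.
  have [c Gc] := graph_total HG (quotient_dom LNL NLD Xz).
  have /(fP _ _ _ (XY _ Xz)) rep := graphZ HG Ab Gc.
  apply: (quotient_shift A0 AB (rep i)); rewrite -mulrBr; apply: (subringM sA) => //.
  by apply: (quotient_sub AB Xu); exact: (fP _ _ _ Xz).1.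
have inj : injective f.
  move=> X Y XY; have [z Xz] := quotient_nonempty L0 X.
  have [z' Yz'] := quotient_nonempty L0 Y.
  have [c Gc] := graph_total HG (quotient_dom LNL NLD Xz).
  have Gc' : G z' c by apply/(fP _ _ _ Yz'); rewrite -XY; apply/(fP _ _ _ Xz).
  apply: (quotient_eq L0 LB Xz (Y := Y)); apply: (quotient_shift L0 LB Yz').
  by apply: (graph_injective HG Gc Gc') => i; rewrite subrr.
exists (@PartialLevelLattice R F infty C v emb N r L (ex_intro2 _ _ n nr rkL) f lin inj) => //.
move=> z c; split=> [[X Xz Xc]|Gz]; first exact/(fP _ _ _ Xz).
have [X Xz] := exists_quotient L0 (graph_dom HG Gz).
by exists X => //; apply/(fP _ _ _ Xz).
Qed.

End Levels.

(** * Completeness *)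

(** Choose x n such that the ball of radius 1 / (n + 1) about x n belongs to G.
    *)
Lemma cauchy_filter_sequence (R : realType) (T : pseudoMetricType R) (G : set_system T) :
  ProperFilter G -> cauchy G -> exists x : nat -> T,
    (forall e, 0 < e -> exists n0, forall n m, (n0 <= n)%N -> (n0 <= m)%N ->
       ball (x n) e (x m)) /\
    (forall y, (forall e, 0 < e -> exists n0, forall n, (n0 <= n)%N -> ball (x n) e y) ->
       G --> y).
Proof.
move=> PG /cauchyP cG.
have H (n : nat) : exists x, G (ball x (n.+1%:R^-1 : R)) by apply: cG; rewrite invr_gt0 ltr0n.
have [x xP] := choice H.
have small (e : R) : 0 < e -> exists n0, forall n : nat, (n0 <= n)%N -> n.+1%:R^-1 <= e / 2.
  move=> e0; have e2 : 0 < e / 2 by rewrite divr_gt0.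
  exists (Num.truncn (e / 2)^-1) => n nn.
  rewrite -[e / 2]invrK lef_pV2 ?posrE ?invr_gt0 ?ltr0n//; apply: ltW.
  by apply: (lt_le_trans (truncnS_gt _)); rewrite ler_nat ltnS.
exists x; split=> [e e0|y xy].
  have [n0 n0P] := small e e0; exists n0 => n m nn mm.
  have [z [xz yz]] := filter_ex (filterI (xP n) (xP m)).
  apply: (@ball_splitl _ _ z); first by apply: (le_ball (n0P _ nn)); exact: xz.
  by apply: (le_ball (n0P _ mm)); exact: yz.
apply/fcvg_ballP => e e0; have [n0 n0P] := small e e0.
have [n1 n1P] := xy (e / 2) (divr_gt0 e0 (ltr0n _ 2)).
near=> z; have xz : ball (x (maxn n0 n1)) ((maxn n0 n1).+1%:R^-1) z by near: z; exact: xP.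
apply: (@ball_splitr _ _ (x (maxn n0 n1))); first by apply: n1P; exact: leq_maxr.
by apply: le_ball xz; apply: n0P; exact: leq_maxl.
Unshelve. all: by end_near. Qed.

Lemma exists_ge4 n1 n2 n3 n4 : exists n : nat,
  [/\ (n1 <= n)%N, (n2 <= n)%N, (n3 <= n)%N & (n4 <= n)%N].
Proof. by exists (n1 + n2 + n3 + n4)%N; split; lia. Qed.

Section Completeness.
Variables (R : realType) (k : finFieldType) (F : fieldExtType {fraction {poly k}}).
Variables (infty : place F) (delta : nat).
Hypothesis Hdelta : has_degree infty delta.
Variables (C : fieldType) (v : absolute_value R C) (emb : {rmorphism F -> C}).
Hypothesis HC : complete_space (metrized v).
Hypothesis Hv : forall x, v (emb x) = place_abs R infty delta x.
Hypothesis Hroot : forall (m : nat) (x : F), (0 < m)%N -> exists c, c ^+ m = emb x.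
Variables (N : set F) (r : nat).
Hypotheses (HN : is_ideal infty N) (HN0 : exists2 x, N x & x != 0).
Local Notation A := (regular infty).
Local Notation NL L := (Ninv_mul infty emb N L).
Local Notation level := (level_module infty N r).
Local Notation partial := (partial_level_lattice infty v emb N r).

Lemma dist_bound (x y : partial) eps : (dist x y <= eps%:E)%E ->
  (forall z, v z <= 1 -> v (exp_lattice v (plat x) z - exp_lattice v (plat y) z) <= eps) /\
  (forall X : set level, finite_set X -> \sum_(l \in X) v (mu x l - mu y l) <= eps).
Proof.
move=> xy; have p1 : (0 <= dist_lattice v (plat x) (plat y))%E.
  rewrite -(dist_latticexx v (plat x)); apply: (@le_trans _ _ (v (exp_lattice v (plat x) 0 - exp_lattice v (plat y) 0))%:E).
    by rewrite dist_latticexx lee_fin absv_ge0.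
  by apply: ereal_sup_ubound; exists 0 => //=; rewrite absv0 ler01.
have p2 : (0 <= \esum_(l in [set: level]) (v (mu x l - mu y l))%:E)%E.
  by apply: esum_ge0 => l _; rewrite lee_fin absv_ge0.
split=> [z z1|X Xfin].
  rewrite -lee_fin; apply: le_trans xy; apply: (@le_trans _ _ (dist_lattice v (plat x) (plat y))).
    by apply: ereal_sup_ubound; exists z.
  by rewrite /dist leeDl.
rewrite -lee_fin; apply: le_trans xy.
apply: (@le_trans _ _ (\esum_(l in [set: level]) (v (mu x l - mu y l))%:E)%E); last first.
  by rewrite /dist leeDr.
apply: ereal_sup_ubound; exists X; first by split.
by rewrite fsumEFin.
Qed.

Lemma dist_le (x y : partial) e1 e2 :
  (forall z, v z <= 1 -> v (exp_lattice v (plat x) z - exp_lattice v (plat y) z) <= e1) ->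
  (forall X : set level, finite_set X -> \sum_(l \in X) v (mu x l - mu y l) <= e2) ->
  (dist x y <= (e1 + e2)%:E)%E.
Proof.
move=> H1 H2; rewrite /dist EFinD; apply: leeD.
  by apply: ge_ereal_sup => _ [z z1 <-]; rewrite lee_fin; exact: H1.
apply: ge_ereal_sup => _ [X [Xfin _] <-]; rewrite fsumEFin// lee_fin; exact: H2.
Qed.

Variable a : F.
Hypotheses (Na : N a) (a_pole : infty a < 0).
Let Aa : A a. Proof. by case: HN => sub _ _ _; exact: sub. Qed.
Variables (D : nat) (f : 'I_D -> F).
Hypothesis fP : forall p : 'I_D -> {poly k}, \sum_i ev a (p i) * f i = 0 ->
     forall i, p i = 0.
Hypothesis dimD : forall (L I : finType) (x : I -> L -> F), (#|L| * D < #|I|)%N ->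
     dependent a x.

Lemma plat_module (x : partial) : discrete_module infty v emb (plat x).
Proof. exact: lattice_discrete_module (latticeP _). Qed.

Lemma plat_ev_rank (x : partial) : ev_rank_le emb a (r * D) (plat x).
Proof.
have [n nr rk] := plat_rank x.
apply: (@ev_rank_leW _ _ _ _ _ (n * D)); first by rewrite leq_mul2r nr orbT.
exact: has_rank_ev_rank rk.
Qed.

Section Sequence.
Variable x : nat -> partial.
Local Notation L n := (plat (x n) : set C).
Local Notation e n := (exp_lattice v (L n)).
Variable rho : R.
Hypotheses (rho0 : 0 < rho) (rho1 : rho <= 1).
Hypothesis Hrho : forall n mu, L n mu -> mu != 0 -> rho <= v mu.
Hypothesis Hcau : forall eps, 0 < eps -> exists n0, forall n m, (n0 <= n)%N -> (n0 <= m)%N ->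
  (dist (x n) (x m) <= eps%:E)%E.

Let HM n : discrete_module infty v emb (L n) := plat_module (x n).
Let Hrk n : ev_rank_le emb a (r * D) (L n) := @plat_ev_rank (x n).
Let dL n : discrete_subgroup v (L n). Proof. by case: (HM n). Qed.
Let sL n : is_submodule infty emb (L n). Proof. by case: (HM n). Qed.
Let HG n : level_graph infty emb N (L n) (graph (x n)) := graphP HN HN0 (x n).

Lemma seq_exp_cauchy : exp_cauchy v (fun n => L n) 1.
Proof.
move=> eps e0; have [n0 n0P] := Hcau e0; exists n0 => n m nn mm z z1.
exact: (dist_bound (n0P _ _ nn mm)).1.
Qed.

Lemma mu_cauchy eps : 0 < eps -> exists n0, forall n m, (n0 <= n)%N -> (n0 <= m)%N ->
  forall l, v (mu (x n) l - mu (x m) l) <= eps.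
Proof.
move=> e0; have [n0 n0P] := Hcau e0; exists n0 => n m nn mm l.
have := (dist_bound (n0P _ _ nn mm)).2 [set l] (finite_set1 l).
by rewrite fsbig_set1.
Qed.

Let LL := limset v (fun n => L n).
Local Notation E := (exp_lattice v LL).

Let HMl : discrete_module infty v emb LL :=
  limset_module Hdelta HC Hv Aa a_pole HM Hrk rho0 rho1 Hrho seq_exp_cauchy.
Let dLl : discrete_subgroup v LL. Proof. by case: HMl. Qed.
Let sLl : is_submodule infty emb LL. Proof. by case: HMl. Qed.

Let exp_cvg z : cvgv v (fun n => e n z) (E z) :=
  exp_limset_cvg Hdelta HC Hv Aa a_pole HM Hrk rho0 rho1 Hrho seq_exp_cauchy z.

Lemma limit_lattice : exists2 n, (n <= r)%N & has_rank emb LL n.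
Proof.
apply: (ev_rank_has_rank Aa a_pole fP dimD sLl).
exact: (limset_ev_rank Hdelta HC Hv Aa a_pole HM Hrk rho0 rho1 Hrho seq_exp_cauchy).
Qed.

Lemma limit_is_lattice : is_lattice infty v emb LL.
Proof.
split; [exact: (submodule0 sLl)|exact: (submoduleD sLl)|exact: (submoduleZ sLl)| |].
  apply: (discrete_module_fg Hdelta Hv Aa a_pole HMl).
  exact: (limset_ev_rank Hdelta HC Hv Aa a_pole HM Hrk rho0 rho1 Hrho seq_exp_cauchy).
by move=> M; apply: (dsg_finite dLl).
Qed.

Let qa := v (emb a).
Let qa1 : 1 < qa. Proof. exact: (absv_a_gt1 Hdelta Hv a_pole). Qed.
Let qa0 : 0 < qa. Proof. exact: lt_trans qa1. Qed.
Let rq0 : 0 < rho / qa. Proof. exact: divr_gt0. Qed.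
Let rq1 : rho / qa < rho. Proof. by rewrite ltr_pdivrMr// ltr_pMr. Qed.

(** Points of N^-1 (L n) become points of L n when they are multiplied by a. *)
Lemma torsion_sep n z z' : NL (L n) z -> NL (L n) z' -> v (z - z') < rho / qa -> z = z'.
Proof.
move=> /(Ninv_mulP HN HN0 (sL n)) Hz /(Ninv_mulP HN HN0 (sL n)) Hz' zz'.
have ea : emb a != 0 by exact: emb_a_neq0 a_pole.
apply: (mulfI ea); apply: (seq_sep HM Hrho (Hz _ Na) (Hz' _ Na)).
by rewrite -mulrBr absvM mulrC -ltr_pdivlMr.
Qed.

(** e_n preserves the norms of the small vectors s n - z. *)
Lemma exp_seq_cvg s z : cvgv v s z -> cvgv v (fun n => e n (s n)) (E z).
Proof.
move=> sz eps e0; have m0 : 0 < Num.min eps (rho / qa) by rewrite lt_min e0.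
have [n0 n0P] := exp_cvg z e0; have [n1 n1P] := sz _ m0.
exists (maxn n0 n1) => n; rewrite geq_max => /andP[nn0 nn1].
apply: (@absvB_trans _ _ _ (e n z)); last exact: n0P.
have := n1P _ nn1; rewrite le_min => /andP[s1 s2].
rewrite -(exp_latticeB HC (dL n)) (exp_iso HC HM Hrho)//.
exact: le_lt_trans rq1.
Qed.

(** The level module is discrete, so that the classes of c have to be eventually
    constant along the sequence. *)
Definition limit_graph z c := exists s, [/\ forall n, NL (L n) (s n), cvgv v s z &
  exists n0, forall n, (n0 <= n)%N -> graph (x n) (s n) c].

Lemma limit_graph_intro s z c n0 : cvgv v s z ->
  (forall n, (n0 <= n)%N -> graph (x n) (s n) c) -> limit_graph z c.
Proof.
move=> sz sc; exists (fun n => if (n0 <= n)%N then s n else 0); split.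
- move=> n; case: ifP => [nn|_]; first exact: (graph_dom (HG n) (sc n nn)).
  exact: (submodule0 (Ninv_mul_submodule HN HN0 (sL n))).
- by apply: (@cvgv_eq _ _ _ n0 s) => // n nn; rewrite nn.
- by exists n0 => n nn; rewrite nn; exact: sc.
Qed.

Lemma limit_graph_dom z c : limit_graph z c -> NL LL z.
Proof.
move=> [s [Ns sz _]]; apply/(Ninv_mulP HN HN0 sLl) => y Ny.
exists (fun n => emb y * s n); split; last exact: cvgvMl.
by move=> n; move: (Ns n) => /(Ninv_mulP HN HN0 (sL n)); apply.
Qed.

(** If z is in the limit lattice then by [torsion_sep] the s n are eventually
    equal to the lattice points that converge to z. *)
Lemma limit_graph_inj z c : limit_graph z c -> LL z <-> forall i, A (c i).
Proof.
move=> [s [Ns sz [n0 n0P]]]; split=> [[s' [Ls' sz']]|Ac].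
  have [n1 n1P] := sz _ (divr_gt0 rq0 (ltr0n _ 2)).
  have [n2 n2P] := sz' _ (divr_gt0 rq0 (ltr0n _ 2)).
  have [n [n0n n1n n2n _]] := exists_ge4 n0 n1 n2 0.
  have E : s n = s' n.
    apply: (torsion_sep (n := n)) => //.
      by apply: (Ninv_mul_sub HN HN0 (sL n)); exact: Ls'.
    apply: (@le_lt_trans _ _ (rho / qa / 2)); last by move: rq0; lra.
    apply: (@absvB_trans _ _ _ z); first exact: n1P.
    by rewrite absv_distC; exact: n2P.
  have Gn : graph (x n) (s n) c by exact: n0P.
  by apply: (graph_zero (HG n) Gn); rewrite E; exact: Ls'.
exists (fun n => if (n0 <= n)%N then s n else 0); split.
  move=> n; case: ifP => [nn|_]; last exact: submodule0 (sL n).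
  exact: (graph_inj (HG n) (n0P _ nn)).
by apply: (@cvgv_eq _ _ _ n0 s) => // n nn; rewrite nn.
Qed.

Lemma mu_graph n (l : level) c z : represents l c -> graph (x n) z c -> ~ (forall i, A (c i)) ->
  mu (x n) l = (e n z)^-1.
Proof. exact: muE. Qed.

(** Points of N^-1 (L n) whose exponentials are close differ by a point of L n.
    *)
Lemma exp_near_eq n y z c : graph (x n) y c -> NL (L n) z -> v (e n y - e n z) < rho / qa ->
  graph (x n) z c.
Proof.
move=> Gy Nz; rewrite -(exp_latticeB HC (dL n)).
have [l Ll yz] := exp_lattice_near HC (dL n) (y - z) => yz'.
have E : y = z + l.
  apply: (torsion_sep (n := n)); [exact: graph_dom (HG n) _ _ Gy| |].
    apply: (submoduleD (Ninv_mul_submodule HN HN0 (sL n))) => //.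
    exact: (Ninv_mul_sub HN HN0 (sL n)).
  by rewrite opprD addrA; exact: le_lt_trans yz yz'.
apply: (graph_congr (HG n) Gy) => [|i]; last by rewrite subrr; exact: subring0 (regular_subring infty).
by rewrite E opprD addNKr; exact: (submoduleN (sL n)).
Qed.

(** Let c be such that iota_n [s n] = [c] for one large n. Since mu is Cauchy
    and 1 / e_n (s n) tends to 1 / e z, which is not 0, mu_m [c] is different
    from 0 for all large m; it is the inverse of the exponential of a point that
    is close to s m by [exp_near_eq], whence iota_m [s m] = [c]. *)
Lemma limit_graph_total z : NL LL z -> exists c, limit_graph z c.
Proof.
move=> Nz; have [Lz|nLz] := pselect (LL z).
  case: Lz => s [Ls sz]; exists (fun=> 0); apply: (limit_graph_intro (n0 := 0%N) sz) => n _.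
  apply: (graph_lattice (HG n)) => // _;
  exact: subring0 (regular_subring infty).
have [s Ns sz] : exists2 s, (forall n, NL (L n) (s n)) & cvgv v s z.
  case: Nz => m [y [l [Ny LLl ->]]].
  have H (i : 'I_m) : exists t : nat -> C, (forall n, L n (t n)) /\ cvgv v t (l i) by exact: LLl.
  have [t tP] := choice H.
  exists (fun n => \sum_i emb (y i) * t i n).
    by move=> n; exists m, y, (t^~ n); split=> // i; exact: (tP i).1.
  by apply: cvgv_sum => i _; apply: cvgvMl; exact: (tP i).2.
have Ez0 : E z != 0 by apply/eqP => /(exp_lattice_eq0 HC dLl).
have vE : 0 < v (E z) by rewrite absv_gt0.
have es := exp_seq_cvg sz.
have [n1 n1P] := cvgv_norm es Ez0.
(* the first bound makes mu non-zero, the second one is for exp_near_eq *)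
have eps0 : 0 < Num.min ((v (E z))^-1 / 2) (rho / qa / 2 / (v (E z) * v (E z))).
  rewrite lt_min !divr_gt0// ?mulr_gt0// invr_gt0//.
move: eps0; set eps := Num.min _ _ => eps0.
have eps1 : eps < (v (E z))^-1.
  have := ge_min ((v (E z))^-1 / 2) ((v (E z))^-1 / 2) (rho / qa / 2 / (v (E z) * v (E z))).
  rewrite lexx => /= le1; apply: (le_lt_trans le1).
  by rewrite ltr_pdivrMr// ltr_pMr ?invr_gt0// ltr1n.
have eps2 : eps * (v (E z) * v (E z)) < rho / qa.
  have := ge_min (rho / qa / 2 / (v (E z) * v (E z))) ((v (E z))^-1 / 2) (rho / qa / 2 / (v (E z) * v (E z))).
  rewrite lexx orbT -/eps ler_pdivlMr ?mulr_gt0// => le1; apply: (le_lt_trans le1).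
  by rewrite ltr_pdivrMr// ltr_pMr// ltr1n.
have [n2 n2P] := mu_cauchy eps0.
have [n3 n3P] := cvgvV es Ez0 eps0.
have [n0 [n10 n20 n30 _]] := exists_ge4 n1 n2 n3 0.
have [c Gc] := graph_total (HG n0) (Ns n0).
have [l lc] := exists_level (graph_Ninv (HG n0) Gc).
have inL n : (n1 <= n)%N -> ~ L n (s n).
  move=> nn /(exp_lattice_eq0 HC (dL n)) e0.
  by move: (n1P _ nn); rewrite e0 absv0 => /eqP; rewrite eq_sym absv_eq0 (negPf Ez0).
have nAc : ~ forall i, A (c i).
  move=> Ac; apply: (inL n0) => //.
  exact: (graph_inj (HG n0) Gc).
have mu0 := mu_graph lc Gc nAc.
exists c; apply: (limit_graph_intro (n0 := n0) sz) => n nn.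
have [n1n n2n n3n] : [/\ (n1 <= n)%N, (n2 <= n)%N & (n3 <= n)%N].
  by split; [exact: leq_trans nn|exact: leq_trans nn|exact: leq_trans nn].
have muz : v (mu (x n) l - (E z)^-1) <= eps.
  apply: (@absvB_trans _ _ _ (mu (x n0) l)); first exact: n2P.
  by rewrite mu0; exact: n3P.
have vmu : v (mu (x n) l) = (v (E z))^-1.
  by rewrite -absvV; apply: absv_eq_near; rewrite absvV; exact: le_lt_trans muz eps1.
have mun : mu (x n) l != 0 by rewrite -(absv_gt0 v) vmu invr_gt0.
have [y Gy [_ muy]] := mu_neq0 lc mun.
have en0 : e n (s n) != 0 by rewrite -(absv_gt0 v) n1P.
have ey0 : e n y != 0 by rewrite -invr_eq0 -muy.
apply: (exp_near_eq Gy (Ns n)).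
have -> : e n y - e n (s n) = - ((e n y)^-1 - (e n (s n))^-1) * (e n y * e n (s n)).
  by field; rewrite en0.
have vey : v (e n y) = v (E z) by rewrite -[LHS]invrK -absvV -muy vmu invrK.
rewrite absvM absvN absvM vey n1P//.
apply: le_lt_trans eps2; apply: ler_wpM2r; first by rewrite mulr_ge0 ?absv_ge0.
rewrite -muy; apply: (@absvB_trans _ _ _ (E z)^-1) => //.
by rewrite absv_distC; exact: n3P.
Qed.

Lemma limit_level_graph : level_graph infty emb N LL limit_graph.
Proof.
split.
- move=> z c [s [_ _ [n0 n0P]]]; exact: (graph_Ninv (HG n0) (n0P _ (leqnn _))).
- exact: limit_graph_total.
- exact: limit_graph_dom.
- move=> z c z' c' [s [_ sz [n0 n0P]]] [s' [_ sz' [n1 n1P]]].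
  apply: (limit_graph_intro (n0 := maxn n0 n1) (cvgvD sz sz')) => n.
  rewrite geq_max => /andP[nn0 nn1]; apply: (graphD (HG n)); [exact: n0P|exact: n1P].
- move=> b z c Ab [s [_ sz [n0 n0P]]].
  apply: (limit_graph_intro (n0 := n0) (cvgvMl (emb b) sz)) => n nn.
  by apply: (graphZ (HG n)) => //; exact: n0P.
- move=> z c [s [Ls sz]] Ac; apply: (limit_graph_intro (n0 := 0%N) sz) => n _.
  by apply: (graph_lattice (HG n)) => //; exact: Ls.
- by move=> z c /limit_graph_inj ->.
- by move=> z c /limit_graph_inj ->.
Qed.

Lemma limit_graph_mu z c (l : level) : represents l c -> limit_graph z c ->
  ~ (forall i, A (c i)) -> cvgv v (fun n => mu (x n) l) (E z)^-1.
Proof.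
move=> lc Gz nAc; have nLz : ~ LL z by move/(limit_graph_inj Gz).
have Ez0 : E z != 0 by apply/eqP => /(exp_lattice_eq0 HC dLl).
case: Gz => s [_ sz [n0 n0P]].
apply: (@cvgv_eq _ _ _ n0) (cvgvV (exp_seq_cvg sz) Ez0) => n nn.
by rewrite (mu_graph lc (n0P _ nn)).
Qed.

Lemma limit_graph_approx eps w : 0 < eps -> exists n0, forall n, (n0 <= n)%N ->
  NL LL w -> exists s c, [/\ graph (x n) s c, limit_graph w c & v (s - w) <= eps].
Proof.
move=> e0; have [Nw|nNw] := pselect (NL LL w); last by exists 0%N.
have [c Gw] := limit_graph_total Nw; have [s [_ sw [n0 n0P]]] := Gw.
have [n1 n1P] := sw _ e0; exists (maxn n0 n1) => n; rewrite geq_max => /andP[nn0 nn1] _.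
by exists (s n), c; split=> //; [exact: n0P|exact: n1P].
Qed.

(** Otherwise mu_n [c] has a limit m different from 0. Then [c] = iota_n [z] for
    a point z of norm at most 1 / |m|, for all large n, and a z is close to a
    point a u of the limit. As the elements of N z are lattice points, those of
    N u are points of the limit, and iota [u] = [c] by [limit_graph_total],
    which is excluded. *)
Lemma mu_vanish c (l : level) : represents l c -> (forall z, ~ limit_graph z c) ->
  cvgv v (fun n => mu (x n) l) 0.
Proof.
move=> lc nG; have [|m mP] := cauchyv_cvgv HC (u := fun n => mu (x n) l).
  by move=> eps e0; have [n0 n0P] := mu_cauchy e0; exists n0 => n n' nn nn'; exact: n0P.
have [<-//|m0] := eqVneq m 0; exfalso.
have vm : 0 < v m by rewrite absv_gt0.
have [n1 n1P] := cvgv_norm mP m0.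
pose T := (v m)^-1.
have [p [gx [gy [Ngx Ngy E1]]]] := ideal_inverse HN HN0.
(* K bounds generators of N, so that eps-close points have close multiples *)
pose K := 1 + \sum_i v (emb (gx i)).
have K1 : 1 <= K by rewrite lerDl sumr_ge0// => i _; exact: absv_ge0.
have K0 : 0 < K by exact: lt_le_trans K1.
have gK i : v (emb (gx i)) <= K.
  by rewrite /K (bigD1 i)//= addrCA lerDl addr_ge0 ?ler01// sumr_ge0// => j _; exact: absv_ge0.
pose eps := rho / qa / 2 / K / 2.
have eps0 : 0 < eps by rewrite /eps !divr_gt0.
have epsK : eps * K < rho / qa / 2.
  by rewrite /eps mulrAC divfK ?lt0r_neq0// ltr_pdivrMr// ltr_pMr ?divr_gt0// ltr1n.
have epsr : eps < rho / qa / 2 by apply: le_lt_trans epsK; rewrite ler_pMr.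
have [n2 n2P] := near_limset Hdelta HC Hv Aa a_pole HM Hrk rho0 rho1 Hrho seq_exp_cauchy (qa * T) (mulr_gt0 qa0 eps0).
have [n3 n3P] := near_limset Hdelta HC Hv Aa a_pole HM Hrk rho0 rho1 Hrho seq_exp_cauchy (K * T) (divr_gt0 rq0 (ltr0n R 2)).
have [n4 n4P] := @eventually_all _ (pts v LL (qa * T + qa * eps)) (fun w n =>
   NL LL (emb a^-1 * w) -> exists s c, [/\ graph (x n) s c, limit_graph (emb a^-1 * w) c & v (s - emb a^-1 * w) <= eps])
   (fun w _ => @limit_graph_approx eps (emb a^-1 * w) eps0).
have [n [n1n n2n n3n n4n]] := exists_ge4 n1 n2 n3 n4.
have vmu : v (mu (x n) l) = v m by exact: n1P.
have mu0 : mu (x n) l != 0 by rewrite -(absv_gt0 v) vmu.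
have [z0 Gz0 [nAc muz]] := mu_neq0 lc mu0.
have ez : v (e n z0) = T by rewrite /T -vmu muz absvV invrK.
have [l0 Ll0 zl] := exp_lattice_near HC (dL n) z0.
pose z := z0 - l0; rewrite -/z ez in zl.
have Gz : graph (x n) z c.
  apply: (graph_congr (HG n) Gz0) => [|i]; last by rewrite subrr; exact: subring0 (regular_subring infty).
  by rewrite /z addrAC subrr add0r; exact: (submoduleN (sL n)).
have /(Ninv_mulP HN HN0 (sL n)) Nz := graph_dom (HG n) Gz.
have [|w LLw wz] := n2P n n2n (emb a * z) (Nz _ Na).
  by rewrite absvM ler_pM2l.
have ea : emb a != 0 by exact: emb_a_neq0 a_pole.
pose u := emb a^-1 * w.
have uz : v (z - u) <= eps.
  rewrite -(ler_pM2l qa0) /qa -absvM mulrBr /u fmorphV mulVKf//.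
have wT : v w <= qa * T + qa * eps.
  rewrite -[w](subKr (emb a * z)); apply: absvB_le.
    by rewrite absvM (le_trans (ler_wpM2l (ltW qa0) zl))// lerDl mulr_ge0 ?ltW.
  by rewrite (le_trans wz)// lerDr mulr_ge0 ?invr_ge0 ?absv_ge0// ltW.
have Nu : NL LL u.
  exists p, gy, (fun i => emb (gx i) * u); split=> // [i|]; last first.
    rewrite -[LHS]mul1r -(rmorph1 emb) -E1 rmorph_sum mulr_suml.
    by apply: eq_bigr => i _; rewrite rmorphM mulrA [emb (gy i) * _]mulrC.
  have [|w' LLw' wz'] := n3P n n3n (emb (gx i) * z) (Nz _ (Ngx i)).
    by rewrite absvM ler_pM ?absv_ge0.
  suff -> : emb (gx i) * u = w' by [].
  apply: (mulfI ea); apply: (limset_sep HM Hrho).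
  - rewrite /u mulrCA fmorphV mulVKf//; apply: (submoduleZ sLl) => //.
    by case: HN => sub _ _ _; exact: sub.
  - exact: (submoduleZ sLl).
  rewrite -mulrBr absvM mulrC -ltr_pdivlMr//.
  apply: (@le_lt_trans _ _ (rho / qa / 2)); last by move: rq0; lra.
  apply: (@absvB_trans _ _ _ (emb (gx i) * z)) => //.
  rewrite -mulrBr absvM absv_distC mulrC (le_trans _ (ltW epsK))//.
  by rewrite ler_pM ?absv_ge0.
have [|//|s [c' [Gs Gu su]]] := n4P n n4n w.
  exact/(mem_pts dLl).
have E2 : s = z.
  apply: (torsion_sep (n := n)); [exact: graph_dom (HG n) _ _ Gs|exact: graph_dom (HG n) _ _ Gz|].
  apply: (@le_lt_trans _ _ (rho / qa / 2)); last by move: rq0; lra.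
  apply: (@absvB_trans _ _ _ u); first exact: le_trans su (ltW epsr).
  by rewrite absv_distC; exact: le_trans uz (ltW epsr).
apply: (nG u); apply: (graph_congr limit_level_graph Gu) => [|i].
  by rewrite subrr; exact: submodule0 sLl.
rewrite E2 in Gs; exact: (graph_functional (sL n) (HG n) Gz Gs).
Qed.

Lemma sequence_limit : exists y : partial, forall eps, 0 < eps ->
  exists n0, forall n, (n0 <= n)%N -> (dist (x n) y <= eps%:E)%E.
Proof.
have [n nr rk] := limit_lattice.
have [y yL yG] := @exists_partial_level R k F infty C v emb N r HN HN0 (Lattice limit_is_lattice) _ _ nr rk limit_level_graph.
have mu_cvg (l : level) : cvgv v (fun n => mu (x n) l) (mu y l).
  have [c lc] := level_repr l.
  have [Ac|nAc] := pselect (forall i, A (c i)).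
    have mu0 (y' : partial) : mu y' l = 0.
      apply/eqP; apply: contraT => /(mu_neq0 lc)[_ _ [nAc _]].
      by case: (nAc Ac).
    rewrite mu0; apply: (@cvgv_eq _ _ _ 0%N (fun=> 0)) => [m _|]; first by rewrite mu0.
    exact: cvgv_cst.
  have [[z Gz]|nG] := pselect (exists z, limit_graph z c).
    rewrite (muE HN HN0 HC lc (proj2 (yG _ _) Gz) nAc) yL.
    exact: limit_graph_mu lc Gz nAc.
  have -> : mu y l = 0.
    apply/eqP; apply: contraT => /(mu_neq0 lc)[z Gz _].
    by case: nG; exists z; exact/yG.
  by apply: (mu_vanish lc) => z Gz; apply: nG; exists z.
exists y => eps e0; have e2 : 0 < eps / 2 by rewrite divr_gt0.
have [n0 n0P] := Hcau e2; exists n0 => m mm.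
have -> : eps = eps / 2 + eps / 2 by lra.
apply: dist_le => [z z1|X Xfin].
  rewrite yL absv_distC; apply: (@cvgv_le _ _ _ (fun n => e n z - e m z) _ n0).
    by apply: cvgvB; [exact: exp_cvg|exact: cvgv_cst].
  by move=> n1 nn1; apply: (dist_bound (n0P _ _ nn1 mm)).1.
apply/ler_addgt0Pr => e' e'0; rewrite fsbig_finite//=.
pose S : seq level := fset_set X; rewrite -/S.
pose d := e' / (size S).+1%:R.
have d0 : 0 < d by rewrite divr_gt0// ltr0n.
have [n1 n1P] := @eventually_all _ S (fun l n => v (mu (x n) l - mu y l) <= d) (fun l _ => mu_cvg l d d0).
pose n2 := maxn n0 n1.
have le2 := (dist_bound (n0P _ n2 mm (leq_maxl _ _))).2 X Xfin.
rewrite fsbig_finite//= -/S in le2.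
apply: (@le_trans _ _ (\sum_(l <- S) (v (mu (x m) l - mu (x n2) l) + d))).
  rewrite big_seq [leRHS]big_seq; apply: ler_sum => l lS.
  rewrite -(subrKA (mu (x n2) l)) (le_trans (absv_triangle v _ _))// lerD2l.
  by apply: n1P => //; exact: leq_maxr.
rewrite big_split/=; apply: lerD => //.
rewrite big_const_seq count_predT iter_addr_0 -[d *+ _]mulr_natr /d mulrAC ler_pdivrMr ?ltr0n//.
by rewrite ler_pM2l// ler_nat.
Qed.

End Sequence.

Lemma partial_complete : complete_space partial.
Proof.
move=> G PG cG; have [x [xc xl]] := cauchy_filter_sequence PG cG.
have xcau eps : 0 < eps -> exists n0, forall n m, (n0 <= n)%N -> (n0 <= m)%N ->
    (dist (x n) (x m) <= eps%:E)%E.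
  by move=> /xc[n0 n0P]; exists n0 => n m nn mm; apply: ltW; exact: n0P.
have ec : exp_cauchy v (fun n => plat (x n) : set C) 1.
  move=> eps /xcau[n0 n0P]; exists n0 => n m nn mm z z1.
  exact: (dist_bound (n0P _ _ nn mm)).1.
have [rho [n0 [rho0 rho1 n0P]]] :=
  exp_cauchy_norm Hdelta HC Hv a_pole Hroot (fun n => plat_module (x n)) ec.
pose x' n := x (n0 + n)%N.
have x'c eps : 0 < eps -> exists n1, forall n m, (n1 <= n)%N -> (n1 <= m)%N ->
    (dist (x' n) (x' m) <= eps%:E)%E.
  move=> /xcau[n1 n1P]; exists n1 => n m nn mm.
  by apply: n1P; [exact: leq_trans nn (leq_addl _ _)|exact: leq_trans mm (leq_addl _ _)].
have [|y yP] := @sequence_limit x' rho rho0 rho1 _ x'c.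
  by move=> n mu; apply: n0P; exact: leq_addr.
exists y; apply: xl => e e0; have e2 : 0 < e / 2 by rewrite divr_gt0.
have [n1 n1P] := yP _ e2; exists (n0 + n1)%N => n nn.
have n0n : (n0 <= n)%N := leq_trans (leq_addr _ _) nn.
have := n1P (n - n0)%N; rewrite leq_subRL// => /(_ nn).
rewrite /x' subnKC// => H; rewrite /ball/=; apply: (le_lt_trans H).
by rewrite lte_fin ltr_pdivrMr// ltr_pMr// ltr1n.
Qed.

End Completeness.

(** * Extension of level structures and density *)

(** An ultrametric sum with a single term of largest norm does not vanish. *)
Lemma zero_sum_norms (R : realType) (C : fieldType) (v : absolute_value R C)
  (I : finType) (x : I -> C) : \sum_i x i = 0 -> (exists i, x i != 0) ->
  exists i j, [/\ i != j, x i != 0, x j != 0 & v (x i) = v (x j)].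
Proof.
move=> x0 [i1 xi1].
have [i0 _ imin] := exists_min (fun i => - v (x i)) (mem_index_enum i1).
have imax j : v (x j) <= v (x i0) by rewrite -lerN2; apply: imin; exact: mem_index_enum.
have vi0 : 0 < v (x i0) by apply: lt_le_trans (imax i1); rewrite absv_gt0.
apply: contrapT => none.
have lt j : j != i0 -> v (x j) < v (x i0).
  move=> ji; rewrite lt_neqAle imax andbT; apply/negP => /eqP E.
  by apply: none; exists j, i0; split=> //; rewrite -(absv_gt0 v) ?E.
have : v (\sum_(j | j != i0) x j) < v (x i0).
  by elim/big_ind: _ => [|y z|//]; [rewrite absv0|exact: absvD_lt].
have -> : \sum_(j | j != i0) x j = - x i0.
  by apply/eqP; rewrite -addr_eq0 addrC; move: x0; rewrite (bigD1 i0)//= => ->.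
by rewrite absvN ltxx.
Qed.

Section MaximalIdeals.
Variables (k : finFieldType) (F : fieldExtType {fraction {poly k}}).
Variables (infty : place F).
Local Notation A := (regular infty).
Let sA : is_subring A := regular_subring infty.

Lemma ideal_sub I : is_ideal infty I -> I `<=` A.
Proof. by case. Qed.

Lemma ideal0 I : is_ideal infty I -> I 0.
Proof. by case. Qed.

Lemma idealD I x y : is_ideal infty I -> I x -> I y -> I (x + y).
Proof. by case=> _ _ + _; apply. Qed.

Lemma idealM I x y : is_ideal infty I -> A x -> I y -> I (x * y).
Proof. by case=> _ _ _; apply. Qed.

Lemma ideal_sum I (T : Type) (s : seq T) (P : pred T) (f : T -> F) : is_ideal infty I ->
  (forall i, P i -> I (f i)) -> I (\sum_(i <- s | P i) f i).
Proof.
move=> HI If; elim/big_ind: _ => [|x y|//]; first exact: ideal0.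
exact: idealD.
Qed.

(** m and d generate A. *)
Lemma inv_ideal_cancel m x d : maximal_ideal infty m -> inv_ideal infty m x -> A d -> ~ m d ->
  A (x * d) -> A x.
Proof.
move=> [Hm _ mmax] mx Ad nd Axd; have [w Aw mw] := mmax _ Ad nd.
rewrite -[x]mulr1 -(subrK (w * d) 1) mulrDr; apply: (subringD sA); first exact: mx.
by rewrite mulrCA; apply: (subringM sA).
Qed.

(** If x m were contained in m then x = x m m^-1 would be in A. *)
Lemma inv_ideal_unit m x : maximal_ideal infty m -> (exists2 b, m b & b != 0) ->
  inv_ideal infty m x -> ~ A x ->
  exists2 p, m p & exists2 w, A w & m (1 - w * (x * p)).
Proof.
move=> Mm mb mx nx; have [Hm m1 mmax] := Mm.
have [[p mp np]|H] := pselect (exists2 p, m p & ~ m (x * p)).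
  by exists p => //; apply: mmax => //; exact: mx.
have [s [f [g [mf mg E]]]] := ideal_inverse Hm mb.
case: nx; rewrite -[x]mulr1 -E mulr_sumr; apply: (subring_sum sA) => i _.
rewrite mulrA mulrC; apply: mg; apply: contrapT => n; apply: H.
by exists (f i).
Qed.

(** [exists_maximal_colon] for the annihilator of c modulo A: injectivity on
    (N^-1 / A)^r may be tested on elements killed by a maximal ideal. *)
Lemma inv_ideal_multiple N (I : finType) (c : I -> F) : is_ideal infty N ->
  (exists2 b, N b & b != 0) -> (forall i, inv_ideal infty N (c i)) -> ~ (forall i, A (c i)) ->
  exists m x, [/\ maximal_ideal infty m, N `<=` m, A x,
    forall i, inv_ideal infty m (x * c i) & exists i, ~ A (x * c i)].
Proof.
move=> HN [b Nb b0] Nc nAc.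
pose J := [set y | A y /\ forall i, A (y * c i)].
have HJ : is_ideal infty J.
  split=> [y []//||y z [Ay cy] [Az cz]|y z Ay [Az cz]].
  - by split=> [|i]; rewrite ?mul0r; exact: (subring0 sA).
  - split=> [|i]; first exact: (subringD sA).
    by rewrite mulrDl; exact: (subringD sA).
  - split=> [|i]; first exact: (subringM sA).
    by rewrite -mulrA; exact: (subringM sA).
have NJ : N `<=` J.
  move=> y Ny; split; first exact: (ideal_sub HN).
  by move=> i; rewrite mulrC; exact: Nc.
have J1 : ~ J 1 by move=> [_ H]; apply: nAc => i; rewrite -[c i]mul1r.
have [x Ax Mm] := exists_maximal_colon HJ (NJ _ Nb) b0 J1.
move: Mm; set m := [set y | _] => Mm; exists m, x; split=> //.
- move=> y Ny; split; first exact: (ideal_sub HN).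
  by rewrite mulrC; apply: (idealM HJ) => //; exact: NJ.
- by move=> i y [Ay [_ H]]; have -> : x * c i * y = y * x * c i by ring.
- have [_ m1 _] := Mm; apply: contrapT => H; apply: m1; split; first exact: (subring1 sA).
  rewrite mul1r; split=> // i; apply: contrapT => n; apply: H.
  by exists i.
Qed.

End MaximalIdeals.

Section Density.
Variables (R : realType) (k : finFieldType) (F : fieldExtType {fraction {poly k}}).
Hypothesis Hk : is_constant_field F.
Variables (infty : place F) (delta : nat).
Hypothesis Hdelta : has_degree infty delta.
Variables (C : fieldType) (v : absolute_value R C) (emb : {rmorphism F -> C}).
Hypothesis HC : complete_space (metrized v).
Hypothesis Hv : forall x, v (emb x) = place_abs R infty delta x.
Hypothesis Hroot : forall (m : nat) (x : F), (0 < m)%N -> exists c, c ^+ m = emb x.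
Variables (N : set F) (r : nat).
Hypotheses (HN : is_ideal infty N) (HN0 : exists2 x, N x & x != 0).
Local Notation A := (regular infty).
Local Notation Ninv := (inv_ideal infty N).
Local Notation NL L := (Ninv_mul infty emb N L).
Local Notation level := (level_module infty N r).
Local Notation partial := (partial_level_lattice infty v emb N r).
Let sA : is_subring A := regular_subring infty.

Variable a : F.
Hypotheses (Na : N a) (a_pole : infty a < 0).
Let Aa : A a. Proof. exact: ideal_sub HN _ Na. Qed.
Let ea0 : emb a != 0. Proof. exact: emb_a_neq0 a_pole. Qed.
Let qa := v (emb a).
Let qa1 : 1 < qa. Proof. exact: (absv_a_gt1 Hdelta Hv a_pole). Qed.
Let qa0 : 0 < qa. Proof. exact: lt_trans qa1. Qed.

(** N^-1 is contained in a^-1 A, and A / a A is finite. *)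
Lemma finite_levels : exists s : seq level, forall l, l \in s.
Proof.
have a0 : a != 0 := a_neq0 a_pole.
have [s [_ sP]] := finite_residues Aa a0.
have [l0 _] : exists l0 : level, represents l0 (fun=> 0).
  by apply: exists_level => i; exact: Ninv_regular HN _ (subring0 sA).
pose Phi (t : {ffun 'I_r -> 'I_(size s)}) : level :=
  xget l0
    [set l | represents l (fun i => s`_(t i) / a)].
have fin : finite_set [set: level].
  apply: (@sub_finite_set _ _ (Phi @` setT)); last exact: finite_image.
  move=> l _; have [c lc] := level_repr l.
  have H (i : 'I_r) : exists j : 'I_(size s), A ((c i) - s`_j / a).
    have Nc := level_Ninv HN lc i.
    have Aac : A (a * c i) by rewrite mulrC; exact: Nc.
    have [y ys [w Aw E]] := sP _ Aac.
    have ys' : (index y s < size s)%N by rewrite index_mem.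
    exists (Ordinal ys'); rewrite /= nth_index//.
    have -> : c i - y / a = w; last by [].
    by apply: (mulfI a0); rewrite mulrBr [a * (y / a)]mulrCA divff// mulr1.
  have [t tP] := choice H.
  have lt : represents l (fun i => s`_([ffun i => t i] i) / a).
    apply: (level_shift lc) => i; rewrite ffunE -opprB; exact: (subringN sA (tP i)).
  exists [ffun i => t i] => //; rewrite /Phi.
  case: xgetP => [l' _ lt'|/(_ l)//].
  exact: level_eq lt' lt.
exists (fset_set [set: level]) => l.
by rewrite in_fset_set// mem_set.
Qed.

(** The norms of the powers th^0, ..., th^n of a root of degree n + 1 of the
    inverse of a uniformiser are different modulo the norms of F. If none of
    them, multiplied by a large element of F, would do, then L would contain n +
    1 elements with different norms modulo those of F, and these are independent
    over F. *)
Lemma exists_new_norm L n (T : R) : has_rank emb L n ->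
  exists2 g, T < v g & forall w y, L w -> w != 0 -> y != 0 -> v (emb y * g) != v w.
Proof.
move=> rkL; have [p pP] := place_val_unif infty.
have p0 : p != 0 by apply: contra_eq_neq pP => ->; rewrite place_val0.
have pV : infty p^-1 = - 1 by rewrite place_valV// pP.
have [th thP] := Hroot p^-1 (ltn0Sn n).
pose t := v th; have tn : t ^+ n.+1 = #|k|%:R ^ (delta%:Z).
  rewrite /t -absvX thP Hv /place_abs invr_eq0 (negPf p0) pV.
  by rewrite mulrN1 opprK.
have k0 : 0 < #|k|%:R :> R by exact: lt_trans (card_gt1R R k).
have d0 := degree_gt0 Hdelta.
have tn1 : 1 < t ^+ n.+1.
  by rewrite tn -exprnP exprn_egt1 ?card_gt1R//; lia.
have t0 : 0 <= t by exact: absv_ge0.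
have t1 : 1 < t by rewrite ltNge; apply/negP => t1; move: tn1; rewrite ltNge exprn_ile1.
have tp : 0 < t by exact: lt_trans t1.
have ve y : y != 0 -> v (emb y) = t ^ (n.+1%:Z * - infty y).
  move=> y0; rewrite Hv /place_abs (negPf y0).
  by rewrite -mulrN -[RHS]exprz_exp -exprnP tn exprz_exp.
have [M MP] : exists M : nat, T < v (emb p^-1) ^+ M by apply: (exists_pow_a Hdelta Hv); rewrite pV.
apply: contrapT => none.
have H (i : 'I_n.+1) : exists wy : C * F, [/\ L wy.1, wy.1 != 0, wy.2 != 0 &
    v (emb wy.2 * th ^+ (i + n.+1 * M)) = v wy.1].
  apply: contrapT => no; apply: none; exists (th ^+ (i + n.+1 * M)).
    rewrite absvX exprD exprM -/t (lt_le_trans MP)// -thP absvX -/t.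
    by apply: ler_peMl; [exact: exprn_ge0 (exprn_ge0 _ t0)|exact: exprn_ege1 (ltW t1)].
  move=> w y Lw w0 y0; apply/eqP => E; apply: no; exists (w, y); split=> //.
have [wy wyP] := choice H.
have [|c [c0 cE]] := @dependent_over_F _ _ _ _ _ _ _ (fun i => (wy i).1) rkL (fun i => let: And4 h _ _ _ := wyP i in h).
  by rewrite card_ord.
have [|i [j [ij]]] := zero_sum_norms v cE.
  by case: c0 => i ci; exists i; rewrite mulf_neq0 ?fmorph_eq0//; case: (wyP i).
rewrite !mulf_eq0 !negb_or !fmorph_eq0 => /andP[ci _] /andP[cj _].
have vw l : c l != 0 -> v (emb (c l) * (wy l).1) = t ^ (n.+1%:Z * (M%:Z - infty (c l) - infty (wy l).2) + l%:Z).
  move=> cl; case: (wyP l) => _ _ y0 E; rewrite absvM -E absvM !ve// absvX -/t exprnP.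
  rewrite -!expfzDr ?lt0r_neq0//; congr (t ^ _).
  rewrite PoszD PoszM; ring.
have t1' : t != 1 by rewrite gt_eqF.
rewrite !vw// => /(ieexprIz tp t1') E.
move/eqP: ij; apply; apply: val_inj => /=.
have := ltn_ord i; have := ltn_ord j; move: E; clear.
move: (M%:Z - _ - _) (M%:Z - _ - _) (i : nat) (j : nat) => X Y {}i {}j.
have [lt|lt|->] := ltgtP X Y; last by lia.
  have : n.+1%:Z * (X + 1) <= n.+1%:Z * Y by rewrite ler_pM2l// lezD1.
  by rewrite mulrDr mulr1; lia.
have : n.+1%:Z * (Y + 1) <= n.+1%:Z * X by rewrite ler_pM2l// lezD1.
by rewrite mulrDr mulr1; lia.
Qed.

Section Enlarge.
Variables (x : partial) (n : nat).
Hypotheses (nr : (n < r)%N) (rkx : has_rank emb (plat x) n).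
Let L : set C := plat x.
Let sL : is_submodule infty emb L := lattice_submodule (plat x).
Let dL : discrete_subgroup v L.
Proof. by case: (plat_module x). Qed.
Let sNL : is_submodule infty emb (NL L) := Ninv_mul_submodule HN HN0 sL.
Let HG : level_graph infty emb N L (graph x) := graphP HN HN0 x.

(** If there were exceptions y in m^-1 in each of the r directions, their r
    preimages under iota would be dependent over F, because n < r. A multiple of
    the relation with coefficients in A but not all in m, applied to the images,
    shows that one of the exceptional y is in A. *)
Lemma exists_free_index m : maximal_ideal infty m -> exists i : 'I_r, forall w y,
  inv_ideal infty m y -> graph x w (fun j => if j == i then y else 0) -> A y.
Proof.
move=> Mm; have [Hm m1 _] := Mm; apply: contrapT => none.
have H (i : 'I_r) : exists wy : C * F, [/\ inv_ideal infty m wy.2,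
    graph x wy.1 (fun j => if j == i then wy.2 else 0) & ~ A wy.2].
  apply: contrapT => no; apply: none; exists i => w y my Gy; apply: contrapT => nAy.
  by apply: no; exists (w, y).
have [wy wyP] := choice H.
have Lw i : L (emb a * (wy i).1).
  by case: (wyP i) => _ /(graph_dom HG) /(Ninv_mulP HN HN0 sL) + _; apply.
have [|c [c0 cE]] := @dependent_over_F _ _ _ _ _ _ _ _ rkx Lw; first by rewrite card_ord.
have [t [At [i nt]]] := primitive_multiple Aa a_pole c0 Hm m1.
have G0 := graph_sum sL HG (index_enum 'I_r) (fun l => graphZ HG (At l) (let: And3 _ h _ := wyP l in h)).
have w0 : \sum_l emb (t * c l) * (wy l).1 = 0.
  apply: (mulfI ea0); rewrite mulr0.
  transitivity (emb t * \sum_l emb (c l) * (emb a * (wy l).1)); last by rewrite cE mulr0.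
  rewrite !mulr_sumr.
  by apply: eq_bigr => l _; rewrite rmorphM; ring.
rewrite w0 in G0; have := graph_zero HG G0 (submodule0 sL) i.
rewrite (bigD1 i)//= eqxx big1 ?addr0 => [|l li]; last by rewrite eq_sym (negPf li) mulr0.
case: (wyP i) => my _ nAy Aty; apply: nAy.
by apply: (inv_ideal_cancel Mm my (At i) nt); rewrite mulrC.
Qed.

(** The extension of iota will map the class of y gam to that of y g. To see
    that it is injective it suffices by [inv_ideal_multiple] to consider y in
    m^-1, one maximal ideal m at a time; then y g is congruent to a multiple of
    the unit vector of [exists_free_index]. *)
Lemma exists_new_direction : exists g : 'I_r -> F, (forall i, A (g i)) /\
  forall w y c, Ninv y -> graph x w c -> (forall i, A (c i + y * g i)) -> A y.
Proof.
have [b Nb b0] := HN0; have Ab : A b by exact: ideal_sub HN _ Nb.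
have [s [us sP]] := finitely_many_maximal Ab b0.
have [d dP] := maximal_separator Ab b0.
have [i0 _] : exists i : 'I_r, true by exists (Ordinal (leq_trans (ltn0Sn n) nr)).
have H (m : set F) : exists i : 'I_r, maximal_ideal infty m -> forall w y,
    inv_ideal infty m y -> graph x w (fun j => if j == i then y else 0) -> A y.
  have [/exists_free_index[i iP]|nM] := pselect (maximal_ideal infty m); first by exists i.
  by exists i0.
have [ix ixP] := choice H.
(* modulo m, only the component ix m of g is not 0 *)
exists (fun i => \sum_(m <- s) if i == ix m then d m else 0); split.
  move=> i; rewrite big_seq; apply: (subring_sum sA) => m /sP[Mm mb].
  by case: ifP => _; [case: (dP _ Mm mb)|exact: (subring0 sA)].
move=> w y c Ny Gw Acy; apply: contrapT => nAy.
have [|m [t [Mm Nm At ty [_ nty]]]] := @inv_ideal_multiple _ _ infty N unit (fun=> y) HN HN0 (fun=> Ny).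
  by move/(_ tt).
have {}ty := ty tt; have mb := Nm _ Nb; have [Adm ndm dm] := dP _ Mm mb.
apply: nty; apply: (inv_ideal_cancel Mm ty Adm ndm).
apply: (ixP m Mm (- (emb t * w)) (t * y * d m)).
  by move=> z mz; rewrite mulrAC; apply: (subringM sA) => //; exact: ty.
have AtN : A (- t) by exact: (subringN sA).
rewrite -mulNr -rmorphN; apply: (graph_congr HG (graphZ HG AtN Gw)) => [|i].
  by rewrite subrr; exact: (submodule0 sL).
have ms : m \in s by apply/sP.
have -> : (if i == ix m then t * y * d m else 0) - - t * c i =
    t * (c i + y * \sum_(m' <- s) if i == ix m' then d m' else 0) -
    \sum_(m' <- s | m' != m) t * y * (if i == ix m' then d m' else 0).
  rewrite (bigD1_seq m)//= -mulr_sumr.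
  by case: ifP => _; ring.
apply: (subringB sA); first exact: (subringM sA).
rewrite big_seq_cond; apply: (subring_sum sA) => m' /andP[/sP[Mm' mb'] /eqP m'm].
case: ifP => _; last by rewrite mulr0; exact: (subring0 sA).
have [_ _ dm'] := dP _ Mm' mb'.
by apply: ty; apply: dm' => // E; apply: m'm.
Qed.

Section NewLattice.
Variables (gam : C) (g : 'I_r -> F).
Hypothesis gam1 : 1 < v gam.
Hypothesis Hgam : forall w y, L w -> w != 0 -> y != 0 -> v (emb y * gam) != v w.
Hypothesis Ag : forall i, A (g i).
Hypothesis Hg : forall w y c, Ninv y -> graph x w c -> (forall i, A (c i + y * g i)) -> A y.

Definition adjoin := [set z | exists w y, [/\ L w, A y & z = w + emb y * gam]].

Let vg0 : 0 < v gam. Proof. exact: lt_trans gam1. Qed.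
Let gam0 : gam != 0. Proof. by rewrite -(absv_gt0 v). Qed.

(** The choice of gam excludes that w and y gam have the same norm. *)
Lemma adjoin_norm w y : NL L w -> v (w + emb y * gam) = Num.max (v w) (v (emb y * gam)).
Proof.
move=> Nw; have [->|w0] := eqVneq w 0.
  by rewrite add0r absv0 max_r// absv_ge0.
have [->|y0] := eqVneq y 0.
  by rewrite rmorph0 mul0r addr0 absv0 max_l// absv_ge0.
have ne : v (emb y * gam) != v w.
  have Law : L (emb a * w) by move: Nw => /(Ninv_mulP HN HN0 sL); apply.
  have := Hgam Law (mulf_neq0 ea0 w0) (mulf_neq0 (a_neq0 a_pole) y0).
  rewrite rmorphM -mulrA !(absvM v (emb a)); apply: contra_neq => -> //.
have [lt|lt|E] := ltgtP (v w) (v (emb y * gam)); last by rewrite E eqxx in ne.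
  exact: absvD_eqr.
by rewrite addrC absvD_eqr.
Qed.

Lemma adjoin_eq0 w y : NL L w -> w + emb y * gam = 0 -> w = 0 /\ y = 0.
Proof.
move=> Nw E; have := adjoin_norm y Nw; rewrite E absv0 => M.
have w0 : w = 0.
  by apply/eqP; rewrite -(absv_eq0 v) eq_le absv_ge0 M le_max lexx.
split=> //; apply/eqP; move/eqP: E; rewrite w0 add0r mulf_eq0 (negPf gam0) orbF.
by rewrite fmorph_eq0.
Qed.

Lemma adjoin_sub : L `<=` adjoin.
Proof.
move=> w Lw; exists w, 0; split=> //; first exact: (subring0 sA).
by rewrite rmorph0 mul0r addr0.
Qed.

Lemma adjoin_gen : adjoin gam.
Proof.
exists 0, 1; split; [exact: (submodule0 sL)|exact: (subring1 sA)|].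
by rewrite add0r rmorph1 mul1r.
Qed.

Lemma adjoin_submodule : is_submodule infty emb adjoin.
Proof.
split=> [|z z' [w [y [Lw Ay ->]]] [w' [y' [Lw' Ay' ->]]]|b z Ab [w [y [Lw Ay ->]]]].
- exact: adjoin_sub (submodule0 sL).
- exists (w + w'), (y + y'); split; [exact: (submoduleD sL)|exact: (subringD sA)|].
  by rewrite rmorphD; ring.
- exists (emb b * w), (b * y); split; [exact: (submoduleZ sL)|exact: (subringM sA)|].
  by rewrite rmorphM; ring.
Qed.

Lemma adjoin_lattice : is_lattice infty v emb adjoin.
Proof.
split; [exact: (submodule0 adjoin_submodule)|exact: (submoduleD adjoin_submodule)|
        exact: (submoduleZ adjoin_submodule)| |].
  have [m [f [Lf fP]]] := lattice_fg (latticeP (plat x)).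
  exists m.+1, (fun i => if unlift ord0 i is Some j then f j else gam); split.
    by move=> i; case: unliftP => [j _|_]; [exact: adjoin_sub (Lf j)|exact: adjoin_gen].
  move=> z [w [y [Lw Ay ->]]]; have [b [Ab ->]] := fP _ Lw.
  exists (fun i => if unlift ord0 i is Some j then b j else y); split.
    by move=> i; case: unliftP.
  rewrite big_ord_recl unlift_none addrC; congr (_ + _).
  by apply: eq_bigr => i _; rewrite liftK.
move=> M; apply: (@sub_finite_set _ _
  ((fun wy => wy.1 + emb wy.2 * gam) @` ([set w | L w /\ v w <= M] `*` [set y | A y /\ v (emb y) <= M]))).
  move=> _ [[w [y [Lw Ay ->]]]]; rewrite adjoin_norm; last exact: (Ninv_mul_sub HN HN0 sL).
  rewrite ge_max => /andP[wM yM]; exists (w, y) => //; split; split=> //=.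
  apply: le_trans yM; rewrite absvM ler_peMr ?absv_ge0//; exact: ltW.
apply: finite_image; apply: finite_setX; first exact: (dsg_finite dL).
exact: (finite_regular_ball Hk Hdelta Hv).
Qed.

Lemma adjoin_rank : has_rank emb adjoin n.+1.
Proof.
have [b [Lb bfree bspan]] := rkx.
exists (fun i => if unlift ord0 i is Some j then b j else gam); split.
- by move=> i; case: unliftP => [j _|_]; [exact: adjoin_sub (Lb j)|exact: adjoin_gen].
- move=> c; rewrite big_ord_recl unlift_none.
  under eq_bigr do rewrite liftK.
  move=> cE; have [t [At t0 tc]] := regular_common_denom (fun i => c (lift ord0 i)) Aa a_pole.
  have Lt : L (\sum_i emb (t * c (lift ord0 i)) * b i).
    by apply: (submodule_sum sL) => i _; apply: (submoduleZ sL); [exact: tc|exact: Lb].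
  have E : \sum_i emb (t * c (lift ord0 i)) * b i + emb (t * c ord0) * gam = 0.
    have tE : emb t * (emb (c ord0) * gam + \sum_i emb (c (lift ord0 i)) * b i) = 0.
      by rewrite cE mulr0.
    rewrite -[RHS]tE mulrDr mulr_sumr addrC rmorphM mulrA; congr (_ + _).
    by apply: eq_bigr => i _; rewrite rmorphM mulrA.
  have [E1 E2] := adjoin_eq0 (Ninv_mul_sub HN HN0 sL Lt) E.
  have c0 : c ord0 = 0 by apply/eqP; move/eqP: E2; rewrite mulf_eq0 (negPf t0).
  have H := bfree _ E1.
  move=> i; case: (unliftP ord0 i) => [j ->|->//].
  by apply/eqP; move/eqP: (H j); rewrite mulf_eq0 (negPf t0).
- move=> z [w [y [Lw Ay ->]]]; have [c ->] := bspan _ Lw.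
  exists (fun i => if unlift ord0 i is Some j then c j else y).
  rewrite big_ord_recl unlift_none addrC; congr (_ + _).
  by apply: eq_bigr => i _; rewrite liftK.
Qed.

Definition adjoin_graph z c := exists w y c0,
  [/\ graph x w c0, Ninv y, z = w + emb y * gam & forall i, c i = c0 i + y * g i].

Lemma adjoin_level_graph : level_graph infty emb N adjoin adjoin_graph.
Proof.
split.
- move=> _ c [w [y [c0 [Gw Ny _ cE]]]] i; rewrite cE; apply: NinvD.
    exact: (graph_Ninv HG Gw).
  by rewrite mulrC; exact: NinvZ.
- move=> z [m [y [l [Ny Ll ->]]]].
  have H (i : 'I_m) : exists wf : C * F, [/\ L wf.1, A wf.2 & l i = wf.1 + emb wf.2 * gam].
    by have [w [f [Lw Af E]]] := Ll i; exists (w, f).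
  have [wf wfP] := choice H.
  have Nw : NL L (\sum_i emb (y i) * (wf i).1).
    by exists m, y, (fun i => (wf i).1); split=> // i; case: (wfP i).
  have [c Gc] := graph_total HG Nw.
  pose y' := \sum_i y i * (wf i).2.
  exists (fun i => c i + y' * g i), (\sum_i emb (y i) * (wf i).1), y', c; split=> //.
    rewrite /y'; elim/big_ind: _ => [|u u'|i _].
    - exact: (Ninv_regular HN (subring0 sA)).
    - exact: NinvD.
    - by rewrite mulrC; apply: NinvZ => //; case: (wfP i).
  rewrite /y' rmorph_sum mulr_suml -big_split/=; apply: eq_bigr => i _.
  by case: (wfP i) => _ _ ->; rewrite rmorphM; ring.
- move=> _ c [w [y [c0 [Gw Ny -> _]]]]; apply/(Ninv_mulP HN HN0 adjoin_submodule) => b Nb.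
  exists (emb b * w), (b * y); split.
  + by have /(Ninv_mulP HN HN0 sL) := graph_dom HG Gw; apply.
  + by rewrite mulrC; exact: Ny.
  + by rewrite rmorphM; ring.
- move=> _ c _ c' [w [y [c0 [Gw Ny -> cE]]]] [w' [y' [c0' [Gw' Ny' -> cE']]]].
  exists (w + w'), (y + y'), (fun i => c0 i + c0' i); split.
  + exact: (graphD HG).
  + exact: NinvD.
  + by rewrite rmorphD; ring.
  + by move=> i; rewrite cE cE'; ring.
- move=> b _ c Ab [w [y [c0 [Gw Ny -> cE]]]].
  exists (emb b * w), (b * y), (fun i => b * c0 i); split.
  + exact: (graphZ HG).
  + exact: NinvZ.
  + by rewrite rmorphM; ring.
  + by move=> i; rewrite cE; ring.
- move=> z c [w [y [Lw Ay ->]]] Ac.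
  exists w, y, (fun i => c i - y * g i); split=> //; last by move=> i; rewrite subrK.
    apply: (graph_lattice HG) => // i; apply: (subringB sA) => //; exact: (subringM sA).
  exact: Ninv_regular HN _ Ay.
- move=> _ c [w [y [c0 [Gw Ny -> cE]]]] Ac.
  have Ay : A y by apply: (Hg Ny Gw) => i; rewrite -cE.
  exists w, y; split=> //; apply: (graph_inj HG Gw) => i.
  have -> : c0 i = c i - y * g i by rewrite cE addrK.
  by apply: (subringB sA) => //; exact: (subringM sA).
- move=> _ c [w [y [c0 [Gw Ny -> cE]]]] [w' [y' [Lw' Ay' E]]].
  have Nw := graph_dom HG Gw.
  have [||E1 E2] := @adjoin_eq0 (w - w') (y - y').
  + by apply: (submoduleB sNL) => //; exact: (Ninv_mul_sub HN HN0 sL).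
  + by rewrite rmorphB mulrBl addrACA -opprD E subrr.
  have Ay : A y by rewrite (subr0_eq E2).
  have Lw : L w by rewrite (subr0_eq E1).
  move=> i; rewrite cE; apply: (subringD sA); last exact: (subringM sA).
  exact: (graph_zero HG Gw Lw).
Qed.

Let dL' : discrete_subgroup v adjoin.
Proof. by case: (lattice_discrete_module adjoin_lattice). Qed.

Lemma adjoin_pts T : T < v gam -> pts v adjoin T = pts v L T.
Proof.
move=> Tg; congr (fset_set _); apply/seteqP; split=> z [Lz zT]; split=> //; last exact: adjoin_sub.
case: Lz zT => w [y [Lw Ay ->]]; rewrite adjoin_norm; last exact: (Ninv_mul_sub HN HN0 sL).
have [->|y0] := eqVneq y 0; first by rewrite rmorph0 mul0r addr0.
rewrite ge_max => /andP[_ yT]; exfalso; move: yT; apply/negP; rewrite -ltNge.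
apply: (lt_le_trans Tg); rewrite absvM ler_peMl ?absv_ge0//.
exact: (absv_regular_ge1 Hk Hdelta Hv).
Qed.

(** Both lattices have the same points of norm at most T. *)
Lemma adjoin_exp z T : v z < T -> T < v gam ->
  v (exp_lattice v adjoin z) = v (exp_lattice v L z) /\
  v (exp_lattice v adjoin z - exp_lattice v L z) <= v (exp_lattice v L z) * (v z / T).
Proof.
move=> zT Tg; have E : v (exp_lattice v adjoin z) = v (exp_lattice v L z).
  by rewrite (exp_lattice_norm HC dL' zT) (exp_lattice_norm HC dL zT) adjoin_pts.
split=> //; apply: (@absvB_trans _ _ _ (zpoly (pts v L T) z)).
  by have := exp_lattice_tail HC dL' zT; rewrite adjoin_pts// E.
by rewrite absv_distC; exact: exp_lattice_tail.
Qed.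

(** The distance of w + y gam from the new lattice is at least |gam| / |a|, and
    [exp_lattice_near] applies. *)
Lemma adjoin_exp_large w y : NL L w -> Ninv y -> ~ A y ->
  v gam / qa <= v (exp_lattice v adjoin (w + emb y * gam)).
Proof.
move=> Nw Ny nAy.
have [_ [w' [y' [Lw' Ay' ->]]]] := exp_lattice_near HC dL' (w + emb y * gam).
apply: le_trans.
have -> : w + emb y * gam - (w' + emb y' * gam) = (w - w') + emb (y - y') * gam.
  by rewrite rmorphB; ring.
rewrite adjoin_norm; last first.
  by apply: (submoduleB sNL) => //; exact: (Ninv_mul_sub HN HN0 sL).
rewrite le_max; apply/orP; right; rewrite ler_pdivrMr// mulrC absvM mulrA -absvM -rmorphM.
rewrite ler_peMl ?absv_ge0//; apply: (absv_regular_ge1 Hk Hdelta Hv).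
  rewrite mulrBr; apply: (subringB sA); last exact: (subringM sA).
  by rewrite mulrC; exact: Ny.
rewrite mulf_neq0 ?(a_neq0 a_pole)// subr_eq0; apply/eqP => E; apply: nAy.
by rewrite E.
Qed.

End NewLattice.

(** Where mu was not 0 it changes little by [adjoin_exp], and its new values are
    small by [adjoin_exp_large]. *)
Lemma enlarge_mu (l : level) eps : 0 < eps -> exists2 T, 0 < T &
  forall gam g (y : partial), T < v gam -> 1 < v gam ->
    (forall w b, L w -> w != 0 -> b != 0 -> v (emb b * gam) != v w) ->
    (forall i, A (g i)) ->
    (forall w b c, Ninv b -> graph x w c -> (forall i, A (c i + b * g i)) -> A b) ->
    (plat y : set C) = adjoin gam ->
    (forall z c, graph y z c <-> adjoin_graph gam g z c) ->
    v (mu x l - mu y l) <= eps.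
Proof.
move=> e0; have [c lc] := level_repr l.
have [Ac|nAc] := pselect (forall i, A (c i)).
  have mu0 (y' : partial) : mu y' l = 0.
    apply/eqP; apply: contraT => /(mu_neq0 lc)[_ _ [nAc _]].
    by case: (nAc Ac).
  by exists 1 => // *; rewrite !mu0 subrr absv0 ltW.
have [[z Gz]|nG] := pselect (exists z, graph x z c).
  pose e := exp_lattice v L z.
  have ez0 : e != 0.
    by apply/eqP => /(exp_lattice_eq0 HC dL) Lz; apply: nAc; exact: (graph_zero HG Gz).
  have ve0 : 0 < v e by rewrite absv_gt0.
  (* so large that |z| / (T |e|) <= eps *)
  pose T := v z + 1 + v z / eps / v e.
  have T0 : 0 < T by rewrite /T addrAC ltr_wpDl ?addr_ge0 ?divr_ge0 ?absv_ge0 ?ltW.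
  have zT : v z < T.
    by rewrite /T -addrA ltrDl ltr_wpDr ?divr_ge0 ?absv_ge0 ?ltW.
  exists T => // gam g y Tg g1 Hgam Ag Hg yL yG.
  have Gy : graph y z c.
    apply/yG; exists z, 0, c; split=> //.
    - exact: (Ninv_regular HN (subring0 sA)).
    - by rewrite rmorph0 mul0r addr0.
    - by move=> i; rewrite mul0r addr0.
  rewrite (muE HN HN0 HC lc Gz nAc) (muE HN HN0 HC lc Gy nAc) yL -/L -/e.
  have [E D] := adjoin_exp g1 Hgam zT Tg; rewrite -/e in E D.
  set e' := exp_lattice v (adjoin gam) z in E D *.
  have e'0 : e' != 0 by rewrite -(absv_gt0 v) E.
  have -> : e^-1 - e'^-1 = (e' - e) / (e * e') by field; rewrite ez0 e'0.
  rewrite absvM absvV absvM E ler_pdivrMr ?mulr_gt0//.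
  apply: (le_trans D); rewrite mulrC mulrA ler_pM2r//.
  rewrite ler_pdivrMr//; apply: (@le_trans _ _ (eps * v e * (v z / eps / v e))).
    by rewrite le_eqVlt; apply/orP; left; apply/eqP; field; rewrite !lt0r_neq0.
  by rewrite ler_pM2l ?mulr_gt0// /T lerDr addr_ge0 ?absv_ge0.
have mu0 : mu x l = 0.
  by apply/eqP; apply: contraT => /(mu_neq0 lc)[z Gz _]; case: nG; exists z.
exists (qa / eps); first exact: divr_gt0.
move=> gam g y Tg g1 Hgam Ag Hg yL yG; rewrite mu0 sub0r absvN.
have [->|muy0] := eqVneq (mu y l) 0; first by rewrite absv0 ltW.
have [z Gy [_ ->]] := mu_neq0 lc muy0.
have /yG [w [b [c0 [Gw Nb -> cE]]]] := Gy.
have nAb : ~ A b.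
  move=> Ab; apply: nG; exists w; apply: (graph_congr HG Gw) => [|i].
    by rewrite subrr; exact: (submodule0 sL).
  by rewrite cE addrAC subrr add0r; exact: (subringM sA).
have := adjoin_exp_large g1 Hgam (graph_dom HG Gw) Nb nAb; rewrite -yL => large.
have vg0 : 0 < v gam by exact: lt_trans g1.
rewrite absvV -[eps]invrK lef_pV2 ?posrE ?invr_gt0//; last first.
  exact: lt_le_trans (divr_gt0 vg0 qa0) large.
apply: le_trans large; rewrite ler_pdivlMr// mulrC; exact: ltW.
Qed.

Lemma enlarge eps : 0 < eps -> exists2 y : partial, has_rank emb (plat y) n.+1 &
  (dist x y <= eps%:E)%E.
Proof.
move=> e0; have e2 : 0 < eps / 2 by rewrite divr_gt0.
have [s sP] := finite_levels.
pose d := eps / 2 / (size s).+1%:R.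
have d0 : 0 < d by rewrite divr_gt0// ltr0n.
have H (l : level) : exists T, 0 < T /\ forall gam g (y : partial), T < v gam -> 1 < v gam ->
    (forall w b, L w -> w != 0 -> b != 0 -> v (emb b * gam) != v w) ->
    (forall i, A (g i)) ->
    (forall w b c, Ninv b -> graph x w c -> (forall i, A (c i + b * g i)) -> A b) ->
    (plat y : set C) = adjoin gam ->
    (forall z c, graph y z c <-> adjoin_graph gam g z c) ->
    v (mu x l - mu y l) <= d.
  by have [T T0 TP] := enlarge_mu l d0; exists T.
have [Tl TlP] := choice H.
have [K KP] := exp_lattice_bounded HC dL 1.
have K0 : 0 <= K.
  by apply: le_trans (KP 0 _); rewrite ?absv_ge0// absv0.
pose T1 := 2 + K / (eps / 2).
have T12 : 1 < T1 by rewrite /T1 (lt_le_trans (ltr1n R 2))// lerDl divr_ge0// ltW.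
pose T := T1 + \sum_(l <- s) Tl l.
have Ts0 (P : pred level) : 0 <= \sum_(l <- s | P l) Tl l.
  by apply: sumr_ge0 => l _; rewrite ltW//; case: (TlP l).
have TT1 : T1 <= T by rewrite /T lerDl.
have [gam Tg Hgam] := exists_new_norm T rkx.
have g1 : 1 < v gam by rewrite (lt_trans T12)// (le_lt_trans TT1).
have [g [Ag Hg]] := exists_new_direction.
have [y yL yG] := exists_partial_level HN HN0 (L := Lattice (adjoin_lattice g1 Hgam)) nr
  (adjoin_rank g1 Hgam) (adjoin_level_graph g1 Hgam Ag Hg).
have yL' : (plat y : set C) = adjoin gam by rewrite yL.
exists y; first by rewrite yL; exact: adjoin_rank.
have -> : eps = eps / 2 + eps / 2 by lra.
apply: dist_le => [z z1|X Xfin].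
  rewrite yL' absv_distC.
  have [] := adjoin_exp (z := z) (T := T1) g1 Hgam.
  - exact: le_lt_trans T12.
  - exact: le_lt_trans Tg.
  move=> _; rewrite -/L => /le_trans; apply.
  have T10 : 0 < T1 by exact: lt_trans T12.
  rewrite mulrA ler_pdivrMr//; apply: (@le_trans _ _ K).
    by rewrite -[K]mulr1 ler_pM ?absv_ge0 ?KP.
  rewrite /T1 mulrDr mulrCA divff ?mulr1 ?lt0r_neq0//.
  by rewrite lerDr mulr_ge0 ?ltW.
rewrite fsbig_finite//=; pose S : seq level := fset_set X; rewrite -/S.
have uS : uniq S by exact: fset_uniq.
have szS : (size S <= size s)%N by apply: uniq_leq_size.
apply: (@le_trans _ _ (\sum_(l <- S) d)).
  apply: ler_sum => l _; have [_ TlP'] := TlP l.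
  apply: (TlP' gam g y) => //; apply: le_lt_trans Tg.
  rewrite /T (big_rem l) ?sP//= addrCA lerDl; apply: addr_ge0; first exact: ltW (lt_trans ltr01 T12).
  by apply: sumr_ge0 => l' _; rewrite ltW//; case: (TlP l').
rewrite big_const_seq count_predT iter_addr_0 -[d *+ _]mulr_natr /d mulrAC ler_pdivrMr ?ltr0n//.
by rewrite ler_pM2l// ler_nat leqW.
Qed.

End Enlarge.

Section FullRank.
Variables (x : partial).
Hypothesis rkx : has_rank emb (plat x) r.
Let L : set C := plat x.
Let sL : is_submodule infty emb L := lattice_submodule (plat x).
Let sNL : is_submodule infty emb (NL L) := Ninv_mul_submodule HN HN0 sL.
Let HG : level_graph infty emb N L (graph x) := graphP HN HN0 x.

(** Injectivity of the map to N^-1 L / L given by u, on the elements killed by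
    m. *)
Definition independent_at (m : set F) j (u : 'I_j -> C) := (forall i, L (u i)) /\
  forall c : 'I_j -> F, (forall i, inv_ideal infty m (c i)) ->
    L (\sum_i emb (c i) * u i) -> forall i, A (c i).

(** Let I be the image of L under a non-zero F-linear form h that vanishes on
    the u i. If no element w of L extended the family, there would be for each w
    some c' in m^-1 but not in A with c' h(w) in I. As 1 is in c' m + m, this
    implies that h(w) is in m I, so that I = m I, although I is invertible. *)
Lemma independent_at_step m j (u : 'I_j -> C) : maximal_ideal infty m ->
  (exists2 b, m b & b != 0) -> (j < r)%N -> independent_at m u ->
  exists u' : 'I_j.+1 -> C, independent_at m u'.
Proof.
move=> Mm mb jr [Lu um]; have [b [Lb bfree bspan]] := rkx; have [Hm m1 _] := Mm.
have [U UE] := choice (fun i => bspan _ (Lu i)).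
(* a linear form on F L that vanishes on the u i *)
have [|psi [psi0 psiU]] := @field_left_kernel F 'I_r 'I_j (fun l i => U i l).
  by rewrite !card_ord.
pose h (p : 'I_r -> F) := \sum_l psi l * p l.
have hE p p' : \sum_l emb (p l) * b l = \sum_l emb (p' l) * b l -> h p = h p'.
  move=> /eqP; rewrite -subr_eq0 -sumrB => /eqP E; apply: eq_bigr => l _; congr (_ * _).
  apply/subr0_eq; apply: (bfree (fun l => p l - p' l)).
  by rewrite -[RHS]E; apply: eq_bigr => i _; rewrite rmorphB mulrBl.
have [n [w [Lw wspan]]] := lattice_fg (latticeP (plat x)).
have [p pE] := choice (fun i => bspan _ (Lw i)).
have hL z d : L z -> z = \sum_l emb (d l) * b l ->
    exists2 y : 'I_n -> F, (forall i, A (y i)) & h d = \sum_i y i * h (p i).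
  move=> Lz zd; have [y [Ay zy]] := wspan _ Lz; exists y => //.
  rewrite (hE d (fun l => \sum_i y i * p i l)).
    rewrite /h; under eq_bigr do rewrite mulr_sumr.
    rewrite exchange_big; apply: eq_bigr => i _; rewrite mulr_sumr.
    by apply: eq_bigr => l _; rewrite mulrCA.
  rewrite -zd zy; under [RHS]eq_bigr do rewrite rmorph_sum mulr_suml.
  rewrite exchange_big; apply: eq_bigr => i _.
  by rewrite pE mulr_sumr; apply: eq_bigr => l _; rewrite rmorphM mulrA.
have hp0 : exists i, h (p i) != 0.
  apply: contrapT => none; case: psi0 => l /eqP; apply.
  have [|y _ yE] := hL (b l) (fun l' => if l' == l then 1 else 0) (Lb l).
    rewrite (bigD1 l)//= eqxx rmorph1 mul1r big1 ?addr0// => l' l'l.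
    by rewrite (negPf l'l) rmorph0 mul0r.
  have <- : h (fun l' => if l' == l then 1 else 0) = psi l.
    rewrite /h (bigD1 l)//= eqxx mulr1 big1 ?addr0// => l' l'l.
    by rewrite (negPf l'l) mulr0.
  rewrite yE big1// => i _; apply/eqP; rewrite mulf_eq0; apply/orP; right.
  by apply: contrapT => hp; apply: none; exists i; apply/negP.
have [t [At tE]] := fractional_inverse Aa a_pole hp0.
apply: contrapT => none; suff : m (\sum_i t i * h (p i)) by rewrite tE.
apply: (ideal_sum _ Hm) => i _.
have [c [c' [mc mc' Lc ncc]]] : exists (c : 'I_j -> F) c',
    [/\ forall l, inv_ideal infty m (c l), inv_ideal infty m c',
        L (\sum_l emb (c l) * u l + emb c' * w i) & ~ ((forall l, A (c l)) /\ A c')].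
  apply: contrapT => no; apply: none.
  exists (fun l => if unlift ord0 l is Some l' then u l' else w i); split.
    by move=> l; case: unliftP => [l' _|_]; [exact: Lu|exact: Lw].
  move=> c mc; rewrite big_ord_recl unlift_none.
  under eq_bigr do rewrite liftK.
  rewrite addrC => Lc; apply: contrapT => nAc; apply: no.
  exists (fun l => c (lift ord0 l)), (c ord0); split=> // -[Ac Ac0]; apply: nAc => l.
  by case: (unliftP ord0 l) => [l' ->|->]; [exact: Ac|exact: Ac0].
have nAc' : ~ A c'.
  move=> Ac'; apply: ncc; split=> //; apply: (um c mc).
  rewrite -[X in L X](addrK (emb c' * w i)); apply: (submoduleB sL) => //.
  by apply: (submoduleZ sL) => //; exact: Lw.
have [|y Ay] := hL _ (fun l => \sum_i' c i' * U i' l + c' * p i l) Lc.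
  under [RHS]eq_bigr do rewrite rmorphD rmorph_sum mulrDl mulr_suml.
  rewrite big_split/= exchange_big/=; congr (_ + _); last first.
    by rewrite pE mulr_sumr; apply: eq_bigr => l _; rewrite rmorphM mulrA.
  apply: eq_bigr => i' _; rewrite UE mulr_sumr; apply: eq_bigr => l _.
  by rewrite rmorphM mulrA.
have -> : h (fun l => \sum_i' c i' * U i' l + c' * p i l) = c' * h (p i).
  rewrite /h; under eq_bigr do rewrite mulrDr mulr_sumr.
  rewrite big_split/= exchange_big/= big1 ?add0r => [|i' _].
    by rewrite mulr_sumr; apply: eq_bigr => l _; rewrite mulrCA.
  under eq_bigr do rewrite mulrCA.
  by rewrite -mulr_sumr psiU mulr0.
move=> cE; have [q mq [z Az mz]] := inv_ideal_unit Mm mb mc' nAc'.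
have -> : t i * h (p i) =
    (z * \sum_l y l * (t i * h (p l))) * q + (t i * h (p i)) * (1 - z * (c' * q)).
  have -> : \sum_l y l * (t i * h (p l)) = t i * (c' * h (p i)).
    by rewrite cE mulr_sumr; apply: eq_bigr => l _; rewrite mulrCA.
  ring.
apply: (idealD Hm); apply: (idealM Hm) => //.
apply: (subringM sA) => //; apply: (subring_sum sA) => l _; exact: (subringM sA).
Qed.

Lemma exists_independent_at m : maximal_ideal infty m -> (exists2 b, m b & b != 0) ->
  exists u : 'I_r -> C, independent_at m u.
Proof.
move=> Mm mb; suff H j : (j <= r)%N -> exists u : 'I_j -> C, independent_at m u by exact: H.
elim: j => [_|j IH jr].
  by exists (fun=> 0); split=> [[]//|c _ _ []].
have [u um] := IH (ltnW jr); exact: independent_at_step um.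
Qed.

(** The families for the different m are put together by [maximal_separator]. *)
Lemma exists_independent_torsion : exists u : 'I_r -> C, (forall i, L (u i)) /\
  forall c : 'I_r -> F, (forall i, Ninv (c i)) -> L (\sum_i emb (c i) * u i) -> forall i, A (c i).
Proof.
have [b Nb b0] := HN0; have Ab : A b by exact: ideal_sub HN _ Nb.
have [s [us sP]] := finitely_many_maximal Ab b0.
have [d dP] := maximal_separator Ab b0.
have H (m : set F) : exists u : 'I_r -> C, maximal_ideal infty m -> m b -> independent_at m u.
  have [Mm|] := pselect (maximal_ideal infty m); last by exists (fun=> 0).
  have [mb|] := pselect (m b); last by exists (fun=> 0).
  have [|u um] := exists_independent_at Mm; first by exists b.
  by exists u.
have [u uP] := choice H.
pose u0 i := \sum_(m <- s) emb (d m) * u m i.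
exists u0; split.
  move=> i; rewrite /u0 big_seq; apply: (submodule_sum sL) => m /sP[Mm mb].
  by apply: (submoduleZ sL); [case: (dP _ Mm mb)|case: (uP m Mm mb)].
move=> c Nc Lc; apply: contrapT => nAc.
have [m [y [Mm Nm Ay my [i nyc]]]] := inv_ideal_multiple HN HN0 Nc nAc.
have mb := Nm _ Nb; have [Adm ndm dm] := dP _ Mm mb; have [Lu um] := uP m Mm mb.
apply: nyc; apply: (inv_ideal_cancel Mm (my i) Adm ndm).
apply: (um (fun i => y * c i * d m)) => [l z mz|].
  by rewrite mulrAC; apply: (subringM sA) => //; exact: my.
have ms : m \in s by apply/sP.
have -> : \sum_i emb (y * c i * d m) * u m i = emb y * (\sum_i emb (c i) * u0 i) -
    \sum_(m' <- s | m' != m) \sum_i emb (y * c i * d m') * u m' i.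
  have -> : emb y * (\sum_i emb (c i) * u0 i) =
      \sum_(m' <- s) \sum_i emb (y * c i * d m') * u m' i.
    rewrite exchange_big mulr_sumr; apply: eq_bigr => l _.
    rewrite /u0 !mulr_sumr; apply: eq_bigr => m' _; rewrite !rmorphM; ring.
  by rewrite (bigD1_seq m)//= addrK.
apply: (submoduleB sL); first exact: (submoduleZ sL).
rewrite big_seq_cond; apply: (submodule_sum sL) => m' /andP[/sP[Mm' mb'] /eqP m'm].
apply: (submodule_sum sL) => l _; apply: (submoduleZ sL); last by case: (uP m' Mm' mb').
have [_ _ dm'] := dP _ Mm' mb'.
by apply: my; apply: dm' => // E; apply: m'm.
Qed.

(** By [exists_independent_torsion] the class of c may be mapped to iota [c .
    u]; this is an injection of a finite set into itself. *)
Lemma full_rank_surjective (l : level) : exists X : torsion infty emb N (plat x), plat_iota X = l.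
Proof.
have [u [Lu uA]] := exists_independent_torsion.
have Nu (c : 'I_r -> F) : (forall i, Ninv (c i)) -> NL L (\sum_i emb (c i) * u i).
  by move=> Nc; exists r, c, u.
have H (l1 : level) : exists l' : level, forall c, represents l1 c ->
    exists2 c', represents l' c' & graph x (\sum_i emb (c i) * u i) c'.
  have [c lc] := level_repr l1; have [c' Gc'] := graph_total HG (Nu c (level_Ninv HN lc)).
  have [l' lc'] := exists_level (graph_Ninv HG Gc'); exists l' => d ld; exists c' => //.
  apply: (graph_congr HG Gc') => [|i]; last by rewrite subrr; exact: (subring0 sA).
  rewrite -sumrB; apply: (submodule_sum sL) => i _; rewrite -mulrBl -rmorphB.
  by apply: (submoduleZ sL) => //; exact: (level_sub ld lc).
have [phi phiP] := choice H.
have phi_inj : injective phi.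
  move=> l1 l2 E; have [c1 lc1] := level_repr l1; have [c2 lc2] := level_repr l2.
  have [d1 ld1 G1] := phiP _ _ lc1; have [d2 ld2 G2] := phiP _ _ lc2.
  rewrite E in ld1.
  have := graph_injective HG G1 G2 (level_sub ld1 ld2); rewrite -sumrB => Lc.
  apply: (level_eq lc1); apply: (level_shift lc2).
  apply: uA => [i|].
    apply: (NinvD (level_Ninv HN lc1 i)); rewrite -mulN1r; apply: NinvZ.
      exact: (subringN sA (subring1 sA)).
    exact: (level_Ninv HN lc2).
  rewrite (eq_bigr (fun i => emb (c1 i) * u i - emb (c2 i) * u i))// => i _.
  by rewrite rmorphB mulrBl.
have [s sP] := finite_levels.
pose S := undup s; have SP l' : l' \in S by rewrite mem_undup.
have uS : uniq (map phi S) by rewrite map_inj_uniq ?undup_uniq.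
have [|_ SE] := uniq_min_size uS (fun l' _ => SP l'); first by rewrite size_map.
have := SP l; rewrite -SE => /mapP[l' _ ->].
have [c lc] := level_repr l'; have [c' lc' [X Xz Xc]] := phiP _ _ lc.
by exists X; exact: level_eq Xc lc'.
Qed.

Lemma full_rank_full_level : full_level x.
Proof.
have [alpha alphaP] := choice full_rank_surjective.
have aK : cancel alpha (@plat_iota _ _ _ _ _ _ _ _ x) by exact: alphaP.
have Ka : cancel (@plat_iota _ _ _ _ _ _ _ _ x) alpha.
  by move=> X; apply: (plat_iota_inj (p := x)); rewrite alphaP.
have L0 : L 0 := submodule0 sL.
have LB y z : L y -> L z -> L (y - z) by exact: (submoduleB sL).
have rep X z : coset (alpha X) z -> exists2 c, graph x z c & represents X c.
  move=> Xz; have [c lc] := level_repr X; exists c => //.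
  by exists (alpha X) => //; rewrite alphaP.
have conv (X : level) z c : graph x z c -> represents X c -> coset (alpha X) z.
  move=> [Y Yz Yc] Xc; suff -> : alpha X = Y by [].
  by rewrite -[Y]Ka; congr alpha; exact: level_eq Xc Yc.
exists alpha; split=> //; split; last by exists (@plat_iota _ _ _ _ _ _ _ _ x).
split=> [X Y Z XYZ z z' /rep[c Gc Xc] /rep[c' Gc' Yc']|b X Y Ab XY z /rep[c Gc Xc]].
  by apply: (conv _ _ _ (graphD HG Gc Gc')) => i; exact: XYZ.
by apply: (conv _ _ _ (graphZ HG Ab Gc)) => i; exact: XY.
Qed.

End FullRank.

Lemma full_level_near d n (x : partial) eps : (n + d = r)%N -> has_rank emb (plat x) n ->
  0 < eps -> exists2 y : partial, full_level y & (dist x y <= eps%:E)%E.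
Proof.
elim: d n x eps => [|d IH] n x eps nd rk e0.
  rewrite addn0 in nd; exists x; last by rewrite distxx lee_fin ltW.
  by apply: full_rank_full_level; have := rk; rewrite {1}nd.
have nr : (n < r)%N by rewrite -nd addnS ltnS leq_addr.
have e2 : 0 < eps / 2 by rewrite divr_gt0.
have [y rky xy] := enlarge nr rk e2.
have [|z zf yz] := IH _ y _ _ rky e2; first by rewrite addSnnS.
exists z => //; apply: (le_trans (dist_triangle y _ _)).
have -> : eps = eps / 2 + eps / 2 by lra.
by rewrite EFinD; exact: leeD.
Qed.

Lemma full_level_dense : dense (@full_level R F infty C v emb N r).
Proof.
move=> O [x Ox] openO.
have /nbhs_ballP[e /= e0 eO] : nbhs x O by exact: open_nbhs_nbhs.
have [n nr rk] := plat_rank x.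
have [|y yf xy] := @full_level_near (r - n)%N n x (e / 2) _ rk (divr_gt0 e0 (ltr0n _ 2)).
  by rewrite subnKC.
exists y; split=> //; apply: eO; rewrite /ball/=; apply: (le_lt_trans xy).
by rewrite lte_fin ltr_pdivrMr// ltr_pMr// ltr1n.
Qed.

End Density.

(** * The theorem *)

Lemma closed_field_root (K : closedFieldType) (m : nat) (x : K) : (0 < m)%N ->
  exists y, y ^+ m = x.
Proof.
move=> m0; have sz : size ('X^m - x%:P) != 1%N.
  by rewrite size_XnsubC// eqSS -lt0n.
have [y] := closed_rootP _ sz.
by rewrite /root hornerD hornerN hornerXn hornerC subr_eq0 => /eqP E; exists y.
Qed.

Theorem theorem31 (R : realType)
  (k : finFieldType) (F : fieldExtType {fraction {poly k}})
  (Hk : is_constant_field F)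
  (infty : place F) (delta : nat) (Hdelta : has_degree infty delta)
  (Finf : fieldType) (vinf : absolute_value R Finf) (j : {rmorphism F -> Finf})
  (Hj : is_completion_of_place infty delta vinf j)
  (Kbar : closedFieldType) (i : {rmorphism Finf -> Kbar})
  (C : fieldType) (v : absolute_value R C) (h : {rmorphism Kbar -> C})
  (Hh : is_completion_of_algebraic_closure vinf i v h)
  (r : nat) (Hr : (1 <= r)%N)
  (N : set F) (HN : is_ideal infty N)
  (HN0 : exists2 x, N x & x != 0) (HN1 : N <> regular infty) :
  complete_space (partial_level_lattice infty v (h \o i \o j) N r) /\
  dense (@full_level R F infty C v (h \o i \o j) N r).
Proof.
have [_ Hvh _ HC] := Hh; have [Hvj _ _] := Hj.
have Hv x : v ((h \o i \o j) x) = place_abs R infty delta x by rewrite -Hvj -Hvh.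
have Hroot (m : nat) (x : F) : (0 < m)%N -> exists c, c ^+ m = (h \o i \o j) x.
  move=> m0; have [y yP] := closed_field_root (i (j x)) m0.
  by exists (h y); rewrite -rmorphXn yP.
have [a Na a_pole] := exists_nonconstant Hk HN HN0 HN1.
have [D [f [fP dimD]]] := exists_ev_dim a.
split.
  exact: (partial_complete Hdelta HC Hv Hroot HN HN0 Na a_pole fP dimD).
exact: (full_level_dense Hk Hdelta HC Hv Hroot HN HN0 Na a_pole).
Qed.
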